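(* Suppose that: (i) there is a constant $c_0$ independent of $p$ and $K$ with $\frac1{c_0}\le\lambda_{\min}(\boldsymbol\Sigma)\le\lambda_{\max}(\boldsymbol\Sigma)\le c_0$; (ii) there is a constant $c_1>0$ independent of $p$ and $K$ with $\min_{1\le i\ne j\le K}(\boldsymbol\mu_i-\boldsymbol\mu_j)^{\rm T}\boldsymbol\Sigma^{-1}(\boldsymbol\mu_i-\boldsymbol\mu_j)\ge c_1$; (iii) there is a constant $c_2$ independent of $n$, $p$ and $K$ with $\frac1{\min_{1\le i\le K}n_i}\le c_2\frac Kn$; and (iv) $K\le p+1$. Let $$s_n=p\sqrt{\frac{\log p}{n}}+\frac{K}{\sqrt{M_{min}}}\sqrt{\frac pn}\ \to\ 0 .$$ Then, if $K^2\sqrt{M_{max}s_n\log[(M_{max}s_n)^{-1}]}\to0$, the classic LDA rule $T_{LDA}$ is asymptotically optimal and $$\frac{R_{LDA}(\mathbf X)}{R_{OPT}}-1=O_p\Big(K^2\sqrt{M_{max}s_n\log[(M_{max}s_n)^{-1}]}\Big).$$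
   Context: There are $K\ge2$ classes; an observation from the $i$th class has distribution $N_p(\boldsymbol\mu_i,\boldsymbol\Sigma)$ with common positive definite covariance $\boldsymbol\Sigma$. All classes have prior probability $1/K$. $\mathbf X=\{\mathbf x_{ij}:1\le i\le K,1\le j\le n_i\}$ is a sample of independent observations, $\mathbf x_{ij}\sim N_p(\boldsymbol\mu_i,\boldsymbol\Sigma)$, $n=\sum_in_i$. Asymptotics: $n,p\to\infty$ (with $p$, $K$, $n_i$, $\boldsymbol\mu_i$, $\boldsymbol\Sigma$ allowed to vary with $n$), and $K$ is arbitrary (bounded or growing). $\lambda_{\min},\lambda_{\max}$ denote smallest and largest eigenvalues. $M_{min}$ and $M_{max}$ are the minimum and maximum over $1\le i\ne j\le K$ of $(\boldsymbol\mu_j-\boldsymbol\mu_i)^{\rm T}\boldsymbol\Sigma^{-1}(\boldsymbol\mu_j-\boldsymbol\mu_i)$. $\bar{\mathbf x}_i=\frac1{n_i}\sum_{j}\mathbf x_{ij}$ and $\widehat{\boldsymbol\Sigma}=\frac1n\sum_{i=1}^K\sum_{j=1}^{n_i}(\mathbf x_{ij}-\bar{\mathbf x}_i)(\mathbf x_{ij}-\bar{\mathbf x}_i)^{\rm T}$. The classic LDA rule $T_{LDA}$ assigns a new $\mathbf x$ to the class $i$ for which $\sqrt{(\mathbf x-\bar{\mathbf x}_i)^{\rm T}\widehat{\boldsymbol\Sigma}^{-1}(\mathbf x-\bar{\mathbf x}_i)}$ is smallest among the $K$ classes (if $\widehat{\boldsymbol\Sigma}$ is singular the rule may be defined arbitrarily).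 The optimal rule $T_{OPT}$ assigns $\mathbf x$ to the class $i$ with smallest $(\mathbf x-\boldsymbol\mu_i)^{\rm T}\boldsymbol\Sigma^{-1}(\mathbf x-\boldsymbol\mu_i)$; $R_{OPT}$ is its misclassification rate (the Bayes error). For a rule $T$ based on $\mathbf X$, $R_T(\mathbf X)=\sum_{i=1}^K P(\mathbf x_{\rm new}\text{ belongs to the }i\text{th class and }T(\mathbf x_{\rm new})\ne i\mid\mathbf X)$, with $\mathbf x_{\rm new}$ a new observation independent of $\mathbf X$; $R_{LDA}(\mathbf X)$ is this quantity for $T_{LDA}$. $T$ is asymptotically optimal if $R_T(\mathbf X)/R_{OPT}-1=o_p(1)$.
   Formalization: The formal theorem also assumes M_max s_n → 0; without it the rate can vanish because M_max s_n = 1 (log = 0), where the claim would force R_LDA = R_OPT with high probability and is false, or be undefined when M_max s_n > 1. *)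

(* Defs.v *)
From HB Require Import structures.
From mathcomp Require Import all_boot all_order all_algebra.
From mathcomp Require Import all_classical all_reals all_analysis.

Set Implicit Arguments.
Unset Strict Implicit.
Unset Printing Implicit Defensive.

Import Order.TTheory GRing.Theory Num.Theory.
Import numFieldNormedType.Exports.

Local Open Scope classical_set_scope.
Local Open Scope ring_scope.

Section Matrices.
Variable R : realType.

Definition qform p (A : 'M[R]_p) (v : 'cV[R]_p) : R := (v^T *m A *m v) 0 0.

Definition posdef p (A : 'M[R]_p) : Prop :=
  A^T = A /\ forall v : 'cV[R]_p, v != 0 -> 0 < qform A v.

Definition lambda_min p (A : 'M[R]_p) : R := inf [set a | eigenvalue A a].
Definition lambda_max p (A : 'M[R]_p) : R := sup [set a | eigenvalue A a].

Definition pair_dists K p (mu : 'I_K -> 'cV[R]_p) (Sigma : 'M[R]_p) : set R :=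
  [set r | exists i j : 'I_K, i != j /\ r = qform (invmx Sigma) (mu j - mu i)].

Definition M_min K p (mu : 'I_K -> 'cV[R]_p) (Sigma : 'M[R]_p) : R :=
  inf (pair_dists mu Sigma).
Definition M_max K p (mu : 'I_K -> 'cV[R]_p) (Sigma : 'M[R]_p) : R :=
  sup (pair_dists mu Sigma).

End Matrices.

Section Sigma_algebras.
Variable R : realType.

(* The sigma-algebra on S generated by a family of real-valued functions.
   For S = 'cV_p and the coordinate functions this is the Borel
   sigma-algebra of R^p. *)
Definition sigma_gen (S I : Type) (F : I -> S -> R) : set (set S) :=
  <<s [set A | exists (i : I) (B : set R), measurable B /\ A = F i @^-1` B] >>.

Definition sigma_vec (S : Type) p (X : S -> 'cV[R]_p) : set (set S) :=
  sigma_gen (fun (k : 'I_p) w => X w k 0).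

End Sigma_algebras.

Section Probability.
Variable R : realType.

Definition random_vector d (Omega : measurableType d) p
    (X : Omega -> 'cV[R]_p) : Prop :=
  forall k : 'I_p, measurable_fun [set: Omega] (fun w => X w k 0).

(* Coordinates independent, each N(0, 1).  The law is given by a set function
   Q, so that Q can also be a conditional probability given an event. *)
Definition std_normal_vector d (Omega : measurableType d)
    (Q : set Omega -> \bar R) p (Z : Omega -> 'cV[R]_p) : Prop :=
  random_vector Z /\
  forall B : 'I_p -> set R, (forall k, measurable (B k)) ->
    Q [set w | forall k, B k (Z w k 0)] =
    (\prod_(k < p) normal_prob 0 1 (B k))%E.

(* X ~ N_p(mu, Sigma) under Q: X is mu + A Z for a standard normal vector Z
   and a square root Sigma = A A^T.  For positive definite Sigma, A is
   invertible, so asking for Z on the same space as X is no restriction. *)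
Definition mvnormal d (Omega : measurableType d) (Q : set Omega -> \bar R)
    p (X : Omega -> 'cV[R]_p) (mu : 'cV[R]_p) (Sigma : 'M[R]_p) : Prop :=
  exists (A : 'M[R]_p) (Z : Omega -> 'cV[R]_p),
    [/\ A *m A^T = Sigma, std_normal_vector Q Z &
        forall w, X w = mu + A *m Z w].

Definition prob_given d (Omega : measurableType d) (P : probability Omega R)
    (E : set Omega) : set Omega -> \bar R :=
  fun B => ((fine (P E))^-1%:E * P (B `&` E))%E.

Definition independent_family d (Omega : measurableType d)
    (P : probability Omega R) (I : finType) (F : I -> set (set Omega)) : Prop :=
  forall A : I -> set Omega, (forall i, F i (A i)) ->
    P (\bigcap_i A i) = (\prod_(i : I) P (A i))%E.

Definition independent_sigma d (Omega : measurableType d)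
    (P : probability Omega R) (F G : set (set Omega)) : Prop :=
  forall A B, F A -> G B -> P (A `&` B) = (P A * P B)%E.

(* g is a version of the conditional probability P(A | F). *)
Definition cond_prob_version d (Omega : measurableType d)
    (P : probability Omega R) (F : set (set Omega)) (A : set Omega)
    (g : Omega -> R) : Prop :=
  [/\ forall B : set R, measurable B -> F (g @^-1` B),
      P.-integrable [set: Omega] (EFin \o g) &
      forall G, F G -> (\int[P]_(w in G) (g w)%:E)%E = P (A `&` G)].

Definition op1 (d : nat -> measure_display)
    (Omega : forall t, measurableType (d t))
    (P : forall t, probability (Omega t) R)
    (Z : forall t, Omega t -> R) : Prop :=
  forall e : R, 0 < e -> P t [set w | e < `|Z t w|] @[t --> \oo] --> 0%E.

Definition Op (d : nat -> measure_display)
    (Omega : forall t, measurableType (d t))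
    (P : forall t, probability (Omega t) R)
    (Z : forall t, Omega t -> R) (a : nat -> R) : Prop :=
  forall e : R, 0 < e -> exists C : R, 0 < C /\
    \forall t \near \oo,
      (P t [set w | (C * a t < `|Z t w|)%R] <= e%:E)%E.

End Probability.

Section Discriminant_analysis.
Variables (R : realType) (K p : nat).

Definition sample (n : 'I_K -> nat) : Type :=
  forall i : 'I_K, 'I_(n i) -> 'cV[R]_p.

Definition class_mean n (D : sample n) (i : 'I_K) : 'cV[R]_p :=
  (n i)%:R^-1 *: \sum_(j < n i) D i j.

Definition pooled_cov n (D : sample n) : 'M[R]_p :=
  (\sum_(i < K) n i)%:R^-1 *:
    \sum_(i < K) \sum_(j < n i)
      ((D i j - class_mean D i) *m (D i j - class_mean D i)^T).

(* A rule based on the sample: training data, then point to be classified. *)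
Definition rule (n : 'I_K -> nat) : Type := sample n -> 'cV[R]_p -> 'I_K.

Definition measurable_rule n (T : rule n) : Prop :=
  forall i : 'I_K,
    sigma_gen
      (fun (k : {l : 'I_K & 'I_(n l)} * 'I_p + 'I_p)
           (z : sample n * 'cV[R]_p) =>
         match k with
         | inl (a, c) => z.1 (tag a) (tagged a) c 0
         | inr c => z.2 c 0
         end)
      [set z | T z.1 z.2 = i].

(* Ties, and the value when the pooled covariance is singular, are left
   unspecified. *)
Definition is_LDA_rule n (T : rule n) : Prop :=
  measurable_rule T /\
  forall (D : sample n) (x : 'cV[R]_p), pooled_cov D \in unitmx ->
    forall j : 'I_K,
      Num.sqrt (qform (invmx (pooled_cov D)) (x - class_mean D (T D x))) <=
      Num.sqrt (qform (invmx (pooled_cov D)) (x - class_mean D j)).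

Definition is_optimal_rule (mu : 'I_K -> 'cV[R]_p) (Sigma : 'M[R]_p)
    (T : 'cV[R]_p -> 'I_K) : Prop :=
  (forall i, sigma_vec (@id 'cV[R]_p) [set x | T x = i]) /\
  forall x j, qform (invmx Sigma) (x - mu (T x)) <=
              qform (invmx Sigma) (x - mu j).

Variables (d : measure_display) (Omega : measurableType d).
Variable P : probability Omega R.

Definition sigma_sample n (X : Omega -> sample n) : set (set Omega) :=
  sigma_gen (fun (k : {l : 'I_K & 'I_(n l)} * 'I_p) w =>
    X w (tag k.1) (tagged k.1) k.2 0).

(* The sigma-algebra generated by the pair (class label, observation). *)
Definition sigma_labelled (y : Omega -> 'I_K) (x : Omega -> 'cV[R]_p) :
    set (set Omega) :=
  sigma_gen (fun (k : option 'I_p) w =>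
    if k is Some c then x w c 0 else (y w)%:R).

(* X is the training sample, xnew the new observation, y its class. *)
Record gaussian_classes (n : 'I_K -> nat) (mu : 'I_K -> 'cV[R]_p)
    (Sigma : 'M[R]_p) (X : Omega -> sample n)
    (y : Omega -> 'I_K) (xnew : Omega -> 'cV[R]_p) : Prop := {
  gc_cov : posdef Sigma ;
  gc_size : forall i, (0 < n i)%N ;
  gc_sample_law : forall i (j : 'I_(n i)),
    mvnormal P (fun w => X w i j) (mu i) Sigma ;
  gc_sample_indep : independent_family P
    (fun a : {l : 'I_K & 'I_(n l)} =>
       sigma_vec (fun w => X w (tag a) (tagged a))) ;
  gc_label_meas : forall i, measurable [set w | y w = i] ;
  gc_prior : forall i, P [set w | y w = i] = (K%:R^-1)%:E ;
  gc_new_law : forall i,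
    mvnormal (prob_given P [set w | y w = i]) xnew (mu i) Sigma ;
  gc_new_indep : independent_sigma P (sigma_sample X) (sigma_labelled y xnew)
}.

(* r is a version of
   R_T(X) = \sum_i P(xnew belongs to class i and T(xnew) <> i | X). *)
Definition is_cond_risk n (T : rule n) (X : Omega -> sample n)
    (y : Omega -> 'I_K) (xnew : Omega -> 'cV[R]_p) (r : Omega -> R) : Prop :=
  exists g : 'I_K -> Omega -> R,
    (forall i, cond_prob_version P (sigma_sample X)
       [set w | y w = i /\ T (X w) (xnew w) <> i] (g i)) /\
    forall w, r w = \sum_(i < K) g i w.

Definition risk (T : 'cV[R]_p -> 'I_K) (y : Omega -> 'I_K)
    (xnew : Omega -> 'cV[R]_p) : R :=
  \sum_(i < K) fine (P [set w | y w = i /\ T (xnew w) <> i]).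

End Discriminant_analysis.

Section Rates.
Variables (R : realType) (K p : nat).

Definition s_rate (n : 'I_K -> nat) (mu : 'I_K -> 'cV[R]_p)
    (Sigma : 'M[R]_p) : R :=
  let N : R := (\sum_(i < K) n i)%:R in
  p%:R * Num.sqrt (ln p%:R / N) +
  K%:R / Num.sqrt (M_min mu Sigma) * Num.sqrt (p%:R / N).

Definition lda_rate (n : 'I_K -> nat) (mu : 'I_K -> 'cV[R]_p)
    (Sigma : 'M[R]_p) : R :=
  let u := M_max mu Sigma * s_rate n mu Sigma in
  K%:R ^+ 2 * Num.sqrt (u * ln u^-1).

End Rates.

(* Main.v *)
Require Import Defs.
From HB Require Import structures.
From mathcomp Require Import all_boot all_order all_algebra.
From mathcomp Require Import all_classical all_reals all_analysis.
From mathcomp Require Import measurable_realfun measurable_function.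
From mathcomp Require Import ring lra.

Set Implicit Arguments.
Unset Strict Implicit.
Unset Printing Implicit Defensive.

Import Order.TTheory GRing.Theory Num.Theory.
Import numFieldNormedType.Exports.

Local Open Scope classical_set_scope.
Local Open Scope ring_scope.

(** Whiten class i by a root of Sigma: the new observation becomes a standard
    normal vector u, and the optimal rule prefers class j to class i when
    D / 2 <= <nu, u>, where nu is the unit vector towards the whitened mean of
    class j and D the whitened distance.  If the whitened class means are off by
    O(s D) and the whitened pooled covariance by O(s) in Frobenius norm, LDA makes
    the same comparison with <nu, u> perturbed by an affine form <c, u> + m, where
    c is orthogonal to nu, |c| = O(s) and |m| = O(s D).  The two rules can differ
    only on the wedge |<nu, u> - D / 2| <= |<c, u> + m|.  Translating by about
    (D / 2) nu with the Cameron-Martin formula, the wedge has probability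
    O(s D^2) P(<nu, u> > D / 2), and this last probability is at most the error of
    the optimal rule on class i.  Summing over j gives
    |R_LDA / R_OPT - 1| = O(K s M_max).  Chebyshev bounds on the estimation errors
    allow s to be a constant multiple of s_n with probability close to 1, and
    K u <= K^2 sqrt(u log(1 / u)) for u = M_max s_n <= 1 / e. *)

(** * Integrals under independence *)

(** The Bayes error can be exponentially small in the squared distances, so an additive bound on the
    difference of the risks says nothing about their ratio. Each wedge estimate must therefore carry
    the factor [exp (- D ^+ 2 / 8)] of the matching half-space, with every other exponent bounded
    uniformly in [D]; this is the purpose of the condition [s * D ^+ 2 <= 1], which keeps [D] times
    an error of size [s * D] bounded. The risks are compared at a frozen sample: independence of the
    new observation makes the conditional risk, off a null set, a sum of ordinary probabilities. The
    two terms of [s_n] mirror two variances: the squared Frobenius error of the covariance has mean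
    of order [p ^+ 2 / N], and the squared mean errors summed over the classes have mean of order
    [K ^+ 2 * p / N], to be compared with [s ^+ 2 * M_min]. A normal vector is known only through
    probabilities of boxes; exponential tilts and the moment generating function take the place of a
    joint density. *)

Section IndependentIntegral.
Context (R : realType) d (T : measurableType d) (P : probability T R).
Variables GF GG : set (set T).
Hypotheses (mGF : GF `<=` measurable) (mGG : GG `<=` measurable).
Hypothesis indFG : independent_sigma P <<s GF >> <<s GG >>.

(** The identity, read as a map into a coarser measurable type, is a random variable whose
    distribution is the restriction of [P]; sub-sigma-algebras can then be handled as types of their
    own. *)
Lemma measurable_sub_sigma (G : set (set T)) : G `<=` measurable ->
  measurable_fun [set: T] (id : T -> g_sigma_algebraType G).
Proof.
move=> mG _ A mA; rewrite setTI.
exact: (smallest_sub (@sigma_algebra_measurable _ T) mG).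
Qed.

Local Notation TF := (g_sigma_algebraType GF).
Local Notation TG := (g_sigma_algebraType GG).
Let idF : {mfun T >-> TF} :=
  HB.pack (id : T -> TF) (isMeasurableFun.Build _ _ _ _ _ (measurable_sub_sigma mGF)).
Let idG : {mfun T >-> TG} :=
  HB.pack (id : T -> TG) (isMeasurableFun.Build _ _ _ _ _ (measurable_sub_sigma mGG)).
Let diag (w : T) : TF * TG := (w, w).
Let mdiag : measurable_fun [set: T] diag.
Proof. exact: (measurable_fun_pair (measurable_sub_sigma mGF) (measurable_sub_sigma mGG)). Qed.
Let mdiag_pack : {mfun T >-> (TF * TG)%type} :=
  HB.pack diag (isMeasurableFun.Build _ _ _ _ _ mdiag).

Let pF := distribution P idF.
Let pG := distribution P idG.

(** Independence says precisely that the law of the diagonal map factorizes on measurable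
    rectangles, which characterizes the product measure. *)
Let distribution_diagE (X : set (TF * TG)) : measurable X ->
  (pF \x pG)%E X = distribution P mdiag_pack X.
Proof.
apply: product_measure_unique => A B mA mB.
rewrite /pF /pG /distribution /pushforward /= -(indFG mA mB); congr (P _).
Qed.

(* The diagonal map sends [P] to the product of its restrictions to the two
   sub-sigma-algebras, so Fubini-Tonelli applies. *)
Lemma integral_indep (h : TF * TG -> \bar R) :
  measurable_fun [set: (TF * TG)%type] h -> (forall z, 0 <= h z)%E ->
  (\int[P]_w h (w, w) = \int[P]_w \int[P]_w' h (w, w'))%E.
Proof.
move=> mh h0.
transitivity (\int[distribution P mdiag_pack]_z h z)%E.
  by rewrite ge0_integral_distribution.
transitivity (\int[(pF \x pG)%E]_z h z)%E.
  by apply: eq_measure_integral => A mA _; exact/esym/distribution_diagE.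
rewrite (fubini_tonelli1 h)// ge0_integral_distribution//.
- apply: eq_integral => w _ /=; rewrite /fubini_F.
  rewrite ge0_integral_distribution//.
  exact: (measurableT_comp mh (pair1_measurable (w : TF))).
- exact: measurable_fun_fubini_tonelli_F.
- by move=> w; apply: integral_ge0.
Qed.

Lemma ge0_integralM_indep (f g : T -> R) :
  measurable_fun [set: TF] f -> measurable_fun [set: TG] g ->
  (forall w, 0 <= f w) -> (forall w, 0 <= g w) ->
  (\int[P]_w (f w * g w)%:E = \int[P]_w (f w)%:E * \int[P]_w (g w)%:E)%E.
Proof.
move=> mf mg f0 g0.
have mfT : measurable_fun [set: T] f.
  exact: (measurableT_comp mf (measurable_sub_sigma mGF)).
have mgT : measurable_fun [set: T] g.
  exact: (measurableT_comp mg (measurable_sub_sigma mGG)).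
rewrite (integral_indep (h := fun z => (f z.1 * g z.2)%:E)); last 2 first.
- apply/measurable_EFinP/measurable_funM.
    exact: (measurableT_comp mf measurable_fst).
  exact: (measurableT_comp mg measurable_snd).
- by move=> z; rewrite lee_fin mulr_ge0.
transitivity (\int[P]_w ((f w)%:E * \int[P]_w' (g w')%:E))%E.
  apply: eq_integral => w _; rewrite -ge0_integralZl//.
  - exact/measurable_EFinP.
  - by move=> ? _; rewrite lee_fin.
  - by rewrite lee_fin.
apply: ge0_integralZr => //.
- exact/measurable_EFinP.
- by move=> ? _; rewrite lee_fin.
- by apply: integral_ge0 => ? _; rewrite lee_fin.
Qed.

Lemma integrableM_indep (f g : T -> R) :
  measurable_fun [set: TF] f -> measurable_fun [set: TG] g ->
  P.-integrable setT (EFin \o f) -> P.-integrable setT (EFin \o g) ->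
  P.-integrable setT (fun w => (f w * g w)%:E).
Proof.
move=> mf mg /integrableP[mf' fi] /integrableP[mg' gi].
apply/integrableP; split.
  by apply/measurable_EFinP/measurable_funM; exact/measurable_EFinP.
under eq_integral do rewrite /= normrM.
rewrite ge0_integralM_indep//; [|exact: measurableT_comp..].
rewrite lte_mul_pinfty ?integral_ge0// ge0_fin_numE ?integral_ge0//.
Qed.

Lemma integralM_indep (f g : T -> R) :
  measurable_fun [set: TF] f -> measurable_fun [set: TG] g ->
  P.-integrable setT (EFin \o f) -> P.-integrable setT (EFin \o g) ->
  (\int[P]_w (f w * g w)%:E = \int[P]_w (f w)%:E * \int[P]_w (g w)%:E)%E.
Proof.
move=> mf mg fi gi; pose h (z : TF * TG) := (f z.1 * g z.2)%:E.
have mh : measurable_fun [set: (TF * TG)%type] h.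
  apply/measurable_EFinP/measurable_funM.
    exact: (measurableT_comp mf measurable_fst).
  exact: (measurableT_comp mg measurable_snd).
have fgi := integrableM_indep mf mg fi gi.
have gfin : (\int[P]_w (g w)%:E)%E \is a fin_num by exact: integrable_fin_num.
(* Fubini for signed functions needs integrability for the product measure; it is carried over from
   [P] along the diagonal. *)
have hi : (pF \x pG)%E.-integrable setT h.
  apply/integrableP; split => //.
  rewrite (@eq_measure_integral _ _ _ _ (distribution P mdiag_pack)); last first.
    by move=> A mA _; exact: distribution_diagE.
  rewrite ge0_integral_distribution//; last exact: measurableT_comp.
  by have /integrableP[] := fgi.
transitivity (\int[distribution P mdiag_pack]_z h z)%E.
  by rewrite integral_distribution.
transitivity (\int[(pF \x pG)%E]_z h z)%E.
  by apply: eq_measure_integral => A mA _; exact/esym/distribution_diagE.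
rewrite -integral12_prod_meas1// /fubini_F /h /=.
have inner x : (\int[pG]_y (f x * g y)%:E = (f x)%:E * \int[P]_w (g w)%:E)%E.
  rewrite integral_distribution//=; last 2 first.
  - by apply/measurable_EFinP/measurable_funM => //; exact: measurable_cst.
  - exact: (integrableZl measurableT (f x) gi).
  exact: (integralZl measurableT gi (f x)).
under eq_integral do rewrite inner.
rewrite integral_distribution//=; last 2 first.
- by apply: emeasurable_funM; [exact/measurable_EFinP|exact: measurable_cst].
- by rewrite -(fineK gfin); exact: (integrableZr measurableT _ fi).
by rewrite -(fineK gfin) integralZr.
Qed.

End IndependentIntegral.

(** * Measures with a density and weighted image laws *)

Lemma density_measure (R : realType) d (T : measurableType d)
    (mu : {measure set T -> \bar R}) (w : T -> R) :
  measurable_fun setT w -> (forall x, 0 <= w x) ->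
  exists nu : {measure set T -> \bar R},
    forall A, nu A = (\int[mu]_(x in A) (w x)%:E)%E.
Proof.
move=> mw w0; pose nu A := (\int[mu]_(x in A) (w x)%:E)%E.
have nu0 : nu set0 = 0%E by rewrite /nu integral_set0.
have nu_ge0 A : (0 <= nu A)%E.
  by apply: integral_ge0 => x _; rewrite lee_fin.
have nuU : semi_sigma_additive nu.
  move=> A mA tA mUA; rewrite /nu ge0_integral_bigcup//.
  - by apply: is_cvg_ereal_nneg_natsum_cond => n _ _; exact: nu_ge0.
  - by apply/measurable_EFinP; exact: measurable_funTS.
  - by move=> x _; rewrite lee_fin.
pose m : {measure set T -> \bar R} :=
  HB.pack nu (isMeasure.Build _ _ _ nu nu0 nu_ge0 nuU).
by exists m.
Qed.

Section WeightedLaw.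
Import HBNNSimple.

(** Simple functions and monotone convergence extend the hypothesis from indicators to nonnegative
    functions. It serves both for a density ([V] the identity, [W] the density) and for one
    coordinate of a normal vector ([W] a product over the others). *)
Lemma integral_weighted_law (R : realType) d d' (T : measurableType d)
    (S : measurableType d') (P : {measure set T -> \bar R})
    (N : {measure set S -> \bar R}) (V : T -> S) (W : T -> R) (c : R) :
  measurable_fun setT V -> measurable_fun setT W -> (forall x, 0 <= W x) ->
  0 <= c ->
  (forall B, measurable B -> \int[P]_x (W x * \1_B (V x))%:E = c%:E * N B)%E ->
  forall f : S -> \bar R, measurable_fun setT f -> (forall s, 0 <= f s)%E ->
  (\int[P]_x ((W x)%:E * f (V x)) = c%:E * \int[N]_s f s)%E.
Proof.
move=> mV mW W0 c0 hW f mf f0.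
pose f_ := nnsfun_approx measurableT mf.
have f_f s : EFin (f_ n s) @[n --> \oo] --> f s.
  by apply: cvg_nnsfun_approx.
have f_nd s : {homo (fun n => f_ n s) : a b / (a <= b)%N >-> a <= b}.
  by move=> a b ab; exact/lefP/nd_nnsfun_approx.
have simple n : (\int[P]_x (W x * f_ n (V x))%:E = c%:E * \int[N]_s (f_ n s)%:E)%E.
  rewrite integralT_nnsfun sintegralE ge0_mule_fsumr; last exact: nnsfun_mulemu_ge0.
  under eq_integral => x _ do rewrite fimfunE mulr_fsumr// -fsumEFin//.
  have m1 k : measurable_fun setT (fun x => \1_(f_ n @^-1` [set k]) (V x) : R).
    by apply: measurableT_comp.
  rewrite ge0_integral_fsum//; last 2 first.
  - move=> k; apply/measurable_EFinP/measurable_funM => //.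
    exact: measurable_funM.
  - move=> k x _; rewrite lee_fin mulr_ge0// -lee_fin EFinM.
    exact: nnfun_muleindic_ge0.
  apply: eq_fsbigr => k; rewrite inE => -[s _ ks].
  have k0 : 0 <= k by rewrite -ks.
  under eq_integral => x _ do rewrite mulrCA EFinM.
  rewrite ge0_integralZl//.
  - by rewrite hW// muleCA.
  - by apply/measurable_EFinP/measurable_funM.
  - by move=> x _; rewrite lee_fin mulr_ge0.
transitivity (limn (fun n => \int[P]_x (W x * f_ n (V x))%:E)%E).
  rewrite -monotone_convergence//.
  - apply: eq_integral => x _; apply/esym/cvg_lim => //.
    by under eq_fun do rewrite EFinM; apply: cvgeZl.
  - move=> n; apply/measurable_EFinP/measurable_funM => //.
    exact: measurableT_comp.
  - by move=> n x _; rewrite lee_fin mulr_ge0.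
  - by move=> x _ a b ab; rewrite lee_fin ler_wpM2l// f_nd.
under eq_fun do rewrite simple.
have int_f : (\int[N]_s f s = limn (fun n => \int[N]_s (f_ n s)%:E))%E.
  rewrite -monotone_convergence//.
  - by apply: eq_integral => x _; exact/esym/cvg_lim.
  - by move=> n; exact/measurable_EFinP.
  - by move=> n x _; rewrite lee_fin.
  - by move=> x _ a b ab; rewrite lee_fin f_nd.
rewrite int_f limeMl//; apply: ereal_nondecreasing_is_cvgn => a b ab.
apply: ge0_le_integral => //.
- by move=> x _; rewrite lee_fin.
- exact/measurable_EFinP.
- exact/measurable_EFinP.
- by move=> x _; rewrite lee_fin f_nd.
Qed.

End WeightedLaw.

Lemma measurable_lerT (R : realType) d (T : measurableType d) (f g : T -> R) :
  measurable_fun setT f -> measurable_fun setT g ->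
  measurable [set x | f x <= g x].
Proof.
move=> mf mg; rewrite -[X in measurable X]setTI.
exact: (measurable_fun_ler mf mg measurableT (Y := [set true])).
Qed.

Lemma measurable_ltrT (R : realType) d (T : measurableType d) (f g : T -> R) :
  measurable_fun setT f -> measurable_fun setT g ->
  measurable [set x | f x < g x].
Proof.
move=> mf mg; rewrite -[X in measurable X]setTI.
exact: (measurable_fun_ltr mf mg measurableT (Y := [set true])).
Qed.

(** * Standard normal vectors and the Cameron-Martin formula *)

Section StandardNormal.
Variable R : realType.
Local Notation gauss := (normal_prob (0 : R) 1).

Lemma lebesgue_measure_shift (a : R) (B : set R) : measurable B ->
  pushforward lebesgue_measure (shift a : _ -> measurableTypeR R) B =
  lebesgue_measure B.
Proof.
move=> mB; apply/esym/lebesgue_measure_unique => //.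
  exact: (@measurable_funD _ _ _ setT id (cst a)).
move=> msh _ [[x y] _ <-] /=.
rewrite /pushforward.
have -> : shift a @^-1` `]x, y] = `]x - a, y - a]%classic.
  by apply/seteqP; split => z /=; rewrite !in_itv/= ltrBlDr lerBrDr.
rewrite !lebesgue_measure_itv/= !lte_fin ltrD2r.
by case: ifP => // _; rewrite -!EFinB; congr (_%:E); ring.
Qed.

Lemma ge0_integral_normal_prob (f : R -> \bar R) : measurable_fun setT f ->
  (forall x, 0 <= f x)%E ->
  (\int[gauss]_x f x = \int[lebesgue_measure]_x ((normal_pdf 0 1 x)%:E * f x))%E.
Proof.
move=> mf f0.
rewrite -[LHS]mul1e -(@integral_weighted_law _ _ _ _ _ lebesgue_measure gauss id (normal_pdf 0 1) 1)//.
- exact: measurable_normal_pdf.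
- by move=> x; exact: normal_pdf_ge0.
- move=> B mB; rewrite mul1e /normal_prob [RHS]integral_mkcond.
  apply: eq_integral => x _; rewrite /patch indicE.
  by case: ifP; rewrite ?mulr1 ?mulr0.
Qed.

(** Cameron-Martin on the line: completing the square turns the tilted density into
    [normal_pdf 0 1 (x - a)], and translation invariance of Lebesgue measure concludes. *)
Lemma integral_gauss_tilt (a : R) (B : set R) : measurable B ->
  (\int[gauss]_x (expR (a * x - a ^+ 2 / 2) * \1_B x)%:E =
   gauss [set x | B (x + a)%R])%E.
Proof.
move=> mB.
have mtilt : measurable_fun setT (fun x : R => expR (a * x - a ^+ 2 / 2) * \1_B x).
  apply: measurable_funM => //; apply: measurableT_comp => //.
  by apply: measurable_funB => //; exact: mulrl_measurable.
rewrite ge0_integral_normal_prob; last 2 first.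
- exact/measurable_EFinP.
- by move=> x; rewrite lee_fin mulr_ge0// expR_ge0.
have pdf_shift x : normal_pdf 0 1 x * expR (a * x - a ^+ 2 / 2) = normal_pdf 0 1 (x - a).
  rewrite !normal_pdfE// /normal_fun -mulrA -expRD; congr (_ * expR _).
  by rewrite !subr0 expr1n; field.
transitivity (\int[lebesgue_measure]_x ((normal_pdf 0 1 (x - a) * \1_B x)%:E))%E.
  by apply: eq_integral => x _; rewrite -EFinM mulrA pdf_shift.
have mg : measurable_fun setT (fun x : R => normal_pdf 0 1 (x - a) * \1_B x).
  apply: measurable_funM => //; apply: (measurableT_comp (measurable_normal_pdf 0 1)).
  by apply: measurable_funB.
have msh : measurable_fun setT (shift a : R -> measurableTypeR R).
  by apply: measurable_funD.
transitivity (\int[pushforward lebesgue_measure (shift a : _ -> measurableTypeR R)]_x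
    (normal_pdf 0 1 (x - a) * \1_B x)%:E)%E.
  by apply: eq_measure_integral => A mA _; exact/esym/lebesgue_measure_shift.
rewrite ge0_integral_pushforward//; last 2 first.
- exact/measurable_EFinP.
- by move=> x _; rewrite lee_fin mulr_ge0// normal_pdf_ge0.
rewrite /normal_prob [RHS]integral_mkcond; apply: eq_integral => x _ /=.
rewrite addrK /patch indicE.
have -> : (x \in [set x | B (x + a)]) = (x + a \in B) by apply/idP/idP; rewrite !inE.
by case: ifP => h; rewrite ?mulr1 ?mulr0.
Qed.

Lemma measurable_forall_fin d (T : measurableType d) (I : finType)
    (A : I -> set T) :
  (forall i, measurable (A i)) -> measurable [set w | forall i, A i w].
Proof.
move=> mA; have -> : [set w | forall i, A i w] = \bigcap_i A i.
  by apply/seteqP; split => w Aw i //; exact: Aw.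
by apply: fin_bigcap_measurable => //; exact: finite_finset.
Qed.

Lemma measurable_preimageT d d' (T : measurableType d) (S : measurableType d')
    (f : T -> S) (B : set S) :
  measurable_fun setT f -> measurable B -> measurable [set w | B (f w)].
Proof. by move=> mf mB; rewrite -[X in measurable X]setTI; exact: mf. Qed.

(** The definition of a standard normal vector speaks of boxes only. The indicators are exchanged
    for functions one coordinate at a time, the factors in the other coordinates acting as the
    weight of [integral_weighted_law]. *)
Lemma prod_integral_std_normal d (T : measurableType d) (P : probability T R) p
    (Z : T -> 'cV[R]_p) (f : 'I_p -> R -> R) (c : 'I_p -> R) :
  std_normal_vector P Z ->
  (forall k, measurable_fun setT (f k)) -> (forall k x, 0 <= f k x) ->
  (forall k, \int[gauss]_x (f k x)%:E = (c k)%:E)%E ->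
  (\int[P]_w (\prod_k f k (Z w k 0))%:E = (\prod_k c k)%:E)%E.
Proof.
move=> [mZ hZ] mf f0 fc.
have c0 k : 0 <= c k.
  by rewrite -lee_fin -fc; apply: integral_ge0 => x _; rewrite lee_fin.
pose N B : R := fine (gauss B).
have NE B : measurable B -> ((N B)%:E = gauss B)%E.
  by move=> mB; rewrite fineK// fin_num_measure.
pose g (s : seq 'I_p) (B : 'I_p -> set R) k := if k \in s then f k else \1_(B k).
pose gc (s : seq 'I_p) (B : 'I_p -> set R) k := if k \in s then c k else N (B k).
have mg s B k : (forall k, measurable (B k)) -> measurable_fun setT (g s B k).
  by move=> mB; rewrite /g; case: ifP => // _.
have g0 s B k x : 0 <= g s B k x by rewrite /g; case: ifP.
have gc0 s B k : 0 <= gc s B k by rewrite /gc; case: ifP => // _; exact: fine_ge0.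
(* The coordinates listed in [s] carry [f], the others still an indicator. *)
have main s B : (forall k, measurable (B k)) ->
    (\int[P]_w (\prod_k g s B k (Z w k 0))%:E = (\prod_k gc s B k)%:E)%E.
  elim: s => [|a s IH] in B *; move=> mB.
    transitivity (\int[P]_w (\1_[set w | forall k, B k (Z w k 0)] w)%:E)%E.
      apply: eq_integral => w _; congr (_%:E); rewrite indicE.
      under eq_bigr do rewrite /g/= indicE.
      have [Bw|/existsNP[k Bk]] := pselect (forall k, B k (Z w k 0)).
        by rewrite mem_set// big1// => k _; rewrite mem_set.
      rewrite (bigD1 k)//= (memNset Bk) mul0r memNset//.
    rewrite integral_indic//; last first.
      by apply: measurable_forall_fin => k; exact: measurable_preimageT.
    rewrite setIT; transitivity (\prod_(k < p) gauss (B k))%E; first exact: hZ.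
    rewrite (eq_bigr (fun k => (gc [::] B k)%:E)); first by rewrite prodEFin.
    by move=> k _; rewrite /gc/= NE//; exact: mB.
  have [as_|as_] := boolP (a \in s).
    have E k : (k \in a :: s) = (k \in s).
      by rewrite inE; case: eqP => // ->.
    transitivity (\int[P]_w (\prod_k g s B k (Z w k 0))%:E)%E.
      by apply: eq_integral => w _; congr (_%:E); apply: eq_bigr => k _; rewrite /g E.
    by rewrite IH//; congr (_%:E); apply: eq_bigr => k _; rewrite /gc E.
  pose W w := \prod_(k | k != a) g s B k (Z w k 0).
  pose C := \prod_(k | k != a) gc s B k.
  have E k : k != a -> (k \in a :: s) = (k \in s).
    by move=> /negbTE ka; rewrite inE ka.
  transitivity (\int[P]_w ((W w)%:E * (f a (Z w a 0))%:E))%E.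
    apply: eq_integral => w _; rewrite -EFinM (bigD1 a)//= mulrC; congr (_ * _)%:E.
      by apply: eq_bigr => k ka; rewrite /g E.
    by rewrite /g inE eqxx.
  have mW : measurable_fun setT W.
    rewrite /W; under eq_fun do rewrite -big_filter.
    by apply: measurable_prod => k _; apply: (measurableT_comp (mg s B k mB)).
  have := @integral_weighted_law _ _ _ _ _ P gauss (fun w => Z w a 0) W C _ _ _ _ _
    (fun x => (f a x)%:E) => ->; last 7 first.
  - exact: mZ.
  - exact: mW.
  - by move=> w; apply: prodr_ge0.
  - by apply: prodr_ge0.
  (* The weighted law of coordinate [a] is the induction hypothesis with side [a] of the box
     replaced by [B0]. *)
  - move=> B0 mB0; pose B' k := if k == a then B0 else B k.
    have mB' k : measurable (B' k).
      by rewrite /B'; case: ifP => _; [exact: mB0|exact: mB].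
    have E' k : k != a -> (g s B' k = g s B k) * (gc s B' k = gc s B k).
      by move=> /negbTE ka; rewrite /g /gc /B' ka.
    transitivity (\int[P]_w (\prod_k g s B' k (Z w k 0))%:E)%E.
      apply: eq_integral => w _; congr (_%:E); rewrite (bigD1 a)//= mulrC; congr (_ * _).
        by rewrite /g (negbTE as_) /B' eqxx.
      by apply: eq_bigr => k ka; rewrite E'.
    rewrite IH// (bigD1 a)//= mulrC EFinM; congr (_%:E * _)%E.
      by apply: eq_bigr => k ka; rewrite E'.
    by rewrite /gc (negbTE as_) /B' eqxx NE//; exact: mB0.
  - by apply/measurable_EFinP; exact: mf.
  - by move=> x; rewrite lee_fin; exact: f0.
  rewrite fc -EFinM (bigD1 a)//= mulrC; congr (_ * _)%:E.
    by rewrite /gc inE eqxx.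
  by apply: eq_bigr => k ka; rewrite /gc E.
have := main (enum 'I_p) (fun _ => setT) (fun _ => measurableT).
under eq_integral do under eq_bigr do rewrite /g mem_enum /=.
by under eq_bigr do rewrite /gc mem_enum /=.
Qed.

End StandardNormal.

(** The sets with measurable preimage form a sigma-algebra, and it contains the generators. *)
Lemma measurable_sigma_gen (R : realType) (S I : Type) (F : I -> S -> R) d
    (T : measurableType d) (phi : T -> S) :
  (forall i, measurable_fun setT (fun w => F i (phi w))) ->
  forall A, sigma_gen F A -> measurable (phi @^-1` A).
Proof.
move=> mF; suff : sigma_gen F `<=` [set B | measurable (phi @^-1` B)] by [].
apply: smallest_sub.
  split => /=; first by rewrite preimage_set0.
    by move=> B mB; rewrite setTD preimage_setC; exact: measurableC.
  by move=> B mB; rewrite preimage_bigcup; exact: bigcup_measurable.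
move=> _ [i [B [mB ->]]] /=.
exact: (measurable_preimageT (mF i) mB).
Qed.

Section CameronMartin.
Context (R : realType) d (T : measurableType d) (P : probability T R) (p : nat).
Local Notation gauss := (normal_prob (0 : R) 1).

Definition dotv (u v : 'cV[R]_p) : R := \sum_k u k 0 * v k 0.

Lemma measurable_dotv (a : 'cV[R]_p) (Z : T -> 'cV[R]_p) : random_vector Z ->
  measurable_fun setT (fun w => dotv a (Z w)).
Proof.
by move=> mZ; apply: measurable_sum => k; apply: measurable_funM => //; exact: mZ.
Qed.

Lemma measurable_sigma_vec (S : set 'cV[R]_p) (Z : T -> 'cV[R]_p) :
  random_vector Z -> sigma_vec id S -> measurable [set w | S (Z w)].
Proof. by move=> mZ; exact: measurable_sigma_gen. Qed.

Let boxes : set (set 'cV[R]_p) :=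
  [set A | exists B : 'I_p -> set R,
     (forall k, measurable (B k)) /\ A = [set v : 'cV[R]_p | forall k, B k (v k 0)]].

(** The law of [Z + a] under [P] and the law of [Z] under the tilted measure agree on boxes, where
    the exponential splits into one-dimensional tilts. Boxes are stable under intersection and
    generate the Borel sets, so the two measures coincide. *)
Lemma cameron_martin (Z : T -> 'cV[R]_p) (a : 'cV[R]_p) (S : set 'cV[R]_p) :
  std_normal_vector P Z -> sigma_vec id S ->
  P [set w | S (Z w + a)] =
  (\int[P]_(w in [set w | S (Z w)]) (expR (dotv a (Z w) - dotv a a / 2))%:E)%E.
Proof.
move=> hZ hS; have [mZ _] := hZ.
pose G := [set A | exists (i : 'I_p) (B : set R),
    measurable B /\ A = (fun v : 'cV[R]_p => v i 0) @^-1` B].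
pose V := g_sigma_algebraType G.
pose dens w := expR (dotv a (Z w) - dotv a a / 2).
have mdens : measurable_fun setT dens.
  apply: measurableT_comp => //; apply: measurable_funB => //.
  exact: measurable_dotv.
have [nu nuE] := density_measure P mdens (fun w => expR_ge0 _).
have mZV (Y : T -> 'cV[R]_p) : random_vector Y -> measurable_fun setT (Y : T -> V).
  by move=> mY _ A mA; rewrite setTI; exact: measurable_sigma_vec.
have mZa : random_vector (fun w => Z w + a).
  move=> k; under eq_fun do rewrite mxE.
  by apply: measurable_funD => //; exact: mZ.
pose m1 : {measure set V -> \bar R} := pushforward P (fun w => Z w + a : V).
pose m2 : {measure set V -> \bar R} := pushforward nu (Z : T -> V).
transitivity (m2 (mZV _ mZ) S); last by rewrite /m2 /= /pushforward nuE.
change (m1 (mZV _ mZa) S = m2 (mZV _ mZ) S).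
have boxG : boxes `<=` @measurable _ V.
  move=> _ [B [mB ->]]; apply: measurable_forall_fin => k.
  by apply: sub_sigma_algebra; exists k, (B k).
have boxT : boxes setT by exists (fun=> setT); split => //; apply/seteqP; split.
apply: (@g_sigma_algebra_measure_unique _ R V boxes boxG (fun=> setT)) => //.
- by apply/seteqP; split => // x _; exists 0%N.
- move=> _ _ [B [mB ->]] [C [mC ->]]; exists (fun k => B k `&` C k); split.
    by move=> k; exact: measurableI.
  apply/seteqP; split => v /=; first by move=> [? ?] k.
  by move=> BC; split => k; have [] := BC k.
- move=> _ [B [mB ->]]; rewrite /m1 /m2 /= /pushforward nuE.
  have mBa k : measurable [set x : R | B k (x + a k 0)].
    by apply: measurable_preimageT (mB k); exact: measurable_funD.
  transitivity (\int[P]_w (\prod_k (expR (a k 0 * Z w k 0 - a k 0 ^+ 2 / 2) *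
      \1_(B k) (Z w k 0)))%:E)%E.
    rewrite (@prod_integral_std_normal _ _ _ P p Z
      (fun k x => expR (a k 0 * x - a k 0 ^+ 2 / 2) * \1_(B k) x)
      (fun k => fine (gauss [set x | B k (x + a k 0)]))) //.
    - rewrite -prodEFin.
      transitivity (\prod_(k < p) gauss [set x | B k (x + a k 0)%R])%E.
        rewrite -(hZ.2 (fun k => [set x | B k (x + a k 0)])); last exact: mBa.
        congr (P _); apply/seteqP; split => w /= BZ k; have := BZ k; rewrite mxE//.
      by apply: eq_bigr => k _; rewrite fineK// fin_num_measure//; exact: mBa.
    - move=> k; apply: measurable_funM.
        apply: measurableT_comp; first exact: measurable_expR.
        by apply: measurable_funB => //; exact: mulrl_measurable.
      by apply: measurable_indic; exact: mB.
    - move=> k; rewrite integral_gauss_tilt; last exact: mB.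
      by rewrite fineK// fin_num_measure//; exact: mBa.
  rewrite [RHS]integral_mkcond; apply: eq_integral => w _.
  rewrite big_split/= -expR_sum /patch.
  have -> : \sum_(k < p) (a k 0 * Z w k 0 - a k 0 ^+ 2 / 2) =
      dotv a (Z w) - dotv a a / 2.
    rewrite big_split/= /dotv; congr (_ + _).
    by rewrite mulr_suml -sumrN; apply: eq_bigr => k _; rewrite expr2.
  have [/set_mem/= BZ|/negP BZ] := boolP (w \in _).
    by rewrite big1 ?mulr1// => k _; rewrite indicE mem_set//; exact: BZ.
  have /existsNP[k Bk] : ~ forall k, B k (Z w k 0).
    by move=> BZ'; apply: BZ; rewrite inE.
  by rewrite (bigD1 k)//= indicE (memNset Bk) mul0r mulr0.
- move=> _; rewrite /m1 /= /pushforward preimage_setT probability_setT.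
  exact: ltry.
(* A condition on a single coordinate is a box whose other sides are full. *)
- refine (@smallest_sub _ _ _ _ (@smallest_sigma_algebra _ setT boxes) _ _ hS).
  move=> _ [k [B [mB ->]]]; apply: sub_sigma_algebra.
  exists (fun l => if l == k then B else setT); split.
    by move=> l; case: ifP.
  apply/seteqP; split => v /=.
    by move=> Bv l; case: eqP => [->|].
  by move=> /(_ k); rewrite eqxx.
Qed.

End CameronMartin.

(** * Euclidean geometry of column vectors *)

Section DotProduct.
Variables (R : realType) (p : nat).
Implicit Types u v w : 'cV[R]_p.

Lemma dotvE u v : dotv u v = (u^T *m v) 0 0.
Proof. by rewrite mxE; apply: eq_bigr => k _; rewrite mxE. Qed.

Lemma dotvC u v : dotv u v = dotv v u.
Proof. by apply: eq_bigr => k _; rewrite mulrC. Qed.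

Lemma dotvDr u v w : dotv u (v + w) = dotv u v + dotv u w.
Proof. by rewrite -big_split; apply: eq_bigr => k _; rewrite mxE mulrDr. Qed.

Lemma dotvZr a u v : dotv u (a *: v) = a * dotv u v.
Proof. by rewrite mulr_sumr; apply: eq_bigr => k _; rewrite mxE mulrCA. Qed.

Lemma dotvNr u v : dotv u (- v) = - dotv u v.
Proof. by rewrite -scaleN1r dotvZr mulN1r. Qed.

Lemma dotvBr u v w : dotv u (v - w) = dotv u v - dotv u w.
Proof. by rewrite dotvDr dotvNr. Qed.

Lemma dotvZl a u v : dotv (a *: u) v = a * dotv u v.
Proof. by rewrite dotvC dotvZr dotvC. Qed.

Lemma dotvDl u v w : dotv (u + v) w = dotv u w + dotv v w.
Proof. by rewrite dotvC dotvDr !(dotvC w). Qed.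

Lemma dotvNl u v : dotv (- u) v = - dotv u v.
Proof. by rewrite dotvC dotvNr dotvC. Qed.

Lemma dotvBl u v w : dotv (u - v) w = dotv u w - dotv v w.
Proof. by rewrite dotvDl dotvNl. Qed.

Lemma dotvv_ge0 u : 0 <= dotv u u.
Proof. by apply: sumr_ge0 => k _; rewrite -expr2 sqr_ge0. Qed.

Lemma dotvv_eq0 u : (dotv u u == 0) = (u == 0).
Proof.
apply/idP/eqP => [|->]; last by rewrite /dotv big1// => k _; rewrite mxE mulr0.
rewrite psumr_eq0; last by move=> k _; rewrite -expr2 sqr_ge0.
move=> /allP u0; apply/colP => k; rewrite mxE.
by have := u0 k (mem_index_enum k); rewrite /= mulf_eq0 orbb => /eqP.
Qed.

Definition normv u := Num.sqrt (dotv u u).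

Lemma normv_ge0 u : 0 <= normv u. Proof. exact: sqrtr_ge0. Qed.

Lemma sqr_normv u : normv u ^+ 2 = dotv u u.
Proof. by rewrite sqr_sqrtr// dotvv_ge0. Qed.

Lemma normvZ a u : normv (a *: u) = `|a| * normv u.
Proof.
by rewrite /normv dotvZl dotvZr mulrA -expr2 sqrtrM ?sqr_ge0// sqrtr_sqr.
Qed.

Lemma CauchySchwarz_dotv u v : `|dotv u v| <= normv u * normv v.
Proof.
rewrite -sqrtrM ?dotvv_ge0// -sqrtr_sqr ler_wsqrtr//.
have [->|v0] := eqVneq v 0.
  by rewrite -(scale0r u) !dotvZr !mul0r mulr0 expr0n.
have vv : 0 < dotv v v by rewrite lt_neqAle eq_sym dotvv_eq0 v0 dotvv_ge0.
have := dotvv_ge0 (u - (dotv u v / dotv v v) *: v).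
rewrite dotvBl !dotvBr !dotvZl !dotvZr (dotvC v u).
have -> : dotv u u - dotv u v / dotv v v * dotv u v - (dotv u v / dotv v v * dotv u v
   - dotv u v / dotv v v * (dotv u v / dotv v v * dotv v v)) =
   (dotv u u * dotv v v - dotv u v ^+ 2) / dotv v v by field; rewrite gt_eqF.
by rewrite pmulr_lge0 ?invr_gt0// subr_ge0.
Qed.

Lemma normvD u v : normv (u + v) <= normv u + normv v.
Proof.
rewrite -(@ler_pXn2r _ 2) ?nnegrE ?addr_ge0 ?normv_ge0//.
rewrite sqr_normv sqrrD !sqr_normv dotvDl !dotvDr (dotvC v u).
have := le_trans (ler_norm _) (CauchySchwarz_dotv u v); lra.
Qed.

Lemma normvN u : normv (- u) = normv u.
Proof. by rewrite -scaleN1r normvZ normrN1 mul1r. Qed.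

Lemma normvB u v : normv (u - v) <= normv u + normv v.
Proof. by rewrite (le_trans (normvD _ _))// normvN. Qed.

End DotProduct.

(** * The wedge around a half-space *)

Section GaussianTails.
Context (R : realType) d (T : measurableType d) (P : probability T R) (p : nat).
Variable Z : T -> 'cV[R]_p.
Hypothesis hZ : std_normal_vector P Z.
Let mZ : random_vector Z. Proof. by case: hZ. Qed.

(** Two linear forms are enough: a wedge involves one form along [nu] and one orthogonal to it. *)
Lemma sigma_vec_borel2 (a c : 'cV[R]_p) (B : set (R * R)) :
  measurable B -> sigma_vec id [set z | B (dotv a z, dotv c z)].
Proof.
move=> mB.
set G := [set A | exists (i : 'I_p) (B : set R),
    measurable B /\ A = (fun v : 'cV[R]_p => v i 0) @^-1` B].
have mdot (u : 'cV[R]_p) :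
    measurable_fun [set: g_sigma_algebraType G] (fun z : g_sigma_algebraType G => dotv u z).
  apply: measurable_sum => k; apply: measurable_funM => //.
  by move=> _ C mC; rewrite setTI; apply: sub_sigma_algebra; exists k, C.
exact: (measurable_preimageT (measurable_fun_pair (mdot a) (mdot c)) mB).
Qed.

(** Cameron-Martin on the whole space: the tilted measure has total mass 1. *)
Lemma expectation_expR_dotv (a : 'cV[R]_p) :
  (\int[P]_w (expR (dotv a (Z w)))%:E = (expR (dotv a a / 2))%:E)%E.
Proof.
have mdot := measurable_dotv a mZ.
have mexp : measurable_fun setT (fun w => (expR (dotv a (Z w)))%:E).
  by apply/measurable_EFinP; exact: measurableT_comp.
have : (\int[P]_w (expR (dotv a (Z w) - dotv a a / 2))%:E = 1)%E.
  rewrite -(probability_setT P) -[setT in RHS]/[set w | setT (Z w + a)].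
  rewrite (cameron_martin a hZ)//.
  by have := sigma_vec_borel2 a a measurableT.
under eq_integral do rewrite addrC expRD EFinM.
rewrite ge0_integralZl//.
move=> /(congr1 (fun x => (expR (dotv a a / 2))%:E * x)%E).
by rewrite muleA -EFinM -expRD subrr expR0 mul1e mule1.
Qed.

Lemma expectation_expR_abs_dotv (a : 'cV[R]_p) :
  (\int[P]_w (expR `|dotv a (Z w)|)%:E <= (2 * expR (dotv a a / 2))%:E)%E.
Proof.
have mdot u := measurable_dotv u mZ.
have mexp u : measurable_fun setT (fun w => (expR (dotv u (Z w)))%:E).
  by apply/measurable_EFinP; apply: measurableT_comp => //; exact: mdot.
apply: (@le_trans _ _ (\int[P]_w ((expR (dotv a (Z w)))%:E + (expR (dotv (- a) (Z w)))%:E))%E).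
  apply: ge0_le_integral => //.
  - by apply/measurable_EFinP; do 2 apply: measurableT_comp => //.
  - by apply: emeasurable_funD; exact: mexp.
  - move=> w _; rewrite lee_fin dotvNl.
    by have [_|_] := ger0P (dotv a (Z w)); rewrite ?lerDl ?lerDr expR_ge0.
rewrite ge0_integralD//.
rewrite !expectation_expR_dotv -EFinD lee_fin dotvNl dotvNr opprK.
by rewrite mulr_natl mulr2n.
Qed.

Lemma measurable_average_set (E : set (measurableTypeR R * T)) (a b : R) (w : T) :
  measurable E ->
  measurable ([set h | h \in `[a, b] /\ E (h, w)] : set (measurableTypeR R)).
Proof.
move=> mE.
have -> : [set h | h \in `[a, b] /\ E (h, w)] =
    (`[a, b]%classic : set (measurableTypeR R)) `&` [set h | E (h, w)] by [].
apply: measurableI; first exact: measurable_itv.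
exact: (measurable_preimageT (pair2_measurable w) mE).
Qed.

Lemma measurable_average_measure (E : set (measurableTypeR R * T)) (a b : R) :
  measurable E ->
  measurable_fun setT (fun w =>
    lebesgue_measure ([set h | h \in `[a, b] /\ E (h, w)] : set R)).
Proof.
move=> mE.
have mE' : measurable (E `&` [set z : measurableTypeR R * T | z.1 \in `[a, b]]).
  apply: measurableI => //.
  by apply: (measurable_preimageT (B := `[a, b]%classic) measurable_fst).
have := measurable_fun_ysection (@lebesgue_measure R) mE'.
apply: eq_measurable_fun => w _ /=; congr (lebesgue_measure _).
by apply/seteqP; split => h; rewrite ysectionE /= => -[].
Qed.

Lemma measurable_average_fun (F : T -> R) (E : set (measurableTypeR R * T)) :
  measurable_fun setT F -> (forall w, 0 <= F w) -> measurable E ->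
  measurable_fun setT (fun h : measurableTypeR R =>
    \int[P]_w (F w * \1_E (h, w))%:E)%E.
Proof.
move=> mF F0 mE.
apply: (measurable_fun_fubini_tonelli_F (m2 := P) (fun z => (F z.2 * \1_E z)%:E)).
  apply/measurable_EFinP/measurable_funM; first exact: (measurableT_comp mF measurable_snd).
  exact: measurable_indic.
by move=> z; rewrite lee_fin mulr_ge0.
Qed.

(** Tonelli: averaging over shifts turns an event into the length of the set of shifts that an
    outcome admits. *)
Lemma integral_average (F : T -> R) (E : set (R * T)) (a b : R) :
  measurable_fun setT F -> (forall w, 0 <= F w) -> measurable E ->
  (\int[lebesgue_measure]_(h in `[a, b]) \int[P]_w (F w * \1_E (h, w))%:E =
   \int[P]_w ((F w)%:E * lebesgue_measure ([set h | h \in `[a, b] /\ E (h, w)] : set R)))%E.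
Proof.
move=> mF F0 mE.
pose f (z : measurableTypeR R * T) := (\1_(`[a, b] : set R) z.1 * (F z.2 * \1_E z))%:E.
have mf : measurable_fun setT f.
  apply/measurable_EFinP/measurable_funM.
    by apply: (measurableT_comp _ measurable_fst); exact: measurable_indic.
  apply: measurable_funM; first exact: (measurableT_comp mF measurable_snd).
  exact: measurable_indic.
have f0 z : (0 <= f z)%E by rewrite lee_fin !mulr_ge0.
have := fubini_tonelli (m1 := lebesgue_measure) (m2 := P) f mf f0.
have mEx h : measurable_fun setT (fun w => \1_E (h, w) : R).
  by apply: (measurableT_comp (measurable_indic mE)); exact: pair1_measurable.
have -> : (\int[lebesgue_measure]_x \int[P]_y f (x, y) =
  \int[lebesgue_measure]_(h in `[a, b]) \int[P]_w (F w * \1_E (h, w))%:E)%E.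
  rewrite [RHS]integral_mkcond; apply: eq_integral => h _.
  under eq_integral do rewrite /f /= EFinM.
  rewrite ge0_integralZl//; last 2 first.
  - by apply/measurable_EFinP; exact: measurable_funM.
  - by move=> w _; rewrite lee_fin mulr_ge0.
  by rewrite indicE /patch; case: ifP; rewrite ?mul1e ?mul0e.
move=> ->; apply: eq_integral => w _.
rewrite /f /=.
have mS : measurable [set h : measurableTypeR R | E (h, w)].
  exact: (measurable_preimageT (pair2_measurable w) mE).
transitivity (\int[lebesgue_measure]_x ((F w)%:E *
    (\1_([set h : R | h \in `[a, b] /\ E (h, w)]) x)%:E))%E.
  apply: eq_integral => h _; rewrite -EFinM; congr (_%:E).
  rewrite mulrCA; congr (_ * _).
  rewrite !indicE -natrM mulnb; congr ((nat_of_bool _)%:R).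
  by apply/andP/idP; rewrite !inE.
have mS' : measurable ([set h | h \in `[a, b] /\ E (h, w)] : set (measurableTypeR R)).
  have -> : [set h | h \in `[a, b] /\ E (h, w)] =
      (`[a, b]%classic : set (measurableTypeR R)) `&` [set h | E (h, w)] by [].
  exact: measurableI.
rewrite ge0_integralZl//; last 2 first.
- by apply/measurable_EFinP; exact: measurable_indic.
- by rewrite lee_fin.
by rewrite integral_indic// setIT.
Qed.

(* Cameron-Martin with every shift [- (D / 2 + h) nu], [h] in [[0, 1]], averaged
   over [h]: for a fixed outcome the admissible [h] form an interval of length
   [2 * `|<c, Z> + m|], so [Z] need not be split along [nu]. *)
Lemma prob_wedge_le_integral (nu c : 'cV[R]_p) (m D : R) :
  dotv nu nu = 1 -> dotv nu c = 0 -> 0 <= D ->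
  (P [set w | (`|dotv nu (Z w) - D / 2| <= `|dotv c (Z w) + m|)%R] <=
   \int[P]_w (expR (1 / 2 - D ^+ 2 / 8) *
     (expR ((D / 2 + 1) * `|dotv c (Z w) + m|) * (2 * `|dotv c (Z w) + m|)))%:E)%E.
Proof.
move=> nu1 nuc D0; set B := [set w | _].
have mdot u := measurable_dotv u mZ.
pose g w := dotv c (Z w) + m.
have mg : measurable_fun setT g by apply: measurable_funD.
have mB : measurable B.
  apply: measurable_lerT; apply: measurableT_comp => //.
  exact: measurable_funB.
pose F w := expR (1 / 2 - D ^+ 2 / 8) * expR ((D / 2 + 1) * `|g w|).
have mF : measurable_fun setT F.
  apply: measurable_funM => //; apply: measurableT_comp => //.
  by apply: measurable_funM => //; exact: measurableT_comp.
have F0 w : 0 <= F w by rewrite mulr_ge0 ?expR_ge0.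
pose E : set (measurableTypeR R * T) := [set z | `|dotv nu (Z z.2) + z.1| <= `|g z.2|].
have mE : measurable E.
  apply: measurable_lerT; apply: measurableT_comp => //.
    by apply: measurable_funD => //; exact: (measurableT_comp (mdot nu) measurable_snd).
  exact: (measurableT_comp mg measurable_snd).
have mEh h : measurable [set w | E (h, w)].
  exact: (measurable_preimageT (pair1_measurable (h : measurableTypeR R)) mE).
have shift_le h : h \in `[0, 1] -> (P B <= \int[P]_w (F w * \1_E (h, w))%:E)%E.
  rewrite in_itv/= => /andP[h0 h1].
  pose a := - (D / 2 + h) *: nu.
  pose S := [set z : 'cV[R]_p | `|dotv nu z + h| <= `|dotv c z + m|].
  have -> : B = [set w | S (Z w + a)].
    apply/seteqP; split => w; rewrite /B /S /a /= !dotvDr !dotvZr nu1 (dotvC c nu) nuc;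
      by rewrite mulr0 addr0 mulr1 opprD addrA addrNK.
  rewrite (cameron_martin a hZ); last first.
    apply: (sigma_vec_borel2 nu c (B := [set x | `|x.1 + h| <= `|x.2 + m|])).
    by apply: measurable_lerT; apply: measurableT_comp => //; exact: measurable_funD.
  rewrite integral_mkcond; apply: ge0_le_integral => //.
  - by move=> w _; rewrite /patch; case: ifP => // _; rewrite lee_fin expR_ge0.
  - apply/(measurable_restrictT _ (mEh h)); apply: measurable_funTS.
    apply/measurable_EFinP; apply: measurableT_comp => //.
    exact: measurable_funB.
  - apply/measurable_EFinP; apply: measurable_funM => //.
    exact: (measurable_indic (mEh h)).
  move=> w _; rewrite /patch indicE.
  have -> : (w \in [set w | S (Z w)]) = ((h, w) \in E) by apply/idP/idP; rewrite !inE.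
  case: ifPn => [|_]; rewrite ?mulr0// inE /E /= => Ew.
  (* With [q = D / 2 + h] and [v = <nu, Z>] the exponent is [- q * v - q ^+ 2 / 2 = - q * (v + h) +
     h ^+ 2 / 2 - D ^+ 2 / 8]. On [E] one has [- G <= v + h], and [h] in [[0, 1]] gives
     [q <= D / 2 + 1] and [h ^+ 2 / 2 <= 1 / 2]. *)
  rewrite lee_fin mulr1 /F -expRD ler_expR /a dotvZl !dotvZr dotvZl nu1.
  set v := dotv nu (Z w) in Ew *; set G := `|g w| in Ew *.
  have G0 : 0 <= G by exact: normr_ge0.
  have : - G <= v + h by move: Ew; rewrite ler_norml => /andP[].
  nra.
have Leb w : (lebesgue_measure ([set h | h \in `[0%R, 1%R] /\ E (h, w)] : set R) <= (2 * `|g w|)%:E)%E.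
  pose v := dotv nu (Z w).
  apply: (@le_trans _ _ (lebesgue_measure (`[- `|g w| - v, `|g w| - v] : set R))).
    apply: le_measure; rewrite ?inE.
    - exact: measurable_average_set.
    - exact: measurable_itv.
    - by move=> h [_]; rewrite /E /= in_itv/= ler_norml lerBlDl lerBrDl.
  rewrite lebesgue_measure_itv/= lte_fin; case: ifPn => _.
    by rewrite -EFinB lee_fin; lra.
  by rewrite lee_fin mulr_ge0.
apply: (@le_trans _ _ (\int[lebesgue_measure]_(h in `[0%R, 1%R]) \int[P]_w (F w * \1_E (h, w))%:E)%E).
  apply: (@le_trans _ _ (\int[lebesgue_measure]_(h in `[0%R, 1%R]) P B)%E).
    rewrite integral_cst//= lebesgue_measure_itv/= lte_fin ltr01 -EFinB subr0.
    by rewrite mule1.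
  apply: ge0_le_integral => //.
  by apply/measurable_funTS; apply: measurable_average_fun.
rewrite (integral_average 0 1 mF F0 mE).
apply: ge0_le_integral => //.
- by move=> w _; rewrite mule_ge0 ?lee_fin.
- apply: emeasurable_funM; first exact/measurable_EFinP.
  exact: measurable_average_measure.
- apply/measurable_EFinP/measurable_funM => //; apply: measurable_funM.
    by apply: measurableT_comp => //; apply: measurable_funM => //; exact: measurableT_comp.
  by apply: measurable_funM => //; exact: measurableT_comp.
- move=> w _; rewrite mulrA -/(g w) -/(F w) [leRHS]EFinM.
  by rewrite lee_wpmul2l ?lee_fin.
Qed.

Lemma expR1_ge2 : 2 <= expR 1 :> R.
Proof. by have := expR_ge1Dx (1 : R); lra. Qed.

(** Absorbs the width of the wedge into an exponential while keeping a small factor [L^-1]; [L]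
    stays free so that it can be taken of order [(s * D)^-1]. *)
Lemma ler_expR_divl (x L : R) : 0 < L -> x <= expR (L * x) / L.
Proof.
move=> L0; rewrite ler_pdivlMr// mulrC.
by apply: le_trans (expR_ge1Dx _); rewrite lerDr.
Qed.

Lemma expectation_expR_abs_le (c : 'cV[R]_p) (s : R) : 0 <= s ->
  (\int[P]_w (expR (s * `|dotv c (Z w)|))%:E <=
   (2 * expR (s ^+ 2 * dotv c c / 2))%:E)%E.
Proof.
move=> s0; have := expectation_expR_abs_dotv (s *: c).
rewrite dotvZl dotvZr mulrA -expr2.
by under eq_integral do rewrite dotvZl normrM (ger0_norm s0).
Qed.

(** Once the width is absorbed, the integrand is a single exponential of [|<c, Z>|] at rate
    [D / 2 + 1 + L], whose mean is bounded by the Gaussian moment generating function. *)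
Lemma prob_wedge_le (nu c : 'cV[R]_p) (m D b L : R) :
  dotv nu nu = 1 -> dotv nu c = 0 -> 0 <= D -> 0 < L -> `|m| <= b ->
  (P [set w | (`|dotv nu (Z w) - D / 2| <= `|dotv c (Z w) + m|)%R] <=
   (4 / L * expR (1 / 2 - D ^+ 2 / 8 + (D / 2 + 1 + L) * b +
      (D / 2 + 1 + L) ^+ 2 * dotv c c / 2))%:E)%E.
Proof.
move=> nu1 nuc D0 L0 mb; pose s := D / 2 + 1 + L.
have s0 : 0 <= s by rewrite /s; lra.
have mdot u := measurable_dotv u mZ.
apply: le_trans (prob_wedge_le_integral m nu1 nuc D0) _.
pose K := 2 / L * expR (1 / 2 - D ^+ 2 / 8 + s * b).
have K0 : 0 <= K by rewrite mulr_ge0 ?expR_ge0// divr_ge0// ltW.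
have mabs : measurable_fun setT (fun w => expR (s * `|dotv c (Z w)|)).
  apply: measurableT_comp => //; apply: measurable_funM => //.
  exact: measurableT_comp.
apply: (@le_trans _ _ (\int[P]_w (K%:E * (expR (s * `|dotv c (Z w)|))%:E))%E).
  apply: ge0_le_integral => //.
  - apply/measurable_EFinP; apply: measurable_funM => //.
    have mg : measurable_fun setT (fun w => `|dotv c (Z w) + m|).
      by apply: measurableT_comp => //; exact: measurable_funD.
    apply: measurable_funM; last exact: measurable_funM.
    by apply: measurableT_comp => //; exact: measurable_funM.
  - apply/measurable_EFinP; exact: measurable_funM.
  - move=> w _; rewrite -EFinM lee_fin.
    set x := `|dotv c (Z w) + m|; set y := `|dotv c (Z w)|.
    have xy : x <= y + b by rewrite (le_trans (ler_normD _ _))// lerD2l.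
    have x0 : 0 <= x by exact: normr_ge0.
    apply: (@le_trans _ _ (expR (1 / 2 - D ^+ 2 / 8) *
        (expR ((D / 2 + 1) * x) * (2 * (expR (L * x) / L))))).
      by rewrite !ler_wpM2l ?expR_ge0// ler_expR_divl.
    have -> : expR (1 / 2 - D ^+ 2 / 8) * (expR ((D / 2 + 1) * x) * (2 * (expR (L * x) / L))) =
       2 / L * expR (1 / 2 - D ^+ 2 / 8 + s * x).
      set A := 1 / 2 - D ^+ 2 / 8; set B := (D / 2 + 1) * x.
      have -> : A + s * x = A + B + L * x by rewrite /s /B; ring.
      by rewrite !expRD; field; rewrite gt_eqF.
    rewrite /K -[leRHS]mulrA -expRD ler_wpM2l ?divr_ge0 ?(ltW L0)// ler_expR.
    by have := ler_wpM2l s0 xy; rewrite mulrDr; lra.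
rewrite ge0_integralZl//; last exact/measurable_EFinP.
apply: le_trans (lee_wpmul2l _ (expectation_expR_abs_le c s0)) _; first by rewrite lee_fin.
rewrite -EFinM lee_fin /K -/s [X in _ <= _ * X]expRD.
by rewrite le_eqVlt; apply/orP; left; apply/eqP; field; rewrite gt_eqF.
Qed.

(** The exponential Markov inequality at rate 2 bounds the complement by [2 * expR (- 2)], at most
    [1 / 2] because [2 <= expR 1]. *)
Lemma prob_abs_le2 (nu : 'cV[R]_p) : dotv nu nu = 1 ->
  ((1 / 2)%:E <= P [set w | (`|dotv nu (Z w)| <= 2)%R])%E.
Proof.
move=> nu1; have mdot := measurable_dotv nu mZ.
have mabs : measurable_fun setT (fun w => `|dotv nu (Z w)|) by exact: measurableT_comp.
have mA : measurable [set w | (2 < `|dotv nu (Z w)|)%R] by exact: measurable_ltrT.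
have -> : [set w | `|dotv nu (Z w)| <= 2] = ~` [set w | 2 < `|dotv nu (Z w)|].
  by apply/seteqP; split => w /=; rewrite leNgt => /negP.
rewrite probability_setC//.
suff : (P [set w | (2 < `|dotv nu (Z w)|)%R] <= (1 / 2)%:E)%E.
  have PA := fin_num_measure P _ mA.
  by rewrite -(fineK PA) -EFinB !lee_fin; lra.
apply: (@le_trans _ _ (\int[P]_w ((expR (- 4))%:E * (expR (2 * `|dotv nu (Z w)|))%:E))%E).
  rewrite -(setIT [set w | _]) -integral_indic//.
  apply: ge0_le_integral => //.
  - by apply/measurable_EFinP; exact: measurable_indic.
  - apply/measurable_EFinP/measurable_funM => //; apply: measurableT_comp => //.
    exact: measurable_funM.
  - move=> w _; rewrite -EFinM lee_fin -expRD indicE.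
    have [|_] := boolP (w \in _); last by rewrite expR_ge0.
    by rewrite inE /= => w2; rewrite -[leLHS]expR0 ler_expR; lra.
rewrite ge0_integralZl//; last first.
  apply/measurable_EFinP; apply: measurableT_comp => //.
  exact: measurable_funM.
apply: le_trans (lee_wpmul2l _ (expectation_expR_abs_le nu _)) _ => //.
rewrite -EFinM lee_fin nu1 mulrCA -expRD.
have -> : - 4 + 2 ^+ 2 * 1 / 2 = - (1 + 1) :> R by lra.
have := expR1_ge2; rewrite expRN expRD => e2.
have : 0 < expR 1 * expR 1 :> R by nra.
move=> e0; rewrite ler_pdivrMr//; nra.
Qed.

(** Only the slab of width [r] beyond [D / 2] is kept, and Cameron-Martin is averaged over shifts
    [h] in [[-3, 3]]. When [|<nu, Z>| <= 2], which has probability at least [1 / 2], the admissible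
    shifts fill an interval of length [r] inside [[-3, 3]], as [r <= 1]. The denominator 12 is this
    2 times the length 6. *)
Lemma prob_halfspace_ge (nu : 'cV[R]_p) (D r : R) :
  dotv nu nu = 1 -> 0 <= D -> 0 < r <= 1 ->
  ((r / 12 * expR (- (D ^+ 2 / 8) - (D / 2 + 3) * r))%:E <=
   P [set w | (D / 2 < dotv nu (Z w))%R])%E.
Proof.
move=> nu1 D0 /andP[r0 r1]; set K := expR _.
have mdot := measurable_dotv nu mZ.
pose B := [set w | D / 2 < dotv nu (Z w) /\ dotv nu (Z w) <= D / 2 + r].
have mB : measurable B.
  by apply: measurableI; [exact: measurable_ltrT|exact: measurable_lerT].
apply: (@le_trans _ _ (P B)); last first.
  by apply: le_measure; rewrite ?inE//; [exact: measurable_ltrT|move=> w []].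
pose E : set (measurableTypeR R * T) :=
  [set z | 0 < dotv nu (Z z.2) + z.1 /\ dotv nu (Z z.2) + z.1 <= r].
have mE : measurable E.
  have ms : measurable_fun setT (fun z : measurableTypeR R * T => dotv nu (Z z.2) + z.1).
    by apply: measurable_funD => //; exact: (measurableT_comp mdot measurable_snd).
  by apply: measurableI; [exact: measurable_ltrT|exact: measurable_lerT].
have mEh h : measurable [set w | E (h, w)].
  exact: (measurable_preimageT (pair1_measurable (h : measurableTypeR R)) mE).
have K0 : 0 <= K by exact: expR_ge0.
have shift_ge h : h \in `[(- 3)%R, 3%R] -> (\int[P]_w (K * \1_E (h, w))%:E <= P B)%E.
  rewrite in_itv/= => /andP[h0 h1].
  pose a := - (D / 2 + h) *: nu.
  pose S := [set z : 'cV[R]_p | 0 < dotv nu z + h /\ dotv nu z + h <= r].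
  have -> : B = [set w | S (Z w + a)].
    apply/seteqP; split => w; rewrite /B /S /a /= !dotvDr !dotvZr nu1 => -[];
      by split; lra.
  rewrite (cameron_martin a hZ); last first.
    apply: (sigma_vec_borel2 nu nu (B := [set x | 0 < x.1 + h /\ x.1 + h <= r])).
    have ms : measurable_fun setT (fun x : R * R => x.1 + h) by exact: measurable_funD.
    by apply: measurableI; [exact: measurable_ltrT|exact: measurable_lerT].
  rewrite [leRHS]integral_mkcond; apply: ge0_le_integral => //.
  - by move=> w _; rewrite lee_fin mulr_ge0.
  - apply/measurable_EFinP; apply: measurable_funM => //.
    exact: (measurable_indic (mEh h)).
  - apply/(measurable_restrictT _ (mEh h)); apply: measurable_funTS.
    apply/measurable_EFinP; apply: measurableT_comp => //.
    by apply: measurable_funB => //; exact: measurable_dotv.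
  move=> w _; rewrite /patch indicE.
  have -> : (w \in [set w | S (Z w)]) = ((h, w) \in E) by apply/idP/idP; rewrite !inE.
  case: ifPn => [|_]; rewrite ?mulr0// inE /E /= => -[Ew1 Ew2].
  rewrite lee_fin mulr1 /K ler_expR /a dotvZl !dotvZr dotvZl nu1.
  set v := dotv nu (Z w) in Ew1 Ew2 *.
  have -> : - (D / 2 + h) * v - - (D / 2 + h) * (- (D / 2 + h) * 1) / 2 =
    - ((D / 2 + h) * (v + h)) + h ^+ 2 / 2 - D ^+ 2 / 8 by field.
  have : (D / 2 + h) * (v + h) <= (D / 2 + 3) * r.
    apply: (@le_trans _ _ ((D / 2 + 3) * (v + h))).
      by rewrite ler_wpM2r ?(ltW Ew1)//; lra.
    by rewrite ler_wpM2l//; lra.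
  have : 0 <= h ^+ 2 by exact: sqr_ge0.
  lra.
have PBfin := fin_num_measure P _ mB.
suff : ((K * r / 2)%:E <= P B * 6%:E)%E.
  by rewrite -(fineK PBfin) -EFinM !lee_fin; lra.
apply: (@le_trans _ _ (\int[lebesgue_measure]_(h in `[(- 3)%R, 3%R])
    \int[P]_w (K * \1_E (h, w))%:E)%E); last first.
  apply: (@le_trans _ _ (\int[lebesgue_measure]_(h in `[(- 3)%R, 3%R]) P B)%E).
    apply: ge0_le_integral => //.
    - by move=> h _; apply: integral_ge0 => w _; rewrite lee_fin mulr_ge0.
    - by apply/measurable_funTS; apply: (@measurable_average_fun (cst K)).
  rewrite integral_cst//= lebesgue_measure_itv/= lte_fin ifT; last lra.
  by rewrite -EFinB lee_wpmul2l// lee_fin; lra.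
rewrite (@integral_average (cst K) E (- 3) 3)//.
have mA : measurable [set w | `|dotv nu (Z w)| <= 2].
  by apply: measurable_lerT => //; exact: measurableT_comp.
apply: (@le_trans _ _ (\int[P]_w ((K * r)%:E * (\1_[set w | (`|dotv nu (Z w)| <= 2)%R] w)%:E))%E).
  rewrite ge0_integralZl//; last 2 first.
  - by apply/measurable_EFinP; exact: measurable_indic.
  - by rewrite lee_fin mulr_ge0// ltW.
  rewrite integral_indic// setIT.
  apply: le_trans (lee_wpmul2l _ (prob_abs_le2 nu1)); last by rewrite lee_fin mulr_ge0// ltW.
  by rewrite -!EFinM lee_fin; lra.
apply: ge0_le_integral => //.
- by move=> w _; rewrite -EFinM lee_fin !mulr_ge0// ltW.
- by apply/measurable_EFinP; apply: measurable_funM => //; exact: measurable_indic.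
- apply: emeasurable_funM; first by apply/measurable_EFinP.
  exact: (@measurable_average_measure E (- 3) 3 mE).
move=> w _ /=; rewrite indicE; have [|_] := boolP (w \in _); last by rewrite mule0 mule_ge0 ?lee_fin.
rewrite inE/= ler_norml => /andP[v1 v2]; rewrite mule1 EFinM lee_wpmul2l ?lee_fin//.
set v := dotv nu (Z w) in v1 v2.
apply: (@le_trans _ _ (lebesgue_measure (`](- v), (r - v)] : set R))).
  by rewrite lebesgue_measure_itv/= lte_fin ifT; [rewrite -EFinB lee_fin; lra|lra].
apply: le_measure; rewrite ?inE.
- exact: measurable_itv.
- exact: measurable_average_set.
- by move=> h; rewrite /E /= !in_itv/= -/v => /andP[h1 h2]; split; [|split]; lra.
Qed.

(* From [prob_wedge_le] with [L = (s * D)^-1] and [prob_halfspace_ge] with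
   [r = (1 + D)^-1]. *)
Definition wedge_const (a b dl : R) : R :=
  48 * expR (7 / 2 + b * (3 / 2 + dl^-1) + (a * (1 + 3 / 2 * dl^-1)) ^+ 2 / 2)
     * (1 + dl^-1).

Lemma wedge_const_gt0 (a b dl : R) : 0 < dl -> 0 < wedge_const a b dl.
Proof.
move=> dl0; have i0 : 0 < dl^-1 by rewrite invr_gt0.
by rewrite /wedge_const !mulr_gt0 ?expR_gt0//; lra.
Qed.

(** The factor [expR (- D ^+ 2 / 8)] cancels between the two bounds. The rate [L = (s * D)^-1] is
    the largest order for which the terms in [b] and in [c] stay bounded, and it leaves
    [4 * (s * D)]. Dividing by the slab factor [(1 + D)^-1 / 12] costs one more power of [D], whence
    [48] and [s * D ^+ 2]. *)
Lemma prob_wedge_le_halfspace (nu c : 'cV[R]_p) (m D a b dl s : R) :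
  dotv nu nu = 1 -> dotv nu c = 0 -> 0 < dl <= D -> 0 <= a -> 0 <= b ->
  0 < s <= 1 -> s * D ^+ 2 <= 1 ->
  dotv c c <= (a * s) ^+ 2 -> `|m| <= b * (s * D) ->
  (P [set w | (`|dotv nu (Z w) - D / 2| <= `|dotv c (Z w) + m|)%R] <=
   (wedge_const a b dl * (s * D ^+ 2))%:E *
   P [set w | (D / 2 < dotv nu (Z w))%R])%E.
Proof.
move=> nu1 nuc /andP[dl0 dlD] a0 b0 /andP[s0 s1] sD2 cc mb.
have D0 : 0 < D by exact: lt_le_trans dlD.
pose i := dl^-1; have i0 : 0 < i by rewrite invr_gt0.
have Di : D^-1 <= i by rewrite lef_pV2 ?posrE.
have sD : s * D <= i.
  have -> : s * D = s * D ^+ 2 * D^-1 by field; rewrite gt_eqF.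
  by apply: le_trans Di; rewrite ler_piMl// invr_ge0 ltW.
have sD0 : 0 < s * D by rewrite mulr_gt0.
pose L := (s * D)^-1; have L0 : 0 < L by rewrite invr_gt0.
pose q := D / 2 + 1 + L.
have q0 : 0 <= q by rewrite /q addr_ge0 ?(ltW L0)//; lra.
(* [7 / 2] is the [1 / 2] of the wedge exponent plus the 3 spent on the slab, since
   [(D / 2 + 3) / (1 + D) <= 3]. *)
pose Q := 7 / 2 + b * (3 / 2 + i) + (a * (1 + 3 / 2 * i)) ^+ 2 / 2.
have upper : (P [set w | (`|dotv nu (Z w) - D / 2| <= `|dotv c (Z w) + m|)%R] <=
    (4 * (s * D) * expR (Q - 3 - D ^+ 2 / 8))%:E)%E.
  apply: le_trans (prob_wedge_le nu1 nuc (ltW D0) L0 mb) _.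
  rewrite lee_fin invrK -/q; apply: ler_wpM2l; first by lra.
  rewrite ler_expR.
  have h1 : q * (b * (s * D)) <= b * (3 / 2 + i).
    have -> : q * (b * (s * D)) = b * (s * D ^+ 2 / 2 + s * D + L * (s * D)).
      by rewrite /q; ring.
    by rewrite ler_wpM2l// mulVf ?gt_eqF//; lra.
  have h2 : q ^+ 2 * dotv c c <= (a * (1 + 3 / 2 * i)) ^+ 2.
    apply: (@le_trans _ _ ((a * (q * s)) ^+ 2)).
      have -> : (a * (q * s)) ^+ 2 = q ^+ 2 * (a * s) ^+ 2 by ring.
      by rewrite ler_wpM2l ?sqr_ge0.
    have qs0 : 0 <= q * s by rewrite mulr_ge0// ltW.
    have qs : q * s <= 1 + 3 / 2 * i.
      have -> : q * s = s * D / 2 + s + D^-1 by rewrite /q /L; field; rewrite !gt_eqF.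
      by lra.
    have qi0 : 0 <= a * (1 + 3 / 2 * i) by rewrite mulr_ge0//; lra.
    by apply: lerXn2r; rewrite ?nnegrE ?(ler_wpM2l a0 qs)// mulr_ge0.
  by rewrite /Q; lra.
have r01 : 0 < (1 + D)^-1 <= 1.
  have D1 : 0 < 1 + D by lra.
  by rewrite invr_gt0 D1 invf_le1//; lra.
have lower := prob_halfspace_ge nu1 (ltW D0) r01.
apply: le_trans upper _.
apply: le_trans (lee_wpmul2l _ lower); last first.
  have C0 := ltW (wedge_const_gt0 a b dl0).
  by rewrite lee_fin (mulr_ge0 C0)// (mulr_ge0 (ltW s0))// sqr_ge0.
rewrite -EFinM lee_fin /wedge_const -/i -/Q.
set r := (1 + D)^-1.
have -> : expR (Q - 3 - D ^+ 2 / 8) = expR Q * expR (- (D ^+ 2 / 8) - 3).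
  by rewrite -expRD; congr expR; lra.
have hr : expR (- (D ^+ 2 / 8) - 3) <= expR (- (D ^+ 2 / 8) - (D / 2 + 3) * r).
  rewrite ler_expR lerD2l lerN2 ler_pdivrMr; lra.
have D1 : s * D <= (1 + i) * (s * D ^+ 2) * r.
  rewrite ler_pdivlMr; last lra.
  have : s * D <= i * (s * D ^+ 2).
    have -> : s * D = D^-1 * (s * D ^+ 2) by field; rewrite gt_eqF.
    by rewrite ler_wpM2r// mulr_ge0 ?sqr_ge0 ?(ltW s0).
  nra.
set x := expR (- (D ^+ 2 / 8) - 3) in hr *.
set y := expR _ in hr *.
have x0 : 0 <= x by exact: expR_ge0.
have eQ0 : 0 <= expR Q by exact: expR_ge0.
apply: (@le_trans _ _ (4 * ((1 + i) * (s * D ^+ 2) * r) * (expR Q * y))).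
  apply: ler_pM; rewrite ?mulr_ge0 ?(ltW s0) ?(ltW D0)//.
    by rewrite ler_wpM2l.
  by rewrite ler_wpM2l.
by rewrite le_eqVlt; apply/orP; left; apply/eqP; field.
Qed.

End GaussianTails.

(** * Moments of the normal distribution *)

Section ExpInequalities.
Variable R : realType.
Implicit Types x y : R.

(** Second-order bound obtained without derivatives from [expR y - 1 <= y * expR y], itself the
    inequality [1 + z <= expR z] at [z = - y]. *)
Lemma expR_le1Dx_quad x : expR x <= 1 + x + x ^+ 2 * expR `|x|.
Proof.
have h y : expR y - 1 <= y * expR y.
  have := expR_ge1Dx (- y); rewrite expRN => hy.
  have ey := expR_gt0 y.
  have : (1 - y) * expR y <= 1 by rewrite -ler_pdivlMr// div1r; lra.
  lra.
have [x0|x0] := ger0P x.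
  have := ler_wpM2l x0 (h x); have := h x; rewrite expr2; lra.
have e1 : 1 <= expR (- x) by rewrite -[leLHS]expR0 ler_expR; lra.
have := ler_wnM2l (ltW x0) (expR_ge1Dx x).
have : 0 <= x ^+ 2 by exact: sqr_ge0.
have := h x; nra.
Qed.

(** With [a = expR (y / 2)] and [b = expR (- y / 2)] the quantity [expR y + expR (- y) - 2] is
    [(a - b) ^+ 2], so bounds on [a - b] that come from [1 + z <= expR z] suffice. *)
Lemma cosh_quad_bound x :
  `|expR x + expR (- x) - 2 - x ^+ 2| <= `|x| ^+ 3 * expR `|x|.
Proof.
have main y : 0 <= y -> `|expR y + expR (- y) - 2 - y ^+ 2| <= y ^+ 3 * expR y.
  move=> y0; pose z := y / 2; pose a := expR z; pose b := expR (- z).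
  have ab : a * b = 1 by rewrite /a /b -expRD subrr expR0.
  have a2 : expR y = a * a by rewrite /a -expRD /z; congr expR; lra.
  have b2 : expR (- y) = b * b by rewrite /b -expRD /z; congr expR; lra.
  have z0 : 0 <= z by rewrite /z; lra.
  have yz : y = 2 * z by rewrite /z; lra.
  have az : 1 + z <= a by exact: expR_ge1Dx.
  have b0 : 0 < b by exact: expR_gt0.
  have bz : b * b >= 1 - y by rewrite -b2; have := expR_ge1Dx (- y); lra.
  have b1 : b <= 1 by rewrite /b -[leRHS]expR0 ler_expR; lra.
  have a1 : 1 <= a by lra.
  have aa1 : 1 <= a * a by nra.
  have y3 : 0 <= y ^+ 3 by exact: exprn_ge0.
  have diff2 : a * a + b * b - 2 = (a - b) ^+ 2.
    by rewrite sqrrB ab; ring.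
  rewrite a2 b2 diff2 ler_norml; apply/andP; split.
    (* The lower bound [2 * z - z ^+ 2] on [a - b] can be squared only while it is nonnegative.
       Beyond that, [y > 4] and the cubic term already dominates [y ^+ 2]. *)
    have [z2|z2] := leP z 2.
      have dz : 2 * z - z ^+ 2 <= a - b.
        have bz1 : b * (1 + z) <= 1 by have := ler_wpM2l (ltW b0) az; rewrite (mulrC b a) ab.
        have az1 : (1 + z) * (1 + z) <= a * (1 + z) by rewrite ler_wpM2r//; lra.
        have : (2 * z - z ^+ 2) * (1 + z) <= (a - b) * (1 + z).
          by rewrite expr2; nra.
        by rewrite ler_pM2r//; lra.
      have dz0 : 0 <= 2 * z - z ^+ 2 by rewrite expr2; nra.
      have : (2 * z - z ^+ 2) ^+ 2 <= (a - b) ^+ 2.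
        by rewrite ler_sqr ?nnegrE// (le_trans dz0).
      have -> : (2 * z - z ^+ 2) ^+ 2 = y ^+ 2 - y ^+ 3 / 2 + z ^+ 4.
        by rewrite yz; field.
      have : 0 <= z ^+ 4 by exact: exprn_ge0.
      have : y ^+ 3 * 1 <= y ^+ 3 * (a * a) by rewrite ler_wpM2l.
      lra.
    have : y ^+ 2 <= y ^+ 3 * (a * a).
      apply: (@le_trans _ _ (y ^+ 2 * y)); first by rewrite ler_peMr ?sqr_ge0//; lra.
      by rewrite -exprSr ler_peMr.
    have : 0 <= (a - b) ^+ 2 by exact: sqr_ge0.
    lra.
  have dab : a - b = a * (1 - b * b) by rewrite mulrBr mulrA ab mul1r mulr1.
  have aab : a * a - 1 = a * a * (1 - b * b).
    by rewrite mulrBr mulrACA ab !mulr1.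
  have bb1 : 0 <= 1 - b * b by have := ltW b0; nra.
  have ay : a * a <= 1 + y * (a * a).
    have : a * a * (1 - b * b) <= a * a * y by rewrite ler_wpM2l//; lra.
    by rewrite -aab; lra.
  have : (a - b) ^+ 2 <= a * a * y ^+ 2.
    rewrite dab exprMn expr2 ler_wpM2l//; first lra.
    by rewrite ler_sqr ?nnegrE//; lra.
  have : y ^+ 2 * (a * a) <= y ^+ 2 * (1 + y * (a * a)) by rewrite ler_wpM2l ?sqr_ge0.
  have -> : y ^+ 3 = y * y ^+ 2 by rewrite exprS.
  nra.
have [x0|x0] := ger0P x; first by have := main x x0.
have := main (- x); rewrite opprK sqrrN (addrC (expR (- x))) => -> //; lra.
Qed.

End ExpInequalities.

(** The power [n.+1] of the inequality [z <= expR z] at [z = y / n.+1]. *)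
Lemma exprn_le_expR (R : realType) n (y : R) : 0 <= y ->
  y ^+ n.+1 <= n.+1%:R ^+ n.+1 * expR y.
Proof.
move=> y0; pose z := y / n.+1%:R.
have z0 : 0 <= z by rewrite divr_ge0.
have yE : y = n.+1%:R * z by rewrite mulrC divfK.
have zle : z <= expR z by apply: le_trans (expR_ge1Dx z); lra.
rewrite yE expRM_natl exprMn ler_wpM2l ?exprn_ge0//.
by apply: lerXn2r; rewrite ?nnegrE ?expR_ge0.
Qed.

Lemma le0_of_le_small (R : realType) (x C : R) :
  (forall t, 0 < t <= 1 -> x <= t * C) -> x <= 0.
Proof.
move=> h; rewrite leNgt; apply/negP => x0.
have C0 : 0 < C by have := h 1; rewrite ltr01 lexx mul1r => /(_ isT); lra.
pose t := Num.min 1 (x / (2 * C)).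
have t0 : 0 < t <= 1.
  by rewrite /t lt_min ltr01 ge_min lexx divr_gt0//; lra.
have := h t t0; have : t * C <= x / 2.
  apply: (@le_trans _ _ (x / (2 * C) * C)).
    by rewrite ler_wpM2r ?(ltW C0)// /t ge_min lexx orbT.
  by rewrite le_eqVlt; apply/orP; left; apply/eqP; field; rewrite gt_eqF.
lra.
Qed.

(* The moments are read off the moment generating function by comparing both
   sides for small [t], which avoids differentiating under the integral. *)
Section Moments.
Context (R : realType) d (T : measurableType d) (P : probability T R).
Variables (X : T -> R) (v : R).
Hypotheses (mX : measurable_fun setT X) (v0 : 0 <= v).
Hypothesis mgfX : forall t,
  (\int[P]_w (expR (t * X w))%:E = (expR (t ^+ 2 * v / 2))%:E)%E.

Local Notation integ f := (P.-integrable setT (EFin \o f)).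

Let integ_expR t : integ (fun w => expR (t * X w)).
Proof.
apply/integrableP; split.
  apply/measurable_EFinP; apply: measurableT_comp => //.
  exact: measurable_funM.
under eq_integral do rewrite /= ger0_norm ?expR_ge0//.
by rewrite mgfX ltry.
Qed.

Let integ_expR_abs s : 0 <= s -> integ (fun w => expR (s * `|X w|)).
Proof.
move=> s0; apply: (le_integrable measurableT)
  (integrableD measurableT (integ_expR s) (integ_expR (- s))).
  apply/measurable_EFinP; apply: measurableT_comp => //.
  by apply: measurable_funM => //; exact: measurableT_comp.
move=> w _ /=; rewrite lee_fin (ger0_norm (expR_ge0 _)).
rewrite (ger0_norm (addr_ge0 (expR_ge0 _) (expR_ge0 _))) mulNr -mulrN.
by have [_|_] := ger0P (X w); rewrite ?lerDl ?lerDr expR_ge0.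
Qed.

Let integ_dom (f : T -> R) K s : measurable_fun setT f -> 0 <= s ->
  (forall w, `|f w| <= K * expR (s * `|X w|)) -> integ f.
Proof.
move=> mf s0 fK; apply: (le_integrable measurableT) (integrableZl measurableT K (integ_expR_abs s0)).
  exact/measurable_EFinP.
move=> w _ /=; by rewrite lee_fin; apply: le_trans (fK w) _; exact: ler_norm.
Qed.

Let absX_le n w : `|X w| ^+ n.+1 <= n.+1%:R ^+ n.+1 * expR (1 * `|X w|).
Proof. by rewrite mul1r exprn_le_expR. Qed.

Lemma integrable_mgf_powers n : integ (fun w => X w ^+ n.+1).
Proof.
apply: (@integ_dom _ (n.+1%:R ^+ n.+1) 1) => //.
  exact: measurable_funX.
by move=> w; rewrite normrX.
Qed.

Lemma integrable_mgf : integ X.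
Proof. exact: (integrable_mgf_powers 0). Qed.

Lemma Rintegral_expR t : \int[P]_w expR (t * X w) = expR (t ^+ 2 * v / 2).
Proof. by rewrite /Rintegral mgfX. Qed.

Let Rintegral1 (r : R) : \int[P]_w r = r.
Proof. by rewrite Rintegral_cst//= probability_setT /= mulr1. Qed.

Let integ_cst (r : R) : integ (fun=> r).
Proof. exact: finite_measure_integrable_cst. Qed.

Let small_exp t : 0 < t <= 1 ->
  expR (t ^+ 2 * v / 2) <= 1 + t ^+ 2 * v / 2 + t ^+ 3 * (v ^+ 2 / 4 * expR (v / 2)).
Proof.
move=> /andP[t0 t1]; set s := t ^+ 2 * v / 2.
have t2 : t ^+ 2 <= 1 by rewrite expr_le1// ltW.
have s0 : 0 <= s by rewrite /s divr_ge0// mulr_ge0// sqr_ge0.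
have sv : s <= v / 2 by rewrite /s ler_pM2r// -[leRHS]mul1r ler_wpM2r.
apply: le_trans (expR_le1Dx_quad s) _; rewrite lerD2l ger0_norm//.
have -> : s ^+ 2 = t ^+ 3 * (t * (v ^+ 2 / 4)) by rewrite /s; field.
rewrite -[leLHS]mulrA ler_wpM2l ?exprn_ge0 ?(ltW t0)//.
rewrite ler_pM ?expR_ge0 ?ler_expR ?mulr_ge0 ?(ltW t0) ?sqr_ge0//.
by rewrite ler_piMl// mulr_ge0 ?sqr_ge0.
Qed.

Lemma Rintegral_mgf_mean : \int[P]_w X w = 0.
Proof.
(* Integrating [1 + t * e * X <= expR (t * e * X)] gives [t * e * E X = O(t ^+ 2)]; dividing by [t]
   and using both signs of [e] forces the mean to vanish. *)
have half (e : R) : e = 1 \/ e = -1 -> e * \int[P]_w X w <= 0.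
  move=> he; apply: (@le0_of_le_small _ _ (v / 2 + v ^+ 2 / 4 * expR (v / 2))) => t /andP[t0 t1].
  rewrite -(ler_pM2l t0).
  have h1 : \int[P]_w (1 + t * e * X w) <= \int[P]_w expR (t * e * X w).
    apply: le_Rintegral => //.
    - exact: (integrableD measurableT (integ_cst 1)
        (integrableZl measurableT (t * e) integrable_mgf)).
    - by move=> w _; exact: expR_ge1Dx.
  have E1 : \int[P]_w (1 + t * e * X w) = 1 + t * e * \int[P]_w X w.
    rewrite RintegralD ?Rintegral1//.
    - by rewrite RintegralZl//; exact: integrable_mgf.
    - exact: (integrableZl measurableT (t * e) integrable_mgf).
  rewrite E1 Rintegral_expR in h1.
  have te : (t * e) ^+ 2 = t ^+ 2 by case: he => ->; rewrite ?mulr1// mulrN1 sqrrN.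
  rewrite te in h1.
  have t01 : 0 < t <= 1 by rewrite t0.
  have := small_exp t01.
  have : t ^+ 3 * (v ^+ 2 / 4 * expR (v / 2)) <= t ^+ 2 * (v ^+ 2 / 4 * expR (v / 2)).
    rewrite ler_wpM2r//.
      by rewrite mulr_ge0 ?expR_ge0// divr_ge0// sqr_ge0.
    by rewrite exprS ler_piMl// sqr_ge0.
  rewrite [t * (t * _)]mulrA -expr2; lra.
have := half 1 (or_introl erefl); have := half (-1) (or_intror erefl); lra.
Qed.

Lemma Rintegral_mgf_sqr : \int[P]_w X w ^+ 2 = v.
Proof.
(* [27 = 3 ^+ 3] comes from [|X| ^+ 3 <= 27 * expR |X|]; the second factor [expR |X|] is the
   remainder of [cosh_quad_bound] with [t <= 1]. The error is of order [t ^+ 3], against [t ^+ 2]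
   times the quantity to be bounded. *)
pose C := 27 * \int[P]_w expR (2 * `|X w|).
pose C' := C + v ^+ 2 / 2 * expR (v / 2).
have bnd t : 0 < t <= 1 -> `|\int[P]_w X w ^+ 2 - v| <= t * C'.
  move=> /andP[t0 t1].
  have iX2 := integrable_mgf_powers 1.
  have ie2 := integ_expR_abs (ler0n _ 2 : 0 <= 2%:R :> R).
  pose f w := expR (t * X w) + expR (- t * X w) - 2 - t ^+ 2 * X w ^+ 2.
  have i1 : integ (fun w => expR (t * X w) + expR (- t * X w)).
    exact: (integrableD measurableT (integ_expR t) (integ_expR (- t))).
  have i2 : integ (fun w => expR (t * X w) + expR (- t * X w) - 2).
    exact: (integrableB measurableT i1 (integ_cst 2)).
  have i3 : integ (fun w => t ^+ 2 * X w ^+ 2).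
    exact: (integrableZl measurableT (t ^+ 2) iX2).
  have if_ : integ f by exact: (integrableB measurableT i2 i3).
  have Ef : \int[P]_w f w = 2 * expR (t ^+ 2 * v / 2) - 2 - t ^+ 2 * \int[P]_w X w ^+ 2.
    rewrite (RintegralB measurableT i2 i3) (RintegralB measurableT i1 (integ_cst 2)).
    rewrite (RintegralD measurableT (integ_expR t) (integ_expR (- t))).
    rewrite Rintegral1 !Rintegral_expR sqrrN (RintegralZl _ measurableT iX2).
    by congr (_ - _ - _); ring.
  have Efle : `|\int[P]_w f w| <= t ^+ 3 * C.
    apply: (le_trans (le_normr_Rintegral measurableT if_)).
    rewrite /C mulrA -RintegralZl//; apply: le_Rintegral => //.
    - exact: integrable_norm.
    - exact: (integrableZl measurableT (t ^+ 3 * 27) ie2).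
    move=> w _; rewrite /f -exprMn mulNr.
    apply: (le_trans (cosh_quad_bound (t * X w))).
    rewrite normrM (gtr0_norm t0) exprMn -[leLHS]mulrA -[leRHS]mulrA ler_wpM2l ?exprn_ge0 ?(ltW t0)//.
    have := absX_le 2 w; rewrite mul1r => X3.
    have eX : expR (t * `|X w|) <= expR `|X w| by rewrite ler_expR ler_piMl.
    have -> : expR (2 * `|X w|) = expR `|X w| * expR `|X w|.
      by rewrite -expRD; congr expR; ring.
    rewrite [leRHS]mulrA ler_pM ?exprn_ge0 ?expR_ge0//.
    by apply: le_trans X3 _; rewrite ler_wpM2r ?expR_ge0//; lra.
  have t01 : 0 < t <= 1 by rewrite t0.
  have s1 := small_exp t01; have s2 := expR_ge1Dx (t ^+ 2 * v / 2).
  suff : `|t ^+ 2 * (\int[P]_w X w ^+ 2 - v)| <= t ^+ 2 * (t * C').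
    by rewrite normrM (ger0_norm (sqr_ge0 t)) ler_pM2l// exprn_gt0.
  rewrite mulrBr.
  have -> : t ^+ 2 * (t * C') = t ^+ 3 * C + t ^+ 3 * (v ^+ 2 / 2 * expR (v / 2)).
    by rewrite /C'; ring.
  have := Efle; rewrite Ef !ler_norml => /andP[e1 e2]; apply/andP; split; lra.
apply/eqP; rewrite -subr_eq0 -normr_le0; apply: le0_of_le_small => t; exact: bnd.
Qed.

(** [X ^+ 4 <= 4 ^+ 4 * expR |X|] and [expR |X| <= expR X + expR (- X)], hence [512 = 2 * 256]. *)
Lemma Rintegral_mgf_pow4 : \int[P]_w X w ^+ 4 <= 512 * expR (v / 2).
Proof.
have e1 : \int[P]_w expR (1 * `|X w|) <= 2 * expR (v / 2).
  apply: (@le_trans _ _ (\int[P]_w (expR (1 * X w) + expR (- 1 * X w)))).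
    apply: le_Rintegral => //; first exact: integ_expR_abs.
      exact: (integrableD measurableT (integ_expR 1) (integ_expR (- 1))).
    move=> w _; rewrite !mulNr !mul1r.
    by have [_|_] := ger0P (X w); rewrite ?lerDl ?lerDr expR_ge0.
  rewrite RintegralD//.
  by rewrite !Rintegral_expR sqrrN expr1n mul1r; lra.
apply: (@le_trans _ _ (\int[P]_w (256 * expR (1 * `|X w|)))).
  apply: le_Rintegral => //; first exact: (integrable_mgf_powers 3).
    exact: (integrableZl measurableT 256 (integ_expR_abs ler01)).
  move=> w _; have := absX_le 3 w; rewrite -normrX ger0_norm; last first.
    by rewrite (exprM _ 2 2) sqr_ge0.
  by move=> /le_trans; apply; rewrite ler_wpM2r ?expR_ge0//; lra.
rewrite RintegralZl//; last exact: integ_expR_abs.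
lra.
Qed.

End Moments.

Section GaussianMoments.
Context (R : realType) d (T : measurableType d) (P : probability T R) (p : nat).
Variable Z : T -> 'cV[R]_p.
Hypothesis hZ : std_normal_vector P Z.
Let mZ : random_vector Z. Proof. by case: hZ. Qed.
Let mdot a := measurable_dotv a mZ.

Let mgf_dotv a t :
  (\int[P]_w (expR (t * dotv a (Z w)))%:E = (expR (t ^+ 2 * dotv a a / 2))%:E)%E.
Proof.
have := expectation_expR_dotv hZ (t *: a).
by rewrite dotvZl dotvZr mulrA -expr2; under eq_integral do rewrite dotvZl.
Qed.

Lemma integrable_dotv a : P.-integrable setT (EFin \o (fun w => dotv a (Z w))).
Proof. exact: (integrable_mgf (mdot a) (mgf_dotv a)). Qed.

Lemma Rintegral_dotv a : \int[P]_w dotv a (Z w) = 0.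
Proof. exact: (Rintegral_mgf_mean (mdot a) (dotvv_ge0 a) (mgf_dotv a)). Qed.

Let integrable_sqr a : P.-integrable setT (EFin \o (fun w => dotv a (Z w) ^+ 2)).
Proof. exact: (integrable_mgf_powers (mdot a) (mgf_dotv a) 1). Qed.

Let Rintegral_sqr a : \int[P]_w dotv a (Z w) ^+ 2 = dotv a a.
Proof. exact: (Rintegral_mgf_sqr (mdot a) (dotvv_ge0 a) (mgf_dotv a)). Qed.

(** Polarization: covariances of linear forms reduce to variances, the only second moments that the
    generating function gives directly. *)
Let polar a b w : dotv a (Z w) * dotv b (Z w) =
  1 / 2 * (dotv (a + b) (Z w) ^+ 2 - (dotv a (Z w) ^+ 2 + dotv b (Z w) ^+ 2)).
Proof. by rewrite dotvDl; field. Qed.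

Let integrable_polar a b : P.-integrable setT
  (EFin \o (fun w => dotv (a + b) (Z w) ^+ 2 - (dotv a (Z w) ^+ 2 + dotv b (Z w) ^+ 2))).
Proof.
exact: (integrableB measurableT (integrable_sqr (a + b))
  (integrableD measurableT (integrable_sqr a) (integrable_sqr b))).
Qed.

Lemma integrable_dotvM a b :
  P.-integrable setT (EFin \o (fun w => dotv a (Z w) * dotv b (Z w))).
Proof.
under [X in EFin \o X]eq_fun do rewrite polar.
exact: (integrableZl measurableT (1 / 2) (integrable_polar a b)).
Qed.

Lemma Rintegral_dotvM a b :
  \int[P]_w (dotv a (Z w) * dotv b (Z w)) = dotv a b.
Proof.
under eq_Rintegral do rewrite polar.
rewrite (RintegralZl _ measurableT (integrable_polar a b)).
rewrite (RintegralB measurableT (integrable_sqr _)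
  (integrableD measurableT (integrable_sqr a) (integrable_sqr b))).
rewrite (RintegralD measurableT (integrable_sqr a) (integrable_sqr b)).
by rewrite !Rintegral_sqr dotvDl !dotvDr (dotvC b a); field.
Qed.

Let integrable_pow4 a : P.-integrable setT (EFin \o (fun w => dotv a (Z w) ^+ 4)).
Proof. exact: (integrable_mgf_powers (mdot a) (mgf_dotv a) 3). Qed.

Let dotvM2_le a b w : `|(dotv a (Z w) * dotv b (Z w)) ^+ 2| <=
  1 / 2 * (dotv a (Z w) ^+ 4 + dotv b (Z w) ^+ 4).
Proof.
rewrite ger0_norm ?sqr_ge0// exprMn !(exprM _ 2 2).
set x := dotv a (Z w) ^+ 2; set y := dotv b (Z w) ^+ 2.
have := sqr_ge0 (x - y); rewrite sqrrB; lra.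
Qed.

Let integrable_sum4 a b : P.-integrable setT
  (EFin \o (fun w => 1 / 2 * (dotv a (Z w) ^+ 4 + dotv b (Z w) ^+ 4))).
Proof.
exact: (integrableZl measurableT (1 / 2)
  (integrableD measurableT (integrable_pow4 a) (integrable_pow4 b))).
Qed.

Lemma integrable_dotvM_sqr a b :
  P.-integrable setT (EFin \o (fun w => (dotv a (Z w) * dotv b (Z w)) ^+ 2)).
Proof.
apply: (le_integrable measurableT) (integrable_sum4 a b).
  by apply/measurable_EFinP; apply: measurable_funX; exact: measurable_funM.
move=> w _ /=; rewrite lee_fin; apply: le_trans (dotvM2_le a b w) _.
exact: ler_norm.
Qed.

Lemma Rintegral_dotvM_sqr_le a b : dotv a a = 1 -> dotv b b = 1 ->
  \int[P]_w (dotv a (Z w) * dotv b (Z w)) ^+ 2 <= 512 * expR (1 / 2).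
Proof.
move=> a1 b1.
have pow4 c : dotv c c = 1 -> \int[P]_w dotv c (Z w) ^+ 4 <= 512 * expR (1 / 2).
  by move=> c1; have := Rintegral_mgf_pow4 (mdot c) (mgf_dotv c); rewrite c1.
apply: (@le_trans _ _ (\int[P]_w (1 / 2 * (dotv a (Z w) ^+ 4 + dotv b (Z w) ^+ 4)))).
  apply: (le_Rintegral measurableT (integrable_dotvM_sqr a b) (integrable_sum4 a b)).
  by move=> w _; apply: le_trans (dotvM2_le a b w); exact: ler_norm.
rewrite (RintegralZl _ measurableT
  (integrableD measurableT (integrable_pow4 a) (integrable_pow4 b))).
rewrite (RintegralD measurableT (integrable_pow4 a) (integrable_pow4 b)).
have := pow4 a a1; have := pow4 b b1; lra.
Qed.

End GaussianMoments.

(** * Second moments of uncorrelated sums and Markov's inequality *)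

Section UncorrelatedSum.
Context (R : realType) d (T : measurableType d) (P : probability T R).

(** Integrability and value are proved together because additivity at each step requires the partial
    sum to be integrable. *)
Lemma Rintegral_sum (I : Type) (s : seq I) (S : pred I) (f : I -> T -> R) :
  (forall i, P.-integrable setT (EFin \o f i)) ->
  P.-integrable setT (EFin \o (fun w => \sum_(i <- s | S i) f i w)) /\
  \int[P]_w (\sum_(i <- s | S i) f i w) = \sum_(i <- s | S i) \int[P]_w f i w.
Proof.
move=> fi; elim: s => [|a s [IH1 IH2]].
  split; first by under [X in EFin \o X]eq_fun do rewrite big_nil; exact: finite_measure_integrable_cst.
  under eq_Rintegral do rewrite big_nil.
  by rewrite big_nil Rintegral_cst//= mul0r.
split.
  under [X in EFin \o X]eq_fun do rewrite big_cons.
  case: (S a) => //; exact: (integrableD measurableT (fi a) IH1).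
under eq_Rintegral do rewrite big_cons.
rewrite big_cons; case: (S a) => //.
by rewrite (RintegralD measurableT (fi a) IH1) IH2.
Qed.

Lemma Rintegral_sqr_sum_uncorrelated (I : finType) (S : pred I) (f : I -> T -> R) :
  (forall i j, P.-integrable setT (EFin \o (fun w => f i w * f j w))) ->
  (forall i j, i != j -> \int[P]_w (f i w * f j w) = 0) ->
  P.-integrable setT (EFin \o (fun w => (\sum_(i | S i) f i w) ^+ 2)) /\
  \int[P]_w (\sum_(i | S i) f i w) ^+ 2 = \sum_(i | S i) \int[P]_w (f i w) ^+ 2.
Proof.
move=> fi f0.
have E w : (\sum_(i | S i) f i w) ^+ 2 = \sum_(i | S i) \sum_(j | S j) f i w * f j w.
  by rewrite expr2 mulr_suml; under eq_bigr do rewrite mulr_sumr.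
have inner i := Rintegral_sum (index_enum I) S (fi i).
have [outer1 outer2] := Rintegral_sum (index_enum I) S (fun i => (inner i).1).
split; first by under [X in EFin \o X]eq_fun do rewrite E.
under eq_Rintegral do rewrite E.
rewrite outer2; apply: eq_bigr => i Si; rewrite (inner i).2 (bigD1 i)//= big1 ?addr0//.
by move=> j /andP[_ ji]; rewrite f0// eq_sym.
Qed.

Lemma markov_Rintegral (f : T -> R) (c : R) : (forall w, 0 <= f w) ->
  P.-integrable setT (EFin \o f) -> 0 < c ->
  (P [set w | (c < f w)%R] <= (c^-1 * \int[P]_w f w)%:E)%E.
Proof.
move=> f0 fi c0.
have mf : measurable_fun setT f by apply/measurable_EFinP; exact: (measurable_int P fi).
have mS : measurable [set w | (c < f w)%R] by exact: measurable_ltrT.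
rewrite EFinM /Rintegral fineK; last exact: integrable_fin_num.
rewrite -(setIT [set w | _]) -integral_indic// -integralZl//.
apply: ge0_le_integral => //.
- by apply/measurable_EFinP; exact: measurable_indic.
- by apply/measurable_EFinP; exact: measurable_funM.
- move=> w _; rewrite lee_fin indicE; have [|_] := boolP (w \in _).
    by rewrite inE/= => cf; rewrite ler_pdivlMl// mulr1 ltW.
  by rewrite mulr_ge0// invr_ge0 ltW.
Qed.

End UncorrelatedSum.

(** * Comparison of the two rules on one class *)

Section MatrixForms.
Variables (R : realType) (p : nat).
Implicit Types (u v : 'cV[R]_p) (A S W : 'M[R]_p).

Lemma dotv_mull A u v : dotv (A *m u) v = dotv u (A^T *m v).
Proof. by rewrite !dotvE trmx_mul -mulmxA. Qed.

Lemma qformE A v : qform A v = dotv v (A *m v).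
Proof. by rewrite dotvE mulmxA. Qed.

Lemma dotv_orthogonal A u v : A *m A^T = 1%:M ->
  dotv (A^T *m u) (A^T *m v) = dotv u v.
Proof. by move=> AA; rewrite dotv_mull trmxK mulmxA AA mul1mx. Qed.

Lemma unitmx_injP W : (forall v, W *m v = 0 -> v = 0) -> W \in unitmx.
Proof.
move=> inj; rewrite -unitmx_tr unitmxE unitfE; apply/negP => /det0P[v v0 vW].
move/eqP: v0; apply; apply: trmx_inj; rewrite trmx0; apply: inj.
by rewrite -[W]trmxK -trmx_mul vW trmx0.
Qed.

Lemma posdef_unitmx S : posdef S -> S \in unitmx.
Proof.
move=> [_ pos]; apply: unitmx_injP => v Sv; apply/eqP; apply: contraT => v0.
have := pos v v0; rewrite qformE Sv /dotv big1 ?ltxx// => k _.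
by rewrite mxE mulr0.
Qed.

Lemma root_unitmx A S : posdef S -> A *m A^T = S -> A \in unitmx.
Proof.
by move=> /posdef_unitmx S1 AS; move: S1; rewrite -AS unitmx_mul => /andP[].
Qed.

(** Whitening turns the Mahalanobis form into the Euclidean one: [A^T *m invmx S] is a right inverse
    of [A], hence also a left inverse. *)
Lemma qform_inv_root A S v : A \in unitmx -> A *m A^T = S ->
  qform (invmx S) (A *m v) = dotv v v.
Proof.
move=> A1 AS; rewrite qformE dotv_mull; congr (dotv _ _).
have S1 : S \in unitmx by rewrite -AS unitmx_mul unitmx_tr A1.
rewrite !mulmxA -[A^T *m _ *m _]/(A^T *m invmx S *m A).
by rewrite (_ : _ *m A = 1%:M) ?mul1mx//; apply: mulmx1C; rewrite mulmxA AS mulmxV.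
Qed.

Lemma near_id_unitmx W s : s < 1 ->
  (forall v, normv (W *m v - v) <= s * normv v) -> W \in unitmx.
Proof.
move=> s1 hW; apply: unitmx_injP => v Wv.
have := hW v; rewrite Wv sub0r normvN => h.
have : normv v = 0.
  apply/eqP; rewrite eq_le normv_ge0 andbT leNgt; apply/negP => nv.
  have : 0 < (1 - s) * normv v by rewrite mulr_gt0//; lra.
  by lra.
move=> /(congr1 (fun x => x ^+ 2)); rewrite sqr_normv expr0n /= => /eqP.
by rewrite dotvv_eq0 => /eqP.
Qed.

Variables (A S : 'M[R]_p) (s D : R) (del ei ej : 'cV[R]_p).
Hypotheses (A1 : A \in unitmx) (Ssym : S^T = S).
Let W := invmx A *m S *m (invmx A)^T.
Hypothesis hW : forall v, normv (W *m v - v) <= s * normv v.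
Hypothesis (s0 : 0 <= s) (s12 : s <= 1 / 12).

Lemma near_id_cov_unitmx : S \in unitmx.
Proof.
have W1 : W \in unitmx by apply: near_id_unitmx hW; have := s12; lra.
by move: W1; rewrite !unitmx_mul => /andP[/andP[]].
Qed.

Hypothesis (D0 : 0 < D) (Ddel : normv del = D).
Hypothesis (hi : normv ei <= s * D) (hj : normv ej <= s * D).

(* [D / 2 <= <del / D, u>] is the Bayes comparison of the two classes for the
   whitened point [u]; the sample version is the same comparison perturbed by
   the affine form [<c, u> + m], whose linear part is orthogonal to [del]. *)
Lemma lda_comparison : exists (c : 'cV[R]_p) (m : R),
  [/\ dotv del c = 0, dotv c c <= (24 * s) ^+ 2, `|m| <= 3 * (s * D) &
   forall u, let q := qform (invmx S) in
     let v := dotv (D^-1 *: del) u + (dotv c u + m) in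
     (q (A *m (u - del - ej)) <= q (A *m (u - ei)) -> D / 2 <= v) /\
     (q (A *m (u - ei)) <= q (A *m (u - del - ej)) -> v <= D / 2)].
Proof.
have S1 := near_id_cov_unitmx.
have [s0' s12' D0'] := And3 s0 s12 D0.
(* [G] is the inverse of [W], the sample precision matrix in whitened coordinates. *)
pose G := A^T *m invmx S *m A.
have WG : W *m G = 1%:M.
  rewrite /W /G !mulmxA -(mulmxA _ (invmx A)^T) -trmx_mul mulmxV// trmx1 mulmx1.
  by rewrite -(mulmxA (invmx A)) mulmxV// mulmx1 mulVmx.
have Gsym : G^T = G by rewrite /G !trmx_mul trmxK trmx_inv Ssym mulmxA.
have qE v : qform (invmx S) (A *m v) = dotv v (G *m v).
  by rewrite qformE dotv_mull /G !mulmxA.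
have Gdot u v : dotv (G *m u) v = dotv u (G *m v) by rewrite dotv_mull Gsym.
(* [dd] is the difference of the whitened sample means, [cv] the sample discriminant direction and
   [r] its error. The error is estimated through [W *m r], which is explicit, so that no bound on
   [G] is required. *)
pose dd := del + ej - ei; pose cv := G *m dd; pose r := cv - del.
have Wr : W *m r = (ej - ei) - (W *m del - del).
  rewrite /r mulmxBr /cv mulmxA WG mul1mx /dd -(addrA del) (addrC del) -addrA.
  by rewrite opprB !addrA.
have sD0 : 0 <= s * D by rewrite mulr_ge0// ltW.
have nr : normv r <= 6 * (s * D).
  have n1 : normv (W *m r) <= 3 * (s * D).
    rewrite Wr; apply: le_trans (normvB _ _) _; have := normvB ej ei.
    by have := hW del; rewrite Ddel; have := hi; have := hj; lra.
  have n2 : normv r <= normv (W *m r) + normv (W *m r - r).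
    by rewrite -[X in normv X <= _](subKr (W *m r)) normvB.
  have n3 := hW r; have n0 := normv_ge0 r.
  have : s * normv r <= 1 / 12 * normv r by rewrite ler_wpM2r.
  by lra.
have sD : 6 * (s * D) <= D / 2 by nra.
(* Dividing by [k], the component of [cv] along the unit vector towards [del], gives that vector
   coefficient 1 and leaves a remainder orthogonal to [del]. *)
pose k := dotv cv (D^-1 *: del).
have kD : k * D = dotv cv del by rewrite /k dotvZr; field; rewrite gt_eqF.
have nD : normv (D^-1 *: del) = 1.
  by rewrite normvZ gtr0_norm ?invr_gt0// Ddel mulVf// gt_eqF.
have delD : dotv del del = D ^+ 2 by rewrite -sqr_normv Ddel.
have kr : k = D + dotv r (D^-1 *: del).
  rewrite /k /r dotvBl dotvZr [dotv del _]dotvZr delD; field; by rewrite gt_eqF.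
have kge : D / 2 <= k.
  have := CauchySchwarz_dotv r (D^-1 *: del); rewrite nD mulr1 ler_norml => /andP[].
  by rewrite kr; lra.
have k0 : 0 < k by lra.
pose c := k^-1 *: cv - D^-1 *: del.
pose m := - (k^-1 * dotv cv (ei + ej) / 2).
exists c, m; split.
- by rewrite /c dotvBr !dotvZr delD dotvC -kD; field; rewrite !gt_eqF.
- have ck : c = k^-1 *: (r - dotv r (D^-1 *: del) *: (D^-1 *: del)).
    have cvE : cv = r + del by rewrite /r subrK.
    have -> : dotv r (D^-1 *: del) = k - D by rewrite kr addrAC subrr add0r.
    by rewrite /c cvE; apply/colP => l; rewrite !mxE; field; rewrite !gt_eqF.
  (* Both [r] and its projection have norm at most [6 * (s * D)], and [k^-1 <= 2 / D]. *)
  have nc : normv c <= 24 * s.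
    rewrite ck normvZ gtr0_norm ?invr_gt0// ler_pdivrMl//.
    apply: le_trans (normvB _ _) _; rewrite normvZ nD mulr1.
    have := CauchySchwarz_dotv r (D^-1 *: del); rewrite nD mulr1.
    have : s * D <= s * (2 * k) by rewrite ler_wpM2l//; lra.
    by lra.
  by rewrite -sqr_normv lerXn2r ?nnegrE ?normv_ge0//; lra.
- rewrite normrN !normrM gtr0_norm ?invr_gt0// (gtr0_norm (_ : 0 < 2^-1 :> R)) ?invr_gt0//.
  rewrite -mulrA ler_pdivrMl//.
  have ncv : normv cv <= 3 / 2 * D.
    have -> : cv = r + del by rewrite /r subrK.
    by apply: le_trans (normvD _ _) _; rewrite Ddel; lra.
  have nee : normv (ei + ej) <= 2 * (s * D).
    by apply: le_trans (normvD _ _) _; have := hi; have := hj; lra.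
  have : `|dotv cv (ei + ej)| <= 3 / 2 * D * (2 * (s * D)).
    by apply: le_trans (CauchySchwarz_dotv _ _) _; rewrite ler_pM ?normv_ge0.
  have : D / 2 * (3 * (s * D)) <= k * (3 * (s * D)) by rewrite ler_wpM2r//; lra.
  by lra.
move=> u /=; rewrite !qE.
pose v := dotv (D^-1 *: del) u + (dotv c u + m).
(* Both quadratic forms use the same [G], so their difference is affine in [u]; [k > 0] then
   transfers signs. *)
have vE : v - D / 2 = (2 * k)^-1 * (dotv (u - ei) (G *m (u - ei)) -
    dotv (u - del - ej) (G *m (u - del - ej))).
  have square a b : dotv a (G *m a) - dotv b (G *m b) = dotv (G *m (a - b)) (a + b).
    rewrite Gdot mulmxDr dotvBl !dotvDr -(Gdot b a) (dotvC _ a).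
    by ring.
  have -> : dotv (u - ei) (G *m (u - ei)) - dotv (u - del - ej) (G *m (u - del - ej)) =
      2 * dotv cv u - dotv cv (ei + ej) - dotv cv del.
    rewrite square; have -> : u - ei - (u - del - ej) = dd.
      by apply/colP => l; rewrite /dd !mxE; ring.
    by rewrite -/cv !dotvDr !dotvNr; ring.
  by rewrite /v /c /m dotvBl !dotvZl -kD; field; rewrite !gt_eqF.
rewrite -/v; split => h.
  by rewrite -subr_ge0 vE mulr_ge0 ?invr_ge0 ?subr_ge0//; lra.
by rewrite -subr_le0 vE mulr_ge0_le0 ?invr_ge0 ?subr_le0//; lra.
Qed.

End MatrixForms.

(** * Events that agree outside a finite union *)

Section MeasureUnion.
Context (R : realType) d (T : measurableType d) (P : probability T R).
Local Notation prb A := (fine (P A)).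

Lemma prb_ge0 A : 0 <= prb A.
Proof. by rewrite fine_ge0. Qed.

Lemma le_prb A B : measurable A -> measurable B -> A `<=` B -> prb A <= prb B.
Proof.
by move=> mA mB AB; rewrite fine_le ?fin_num_measure// le_measure ?inE.
Qed.

Lemma prb_le_union (I : finType) (S : pred I) A B (C : I -> set T) :
  measurable A -> measurable B -> (forall i, S i -> measurable (C i)) ->
  (forall w, A w -> B w \/ exists2 i, S i & C i w) ->
  prb A <= prb B + \sum_(i | S i) prb (C i).
Proof.
move=> mA mB mC ABC.
pose U := \big[setU/set0]_(i | S i) C i.
have prbU2 V W : measurable V -> measurable W -> prb (V `|` W) <= prb V + prb W.
  move=> mV mW; have := @measureU2 _ _ _ P V W mV mW.
  have fV := fin_num_measure P _ mV; have fW := fin_num_measure P _ mW.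
  have fVW := fin_num_measure P _ (measurableU _ _ mV mW).
  by rewrite -(fineK fV) -(fineK fW) -(fineK fVW) -EFinD lee_fin.
have [mU prbU] : measurable U /\ prb U <= \sum_(i | S i) prb (C i).
  apply: (big_rec2 (fun V s => measurable V /\ prb V <= s)).
    by rewrite measure0; split.
  move=> i V s Si [mV Vs]; split; first by apply: measurableU => //; exact: mC.
  by apply: le_trans (prbU2 _ _ (mC i Si) mV) _; rewrite lerD2l.
apply: (@le_trans _ _ (prb (B `|` U))).
  apply: le_prb => //; first exact: measurableU.
  move=> w /ABC[Bw|[i Si Ci]]; [by left|right].
  by rewrite /U (bigD1 i)//=; left.
apply: (@le_trans _ _ (prb B + prb U)); last by rewrite lerD2l.
exact: prbU2.
Qed.

Lemma prb_sym_diff (I : finType) (S : pred I) A B (C : I -> set T) :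
  measurable A -> measurable B -> (forall i, S i -> measurable (C i)) ->
  (forall w, A w -> B w \/ exists2 i, S i & C i w) ->
  (forall w, B w -> A w \/ exists2 i, S i & C i w) ->
  `|prb A - prb B| <= \sum_(i | S i) prb (C i).
Proof.
move=> mA mB mC AB BA.
have := prb_le_union mA mB mC AB; have := prb_le_union mB mA mC BA.
by rewrite ler_distlC => ? ?; apply/andP; split; lra.
Qed.

End MeasureUnion.

Section ClassError.
Context (R : realType) d (T : measurableType d) (Q : probability T R).
Variables (K p : nat) (mu : 'I_K -> 'cV[R]_p) (Sigma : 'M[R]_p) (A0 : 'M[R]_p).
Hypotheses (posS : posdef Sigma) (A0S : A0 *m A0^T = Sigma).
Variables (x : T -> 'cV[R]_p) (i : 'I_K).
Hypothesis hx : mvnormal Q x (mu i) Sigma.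

Let A1 : A0 \in unitmx. Proof. exact: root_unitmx A0S. Qed.
Let del j := invmx A0 *m (mu j - mu i).
Let D j := normv (del j).
Let u w := invmx A0 *m (x w - mu i).

Lemma qform_pair_dist j k :
  qform (invmx Sigma) (mu j - mu k) = normv (invmx A0 *m (mu j - mu k)) ^+ 2.
Proof.
by rewrite -(mulKVmx A1 (mu j - mu k)) (qform_inv_root _ A1 A0S) mulKmx// sqr_normv.
Qed.

Lemma random_vector_mvnormal : random_vector x.
Proof.
have [A [Z [AS [mZ _] xE]]] := hx => k.
under eq_fun do rewrite xE !mxE.
apply: measurable_funD => //; apply: measurable_sum => l.
exact: measurable_funM.
Qed.

(* [u] is a standard normal vector up to a rotation, since [x] may be built
   from a root of [Sigma] other than [A0]. *)
Lemma whitened_std_normal : exists (rot : 'M[R]_p) (Z : T -> 'cV[R]_p),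
  [/\ std_normal_vector Q Z, rot *m rot^T = 1%:M & forall w, u w = rot *m Z w].
Proof.
have [A [Z [AS hZ xE]]] := hx; exists (invmx A0 *m A), Z; split => //.
  rewrite trmx_mul mulmxA -(mulmxA _ A) AS -A0S mulmxA mulVmx// mul1mx.
  by rewrite -trmx_mul mulVmx// trmx1.
by move=> w; rewrite /u xE addrC addKr mulmxA.
Qed.

Let nu j := (D j)^-1 *: del j.

Let nu1 j : 0 < D j -> dotv (nu j) (nu j) = 1.
Proof.
move=> D0; rewrite /nu dotvZl dotvZr -sqr_normv -/(D j).
by field; rewrite gt_eqF.
Qed.

(** Positivity of the Bayes error, by which the ratio of risks is divided, rests on this
    half-space. *)
Lemma prob_class_tail j : 0 < D j ->
  0 < fine (Q [set w | D j / 2 < dotv (nu j) (u w)]).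
Proof.
move=> D0; have [rot [Z [hZ OO uE]]] := whitened_std_normal.
have [mZ _] := hZ.
under eq_set do rewrite uE dotvC dotv_mull dotvC.
have r1 : 0 < (1 : R) <= 1 by rewrite ltr01 lexx.
have n1 : dotv (rot^T *m nu j) (rot^T *m nu j) = 1 by rewrite dotv_orthogonal// nu1.
have := prob_halfspace_ge hZ n1 (ltW D0) r1.
have mS : measurable [set w | (D j / 2 < dotv (rot^T *m nu j) (Z w))%R].
  by apply: measurable_ltrT => //; exact: measurable_dotv.
rewrite -(fineK (fin_num_measure Q _ mS)) lee_fin; apply: lt_le_trans.
by rewrite mulr_gt0 ?expR_gt0//; lra.
Qed.

Lemma prob_class_wedge j c m dl s : 0 < dl <= D j -> dotv (del j) c = 0 ->
  0 < s <= 1 -> s * D j ^+ 2 <= 1 -> dotv c c <= (24 * s) ^+ 2 ->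
  `|m| <= 3 * (s * D j) ->
  fine (Q [set w | `|dotv (nu j) (u w) - D j / 2| <= `|dotv c (u w) + m|]) <=
  wedge_const 24 3 dl * (s * D j ^+ 2) *
  fine (Q [set w | D j / 2 < dotv (nu j) (u w)]).
Proof.
move=> dlD delc s01 sD cc hm; have [rot [Z [hZ OO uE]]] := whitened_std_normal.
have D0 : 0 < D j by case/andP: dlD => h1 h2; exact: lt_le_trans h1 h2.
have [mZ _] := hZ.
have E a w : dotv a (u w) = dotv (rot^T *m a) (Z w).
  by rewrite uE dotvC dotv_mull dotvC.
under eq_set do rewrite !E.
under [X in _ <= _ * fine (Q X)]eq_set do rewrite E.
have n1 : dotv (rot^T *m nu j) (rot^T *m nu j) = 1 by rewrite dotv_orthogonal// nu1.
have nc : dotv (rot^T *m nu j) (rot^T *m c) = 0.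
  by rewrite dotv_orthogonal// /nu dotvZl delc mulr0.
have cc' : dotv (rot^T *m c) (rot^T *m c) <= (24 * s) ^+ 2 by rewrite dotv_orthogonal.
have mdot a := measurable_dotv (rot^T *m a) mZ.
have := prob_wedge_le_halfspace hZ n1 nc dlD (ler0n _ 24) (ler0n _ 3) s01 sD cc' hm.
have m1 : measurable [set w | (D j / 2 < dotv (rot^T *m nu j) (Z w))%R].
  exact: measurable_ltrT.
have m2 : measurable [set w | (`|dotv (rot^T *m nu j) (Z w) - D j / 2| <=
    `|dotv (rot^T *m c) (Z w) + m|)%R].
  apply: measurable_lerT; apply: measurableT_comp => //.
    exact: measurable_funB.
  exact: measurable_funD.
by rewrite -(fineK (fin_num_measure Q _ m1)) -(fineK (fin_num_measure Q _ m2)) -EFinM lee_fin.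
Qed.

Variables (TO TL : 'cV[R]_p -> 'I_K) (xbar : 'I_K -> 'cV[R]_p) (S : 'M[R]_p).
Hypotheses (mTO : sigma_vec id [set z | TO z = i])
           (mTL : measurable [set w | TL (x w) = i]).
Hypothesis optTO : forall z j,
  qform (invmx Sigma) (z - mu (TO z)) <= qform (invmx Sigma) (z - mu j).

Let mTOx : measurable [set w | TO (x w) = i].
Proof. exact: measurable_sigma_vec random_vector_mvnormal mTO. Qed.

Let qx j w : qform (invmx Sigma) (x w - mu j) = dotv (u w - del j) (u w - del j).
Proof.
rewrite -(qform_inv_root _ A1 A0S) mulmxBr /u /del !mulKVmx//.
by rewrite opprB addrA subrK.
Qed.

Let optE j w : 0 < D j ->
  (qform (invmx Sigma) (x w - mu j) <= qform (invmx Sigma) (x w - mu i) ->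
     D j / 2 <= dotv (nu j) (u w)) /\
  (qform (invmx Sigma) (x w - mu i) <= qform (invmx Sigma) (x w - mu j) ->
     dotv (nu j) (u w) <= D j / 2).
Proof.
move=> D0; rewrite !qx; have -> : del i = 0 by rewrite /del subrr mulmx0.
rewrite subr0 dotvBl !dotvBr (dotvC (u w)) -(sqr_normv (del j)) -/(D j) /nu dotvZl.
split => h; first by rewrite ler_pdivlMl//; lra.
by rewrite ler_pdivrMl//; lra.
Qed.

Lemma opt_error_gt j w : 0 < D j -> D j / 2 < dotv (nu j) (u w) -> TO (x w) <> i.
Proof.
move=> D0 Dv TOi; have := optTO (x w) j; rewrite TOi => /(optE w D0).2.
by rewrite leNgt Dv.
Qed.

Let measurable_errO : measurable [set w | TO (x w) <> i].
Proof. exact: measurableC mTOx. Qed.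

Let measurable_errL : measurable [set w | TL (x w) <> i].
Proof. exact: measurableC mTL. Qed.

Let random_vector_u : random_vector u.
Proof.
have [rot [Z [[mZ _] _ uE]]] := whitened_std_normal => k.
under eq_fun do rewrite uE mxE.
by apply: measurable_sum => l; exact: measurable_funM.
Qed.

Let measurable_tail j : measurable [set w | D j / 2 < dotv (nu j) (u w)].
Proof. by apply: measurable_ltrT => //; exact: measurable_dotv. Qed.

Lemma opt_error_ge_tail j : 0 < D j ->
  fine (Q [set w | D j / 2 < dotv (nu j) (u w)]) <= fine (Q [set w | TO (x w) <> i]).
Proof.
by move=> D0; apply: le_prb => // w; exact: opt_error_gt.
Qed.

Lemma opt_error_gt0 j : 0 < D j -> 0 < fine (Q [set w | TO (x w) <> i]).
Proof.
by move=> D0; exact: lt_le_trans (prob_class_tail D0) (opt_error_ge_tail D0).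
Qed.

(** If one rule errs at a point of class [i] and the other does not, the class [j] chosen by the
    former is compared with [i] in opposite senses by the two rules, so the point lies in the wedge
    of [j]. Each wedge is bounded by its half-space, on which the optimal rule errs. All comparisons
    are weak, so ties may be broken in any way. *)
Lemma class_error (s c1 M : R) :
  S^T = S ->
  (forall v, normv (invmx A0 *m S *m (invmx A0)^T *m v - v) <= s * normv v) ->
  0 < s <= 1 / 12 -> 0 <= M -> s * M <= 1 -> 0 < c1 ->
  (forall z j, qform (invmx S) (z - xbar (TL z)) <= qform (invmx S) (z - xbar j)) ->
  (forall j, j != i -> c1 <= D j ^+ 2 <= M) ->
  (forall j k, j != i -> normv (invmx A0 *m (xbar k - mu k)) <= s * D j) ->
  `|fine (Q [set w | TL (x w) <> i]) - fine (Q [set w | TO (x w) <> i])| <=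
  K%:R * (wedge_const 24 3 (Num.sqrt c1) * (s * M)) *
    fine (Q [set w | TO (x w) <> i]).
Proof.
move=> Ssym hW /andP[s0 s12] M0 sM c10 optTL hD he.
set dl := Num.sqrt c1; set beta := fine (Q [set w | TO (x w) <> i]).
have dl0 : 0 < dl by rewrite sqrtr_gt0.
have Ddl j : j != i -> dl <= D j.
  move=> /hD /andP[h _]; rewrite -[leRHS](ger0_norm (normv_ge0 (del j))) -sqrtr_sqr.
  exact: ler_wsqrtr.
have D0 j : j != i -> 0 < D j by move=> /Ddl; exact: lt_le_trans.
pose e k := invmx A0 *m (xbar k - mu k).
(* Choice is applied over all [j], with a dummy pair at [j = i]. *)
have ex j : exists cm : 'cV[R]_p * R, j != i ->
    [/\ dotv (del j) cm.1 = 0, dotv cm.1 cm.1 <= (24 * s) ^+ 2,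
      `|cm.2| <= 3 * (s * D j) &
      forall w, let q := qform (invmx S) in
        let v := dotv (nu j) (u w) + (dotv cm.1 (u w) + cm.2) in
        (q (x w - xbar j) <= q (x w - xbar i) -> D j / 2 <= v) /\
        (q (x w - xbar i) <= q (x w - xbar j) -> v <= D j / 2)].
  have [->|ji] := eqVneq j i; first by exists (0, 0).
  have [c [m [h1 h2 h3 h4]]] := lda_comparison A1 Ssym hW (ltW s0) s12 (D0 j ji)
    (erefl : normv (del j) = D j) (he j i ji) (he j j ji).
  exists (c, m) => _; split => // w /=; have := h4 (u w); rewrite /= -/(nu j).
  have -> : A0 *m (u w - e i) = x w - xbar i.
    by rewrite mulmxBr /u /e !mulKVmx// opprB addrA subrK.
  have -> : A0 *m (u w - del j - e j) = x w - xbar j.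
    rewrite !mulmxBr /u /e /del !mulmxBr !mulKVmx//.
    by apply/colP => l; rewrite !mxE; ring.
  by [].
have [cm hcm] := choice ex.
pose C j := [set w | `|dotv (nu j) (u w) - D j / 2| <= `|dotv (cm j).1 (u w) + (cm j).2|].
have mC j : measurable (C j).
  have mdot a := measurable_dotv a random_vector_u.
  apply: measurable_lerT; apply: measurableT_comp => //.
    exact: measurable_funB.
  exact: measurable_funD.
have hC j : j != i -> fine (Q (C j)) <= wedge_const 24 3 dl * (s * M) * beta.
  move=> ji; have [h1 h2 h3 _] := hcm j ji; have /andP[_ hDM] := hD j ji.
  have sD : s * D j ^+ 2 <= s * M by rewrite ler_wpM2l// ltW.
  have dlD : 0 < dl <= D j by rewrite dl0 Ddl.
  have s1 : 0 < s <= 1 by rewrite s0/=; lra.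
  apply: (le_trans (prob_class_wedge dlD h1 s1 (le_trans sD sM) h2 h3)).
  have w0 := ltW (wedge_const_gt0 24 3 dl0).
  have sD0 : 0 <= s * D j ^+ 2 by rewrite mulr_ge0 ?sqr_ge0 ?(ltW s0).
  apply: ler_pM; rewrite ?prb_ge0//; first by rewrite mulr_ge0.
    by rewrite ler_wpM2l.
  exact: opt_error_ge_tail (D0 _ ji).
have wedge j w a : a = dotv (nu j) (u w) + (dotv (cm j).1 (u w) + (cm j).2) ->
    (dotv (nu j) (u w) <= D j / 2 <= a) || (a <= D j / 2 <= dotv (nu j) (u w)) -> C j w.
  move=> -> /orP[] /andP[h1 h2]; rewrite /C /=.
    by rewrite ler0_norm ?subr_le0// (le_trans _ (ler_norm _))//; lra.
  by rewrite ger0_norm ?subr_ge0// -normrN (le_trans _ (ler_norm _))//; lra.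
have := prb_sym_diff Q (S := fun j => j != i) measurable_errL measurable_errO (fun j _ => mC j).
move=> /(_ _ _)/wrap[||h].
- move=> w TLi; have [TOi|TOi] := eqVneq (TO (x w)) i; last by left; exact/eqP.
  right; have ji : TL (x w) != i by exact/eqP.
  exists (TL (x w)) => //; have [_ _ _ h] := hcm _ ji.
  apply: (wedge _ _ _ erefl); apply/orP; left; apply/andP; split.
    by apply: (optE w (D0 _ ji)).2; have := optTO (x w) (TL (x w)); rewrite TOi.
  by apply: (h w).1; exact: optTL.
- move=> w TOi; have [TLi|TLi] := eqVneq (TL (x w)) i; last by left; exact/eqP.
  right; have ji : TO (x w) != i by exact/eqP.
  exists (TO (x w)) => //; have [_ _ _ h] := hcm _ ji.
  apply: (wedge _ _ _ erefl); apply/orP; right; apply/andP; split.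
    by apply: (h w).2; have := optTL (x w) (TO (x w)); rewrite TLi.
  by apply: (optE w (D0 _ ji)).1; exact: optTO.
pose b := wedge_const 24 3 dl * (s * M) * beta.
have b0 : 0 <= b.
  by rewrite /b mulr_ge0 ?prb_ge0// mulr_ge0 ?(ltW (wedge_const_gt0 _ _ _))// mulr_ge0// ltW.
apply: (le_trans h); apply: (@le_trans _ _ (\sum_(j < K) b)).
  rewrite [leRHS](bigID (fun j => j != i))/= -[leLHS]addr0.
  by rewrite lerD ?sumr_ge0// ler_sum.
by rewrite sumr_const card_ord -[leLHS]mulr_natl /b [leLHS]mulrA.
Qed.

End ClassError.

(** * Estimation errors *)

Section SampleAlgebra.
Variables (R : realType) (K p : nat) (n : 'I_K -> nat).
Hypothesis n0 : forall i, (0 < n i)%N.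
Variables (mu : 'I_K -> 'cV[R]_p) (A0 : 'M[R]_p) (X : sample R p n).

Definition std_resid i (j : 'I_(n i)) : 'cV[R]_p := invmx A0 *m (X j - mu i).
Definition mean_err i : 'cV[R]_p := invmx A0 *m (class_mean X i - mu i).
(** Centred at the true means, so that it is an average of independent matrices minus its
    expectation. *)
Definition cov_err : 'M[R]_p :=
  (\sum_i n i)%:R^-1 *: (\sum_i \sum_(j < n i) std_resid j *m (std_resid j)^T) - 1%:M.
(** The squared Frobenius norm: it dominates the squared operator norm and its expectation is
    computed entry by entry. *)
Definition frob2 (V : 'M[R]_p) : R := \sum_a \sum_b V a b ^+ 2.

Lemma sum_std_resid i : \sum_(j < n i) std_resid j = (n i)%:R *: mean_err i.
Proof.
rewrite /std_resid /mean_err -mulmx_sumr scalemxAr; congr (_ *m _).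
rewrite sumrB /class_mean scalerBr scalerA mulfV ?scale1r; last first.
  by rewrite pnatr_eq0 -lt0n.
by rewrite sumr_const card_ord scaler_nat.
Qed.

Lemma mean_errE i : mean_err i = (n i)%:R^-1 *: \sum_(j < n i) std_resid j.
Proof.
by rewrite sum_std_resid scalerA mulVf ?scale1r// pnatr_eq0 -lt0n.
Qed.

(** Centring at the class mean instead of the true mean removes [n i] times a rank-one matrix from
    the scatter of class [i]. *)
Lemma pooled_cov_whitened :
  invmx A0 *m pooled_cov X *m (invmx A0)^T - 1%:M = cov_err -
  (\sum_i n i)%:R^-1 *: \sum_i (n i)%:R *: (mean_err i *m (mean_err i)^T).
Proof.
rewrite /cov_err addrAC -scalerBr -sumrB /pooled_cov -scalemxAr -scalemxAl; congr (_ *: _ - _).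
rewrite mulmx_sumr mulmx_suml; apply: eq_bigr => i _.
rewrite mulmx_sumr mulmx_suml.
under eq_bigr => j _.
  have -> : invmx A0 *m ((X j - class_mean X i) *m (X j - class_mean X i)^T) *m (invmx A0)^T =
      (std_resid j - mean_err i) *m (std_resid j - mean_err i)^T.
    rewrite /std_resid /mean_err -mulmxBr opprB addrA subrK.
    by rewrite trmx_mul !mulmxA.
  rewrite linearB/= mulmxBl !mulmxBr.
  over.
rewrite !sumrB.
have -> : \sum_(j < n i) std_resid j *m (mean_err i)^T =
    (n i)%:R *: (mean_err i *m (mean_err i)^T).
  by rewrite -mulmx_suml sum_std_resid scalemxAl.
have -> : \sum_(j < n i) mean_err i *m (std_resid j)^T =
    (n i)%:R *: (mean_err i *m (mean_err i)^T).
  have -> : \sum_(j < n i) mean_err i *m (std_resid j)^T =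
      mean_err i *m (\sum_(j < n i) std_resid j)^T.
    by rewrite linear_sum/= mulmx_sumr.
  by rewrite sum_std_resid linearZ/= scalemxAr.
by rewrite sumr_const card_ord scaler_nat subrr subr0.
Qed.

Lemma normv_sum (I : Type) (s : seq I) (f : I -> 'cV[R]_p) :
  normv (\sum_(i <- s) f i) <= \sum_(i <- s) normv (f i).
Proof.
elim: s => [|a s IH]; first by rewrite !big_nil /normv -(scale0r 0) dotvZl mul0r sqrtr0.
by rewrite !big_cons (le_trans (normvD _ _))// lerD2l.
Qed.

Lemma normv_frob2 (V : 'M[R]_p) v : normv (V *m v) <= Num.sqrt (frob2 V) * normv v.
Proof.
have f0 : 0 <= frob2 V by apply: sumr_ge0 => a _; apply: sumr_ge0 => b _; exact: sqr_ge0.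
rewrite -sqrtrM// ler_wsqrtr// {1}/dotv mulr_suml; apply: ler_sum => a _.
have -> : (V *m v) a 0 = dotv (row a V)^T v.
  by rewrite mxE; apply: eq_bigr => b _; rewrite !mxE.
have -> : \sum_b V a b ^+ 2 = dotv (row a V)^T (row a V)^T.
  by apply: eq_bigr => b _; rewrite !mxE expr2.
rewrite -expr2 -!sqr_normv -exprMn -(real_normK (num_real (dotv _ _))).
by rewrite ler_sqr ?nnegrE ?mulr_ge0 ?normv_ge0// CauchySchwarz_dotv.
Qed.

(** The rank-one corrections carry the weights [n i / N], which sum to 1, so together they cost no
    more than the largest squared mean error, whatever the number of classes. *)
Lemma pooled_cov_near_id s1 s2 : 0 <= s2 ->
  (forall i, dotv (mean_err i) (mean_err i) <= s1) -> frob2 cov_err <= s2 ^+ 2 ->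
  (0 < \sum_i n i)%N ->
  forall v, normv (invmx A0 *m pooled_cov X *m (invmx A0)^T *m v - v) <= (s2 + s1) * normv v.
Proof.
move=> s20 he hV N0 v.
rewrite -[X in _ - X]mul1mx -mulmxBl pooled_cov_whitened mulmxBl mulrDl.
apply: le_trans (normvB _ _) _; apply: lerD.
  apply: le_trans (normv_frob2 _ _) _; rewrite ler_wpM2r ?normv_ge0//.
  by rewrite -(ger0_norm s20) -sqrtr_sqr ler_wsqrtr.
have N0' : 0 < (\sum_i n i)%:R :> R by rewrite ltr0n.
rewrite -scalemxAl normvZ gtr0_norm ?invr_gt0// ler_pdivrMl//.
rewrite mulmx_suml natr_sum mulr_suml.
apply: le_trans (normv_sum _ _) _; apply: ler_sum => i _.
rewrite -scalemxAl normvZ ger0_norm// ler_wpM2l// -mulmxA.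
have -> : (mean_err i)^T *m v = (dotv (mean_err i) v)%:M.
  by rewrite [LHS]mx11_scalar dotvE.
rewrite mul_mx_scalar normvZ.
apply: (@le_trans _ _ (normv (mean_err i) * normv v * normv (mean_err i))).
  by rewrite ler_wpM2r ?normv_ge0// CauchySchwarz_dotv.
by rewrite mulrAC -expr2 sqr_normv ler_wpM2r ?normv_ge0.
Qed.

Lemma pooled_cov_sym : (pooled_cov X)^T = pooled_cov X.
Proof.
rewrite /pooled_cov linearZ/=; congr (_ *: _); rewrite linear_sum/=; apply: eq_bigr => i _.
by rewrite linear_sum/=; apply: eq_bigr => j _; rewrite trmx_mul trmxK.
Qed.

(** Writing [v = S u] turns the form into [<S u, u>], a sum of squares. Nonnegativity allows the
    square roots in the LDA rule to be dropped. *)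
Lemma qform_inv_pooled_cov_ge0 v : pooled_cov X \in unitmx ->
  0 <= qform (invmx (pooled_cov X)) v.
Proof.
move=> S1; rewrite qformE; set u := invmx _ *m v.
have -> : v = pooled_cov X *m u by rewrite /u mulKVmx.
rewrite dotvC /pooled_cov -scalemxAl dotvZr mulr_ge0 ?invr_ge0//.
rewrite mulmx_suml dotvE mulmx_sumr summxE sumr_ge0// => i _.
rewrite mulmx_suml mulmx_sumr summxE sumr_ge0// => j _.
rewrite -mulmxA -dotvE; set y := X j - _.
have -> : y^T *m u = (dotv y u)%:M by rewrite [LHS]mx11_scalar dotvE.
by rewrite mul_mx_scalar dotvZr (dotvC u) -expr2 sqr_ge0.
Qed.

Lemma LDA_rule_le (T : rule R p n) z j : is_LDA_rule T -> pooled_cov X \in unitmx ->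
  qform (invmx (pooled_cov X)) (z - class_mean X (T X z)) <=
  qform (invmx (pooled_cov X)) (z - class_mean X j).
Proof.
move=> [_ hT] S1; have := hT X z S1 j.
by rewrite ler_sqrt// qform_inv_pooled_cov_ge0.
Qed.

End SampleAlgebra.

Section SampleMoments.
Context (R : realType) d (T : measurableType d) (P : probability T R).
Variables (K p : nat) (n : 'I_K -> nat) (mu : 'I_K -> 'cV[R]_p).
Variables (Sigma A0 : 'M[R]_p) (X : T -> sample R p n).
Arguments X : clear implicits.
Hypotheses (posS : posdef Sigma) (A0S : A0 *m A0^T = Sigma).
Hypothesis n0 : forall i, (0 < n i)%N.
Hypothesis lawX : forall i (j : 'I_(n i)), mvnormal P (fun w => X w i j) (mu i) Sigma.
Local Notation I := {l : 'I_K & 'I_(n l)}.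
Hypothesis indX : independent_family P
  (fun a : I => sigma_vec (fun w => X w (tag a) (tagged a))).

Local Notation integ f := (P.-integrable setT (EFin \o f)).
Let N : R := (\sum_i n i)%:R.
Let xi (a : I) k w := std_resid mu A0 (X w) (tagged a) k 0.

Let gens (a : I) : set (set T) :=
  [set A | exists (k : 'I_p) (B : set R),
    measurable B /\ A = (fun w => X w (tag a) (tagged a) k 0) @^-1` B].

Let mX (a : I) : random_vector (fun w => X w (tag a) (tagged a)).
Proof. exact: random_vector_mvnormal (lawX (tagged a)). Qed.

Let gens_sub a : gens a `<=` measurable.
Proof. by move=> _ [k [B [mB ->]]]; exact: measurable_preimageT (mX a k) mB. Qed.

(** The full space is inserted for every other observation. *)
Let indep2 a b : a != b -> independent_sigma P <<s gens a >> <<s gens b >>.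
Proof.
move=> ab A B hA hB.
pose C c := if c == a then A else if c == b then B else setT.
have CE : \bigcap_c C c = A `&` B.
  apply/seteqP; split => w.
    move=> h; have := h a Logic.I; have := h b Logic.I; rewrite /C !eqxx eq_sym (negbTE ab).
    by split.
  by move=> [Aw Bw] c _; rewrite /C; case: ifP => // _; case: ifP.
rewrite -CE indX; last first.
  move=> c; rewrite /C; case: eqP => [->//|_]; case: eqP => [->//|_].
  exact: (@measurableT _ (g_sigma_algebraType (gens c))).
rewrite (bigD1 a)//= (bigD1 b)/= 1?eq_sym//.
rewrite big1 ?mule1 /C ?eqxx ?(eq_sym b) ?(negbTE ab)//.
by move=> c /andP[/negbTE -> /negbTE ->]; rewrite probability_setT.
Qed.

Let mxi a k : measurable_fun [set: g_sigma_algebraType (gens a)] (xi a k).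
Proof.
rewrite /xi /std_resid; under eq_fun do rewrite mxE.
apply: measurable_sum => l; apply: measurable_funM => //.
under eq_fun do rewrite !mxE.
apply: measurable_funD => // _ B mB; rewrite setTI.
by apply: sub_sigma_algebra; exists l, B.
Qed.

(** The rows of the rotation are orthonormal, so the whitened coordinates are linear forms whose
    moments are already known. *)
Let xi_gauss a : exists (M : 'I_p -> 'cV[R]_p) (Z : T -> 'cV[R]_p),
  [/\ std_normal_vector P Z, forall k l, dotv (M k) (M l) = (k == l)%:R &
      forall k, xi a k = fun w => dotv (M k) (Z w)].
Proof.
have [rot [Z [hZ rr uE]]] := whitened_std_normal posS A0S (lawX (tagged a)).
exists (fun k => (row k rot)^T), Z; split => //.
  move=> k l; have := congr1 (fun M : 'M[R]_p => M k l) rr; rewrite !mxE => <-.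
  by apply: eq_bigr => i _; rewrite !mxE.
move=> k; apply/funext => w; rewrite /xi /std_resid uE mxE.
by apply: eq_bigr => i _; rewrite !mxE.
Qed.

Let integ_xi a k : integ (xi a k).
Proof. by have [M [Z [hZ _ ->]]] := xi_gauss a; exact: integrable_dotv hZ (M k). Qed.

Let mean_xi a k : \int[P]_w xi a k w = 0.
Proof. by have [M [Z [hZ _ ->]]] := xi_gauss a; exact: Rintegral_dotv hZ (M k). Qed.

Let integ_xiM a k l : integ (fun w => xi a k w * xi a l w).
Proof. by have [M [Z [hZ _ E]]] := xi_gauss a; rewrite !E; exact: integrable_dotvM hZ _ _. Qed.

Let cov_xi a k l : \int[P]_w (xi a k w * xi a l w) = (k == l)%:R.
Proof. by have [M [Z [hZ MM E]]] := xi_gauss a; rewrite !E (Rintegral_dotvM hZ) MM. Qed.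

Let integ_xiM2 a k l : integ (fun w => (xi a k w * xi a l w) ^+ 2).
Proof. by have [M [Z [hZ _ E]]] := xi_gauss a; rewrite !E; exact: integrable_dotvM_sqr hZ _ _. Qed.

Let C4 : R := 512 * expR (1 / 2).

Let fourth_xi a k l : \int[P]_w (xi a k w * xi a l w) ^+ 2 <= C4.
Proof.
have [M [Z [hZ MM E]]] := xi_gauss a; rewrite !E.
by apply: (Rintegral_dotvM_sqr_le hZ); rewrite MM eqxx.
Qed.

Let integ_cst (r : R) : integ (fun=> r).
Proof. exact: finite_measure_integrable_cst. Qed.

Let Rintegral1 (r : R) : \int[P]_w r = r.
Proof. by rewrite Rintegral_cst//= probability_setT /= mulr1. Qed.

Let indep_prod a b (f g : T -> R) : a != b ->
  measurable_fun [set: g_sigma_algebraType (gens a)] f ->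
  measurable_fun [set: g_sigma_algebraType (gens b)] g ->
  integ f -> integ g ->
  integ (fun w => f w * g w) /\
  \int[P]_w (f w * g w) = (\int[P]_w f w) * (\int[P]_w g w).
Proof.
move=> ab mf mg fi gi; split.
  exact: (integrableM_indep (@gens_sub a) (@gens_sub b) (indep2 ab)).
rewrite /Rintegral (integralM_indep (@gens_sub a) (@gens_sub b) (indep2 ab))//.
by rewrite fineM//; exact: integrable_fin_num.
Qed.

Lemma expectation_mean_err i :
  integ (fun w => dotv (mean_err mu A0 (X w) i) (mean_err mu A0 (X w) i)) /\
  \int[P]_w dotv (mean_err mu A0 (X w) i) (mean_err mu A0 (X w) i) = p%:R / (n i)%:R.
Proof.
have sumk (k : 'I_p) : integ (fun w => (mean_err mu A0 (X w) i k 0) ^+ 2) /\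
    \int[P]_w (mean_err mu A0 (X w) i k 0) ^+ 2 = (n i)%:R^-1.
  have E w : (mean_err mu A0 (X w) i k 0) ^+ 2 =
      (n i)%:R ^- 2 * (\sum_(j < n i) xi (Tagged _ j) k w) ^+ 2.
    by rewrite mean_errE// mxE summxE exprMn exprVn.
  have hi (j j' : 'I_(n i)) : integ (fun w => xi (Tagged _ j) k w * xi (Tagged _ j') k w).
    have [->|jj] := eqVneq j j'; first exact: integ_xiM.
    have ab : Tagged (fun l => 'I_(n l)) j != Tagged (fun l => 'I_(n l)) j' by rewrite eq_Tagged.
    by have [] := indep_prod ab (@mxi _ k) (@mxi _ k) (integ_xi _ k) (integ_xi _ k).
  have h0 (j j' : 'I_(n i)) : j != j' ->
      \int[P]_w (xi (Tagged _ j) k w * xi (Tagged _ j') k w) = 0.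
    move=> jj.
    have ab : Tagged (fun l => 'I_(n l)) j != Tagged (fun l => 'I_(n l)) j' by rewrite eq_Tagged.
    have [_ ->] := indep_prod ab (@mxi _ k) (@mxi _ k) (integ_xi _ k) (integ_xi _ k).
    by rewrite mean_xi mul0r.
  have [h1 h2] := Rintegral_sqr_sum_uncorrelated predT hi h0.
  split.
    under [X in EFin \o X]eq_fun do rewrite E.
    exact: (integrableZl measurableT _ h1).
  under eq_Rintegral do rewrite E.
  rewrite (RintegralZl _ measurableT h1) h2.
  under eq_bigr do [under eq_Rintegral do rewrite expr2; rewrite cov_xi eqxx].
  rewrite sumr_const card_ord /= -[_ *+ n i]/((n i)%:R); field.
  by rewrite pnatr_eq0 -lt0n.
have [h1 h2] := Rintegral_sum (index_enum 'I_p) predT (fun k => (sumk k).1).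
have E w : dotv (mean_err mu A0 (X w) i) (mean_err mu A0 (X w) i) =
    \sum_k (mean_err mu A0 (X w) i k 0) ^+ 2.
  by apply: eq_bigr => k _; rewrite expr2.
split; first by under [X in EFin \o X]eq_fun do rewrite E.
under eq_Rintegral do rewrite E.
rewrite h2; under eq_bigr do rewrite (sumk _).2.
by rewrite sumr_const card_ord -[LHS]mulr_natl.
Qed.

(** Each of the [p ^+ 2] entries is an average of [N] uncorrelated centred products [eta], whose
    second moment is at most the fourth-moment bound [C4]. *)
Lemma expectation_cov_err :
  (0 < \sum_i n i)%N ->
  integ (fun w => frob2 (cov_err mu A0 (X w))) /\
  \int[P]_w frob2 (cov_err mu A0 (X w)) <= p%:R ^+ 2 * C4 / N.
Proof.
move=> N0; have N0' : 0 < N by rewrite ltr0n.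
pose eta k l (a : I) w := xi a k w * xi a l w - (k == l)%:R.
have meta k l a : measurable_fun [set: g_sigma_algebraType (gens a)] (eta k l a).
  by apply: measurable_funB => //; exact: measurable_funM.
have ieta k l a : integ (eta k l a).
  exact: (integrableB measurableT (integ_xiM a k l) (integ_cst _)).
have eta0 k l a : \int[P]_w eta k l a w = 0.
  by rewrite (RintegralB measurableT (integ_xiM a k l) (integ_cst _)) cov_xi Rintegral1 subrr.
have eta2E k l a w : eta k l a w * eta k l a w =
    (xi a k w * xi a l w) ^+ 2 - (2 * (k == l)%:R * (xi a k w * xi a l w) - (k == l)%:R ^+ 2).
  by rewrite /eta; ring.
have i2 k l a : integ (fun w => 2 * (k == l)%:R * (xi a k w * xi a l w) - (k == l)%:R ^+ 2).
  exact: (integrableB measurableT (integrableZl measurableT _ (integ_xiM a k l)) (integ_cst _)).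
have ieta2 k l a : integ (fun w => eta k l a w * eta k l a w).
  under [X in EFin \o X]eq_fun do rewrite eta2E.
  exact: (integrableB measurableT (integ_xiM2 a k l) (i2 k l a)).
have eta2 k l a : \int[P]_w (eta k l a w * eta k l a w) <= C4.
  under eq_Rintegral do rewrite eta2E.
  rewrite (RintegralB measurableT (integ_xiM2 a k l) (i2 k l a)).
  rewrite (RintegralB measurableT (integrableZl measurableT _ (integ_xiM a k l)) (integ_cst _)).
  rewrite (RintegralZl _ measurableT (integ_xiM a k l)) cov_xi Rintegral1.
  have := fourth_xi a k l; have : 0 <= ((k == l)%:R : R) ^+ 2 by exact: sqr_ge0.
  by rewrite expr2; lra.
have sum_tagged (F : forall i, 'I_(n i) -> R) :
    \sum_i \sum_(j < n i) F i j = \sum_(a : I) F (tag a) (tagged a).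
  by rewrite (sig_big_dep predT (fun _ => predT)).
have sum_const (r : R) : \sum_(a : I) r = N * r.
  rewrite -(sum_tagged (fun _ _ => r)) /N natr_sum mulr_suml.
  by apply: eq_bigr => i _; rewrite sumr_const card_ord mulr_natl.
have E w k l : cov_err mu A0 (X w) k l ^+ 2 = N ^- 2 * (\sum_a eta k l a w) ^+ 2.
  rewrite -exprVn -exprMn; congr (_ ^+ 2).
  rewrite /cov_err !mxE summxE sumrB sum_const mulrBr mulKf ?(lt0r_neq0 N0')//.
  congr (_ * _ - _); rewrite -(sum_tagged (fun i j => std_resid mu A0 (X w) j k 0 *
    std_resid mu A0 (X w) j l 0)).
  apply: eq_bigr => i _; rewrite summxE; apply: eq_bigr => j _.
  by rewrite !mxE big_ord1 !mxE.
have entry k l : integ (fun w => cov_err mu A0 (X w) k l ^+ 2) /\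
    \int[P]_w cov_err mu A0 (X w) k l ^+ 2 <= C4 / N.
  have hi a b : integ (fun w => eta k l a w * eta k l b w).
    have [->|ab] := eqVneq a b; first exact: ieta2.
    by have [] := indep_prod ab (meta k l a) (meta k l b) (ieta k l a) (ieta k l b).
  have h0 a b : a != b -> \int[P]_w (eta k l a w * eta k l b w) = 0.
    move=> ab; have [_ ->] := indep_prod ab (meta k l a) (meta k l b) (ieta k l a) (ieta k l b).
    by rewrite eta0 mul0r.
  have [h1 h2] := Rintegral_sqr_sum_uncorrelated predT hi h0.
  split.
    under [X in EFin \o X]eq_fun do rewrite E.
    exact: (integrableZl measurableT _ h1).
  under eq_Rintegral do rewrite E.
  rewrite (RintegralZl _ measurableT h1) h2.
  apply: (@le_trans _ _ (N ^- 2 * \sum_(a : I) C4)).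
    rewrite ler_wpM2l ?invr_ge0 ?sqr_ge0//; apply: ler_sum => a _.
    by under eq_Rintegral do rewrite expr2; exact: eta2.
  by rewrite sum_const le_eqVlt; apply/orP; left; apply/eqP; field; rewrite gt_eqF.
have row_sum k := Rintegral_sum (index_enum 'I_p) predT (fun l => (entry k l).1).
have [h1 h2] := Rintegral_sum (index_enum 'I_p) predT (fun k => (row_sum k).1).
split; first exact: h1.
rewrite /frob2 h2; apply: (@le_trans _ _ (\sum_(k < p) \sum_(l < p) C4 / N)).
  apply: ler_sum => k _; rewrite (row_sum k).2; apply: ler_sum => l _.
  exact: (entry k l).2.
rewrite !sumr_const !card_ord -mulrnA -[leLHS]mulr_natl natrM.
by rewrite le_eqVlt; apply/orP; left; apply/eqP; rewrite expr2 mulrA.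
Qed.

End SampleMoments.

(** * Conditional risk *)

(** [prob_given] is a bare set function; once it is identified with a probability, the Gaussian
    estimates apply to the law of the new observation within a class. *)
Lemma prob_given_probability (R : realType) d (T : measurableType d)
    (P : probability T R) (E : set T) (c : R) :
  measurable E -> 0 < c -> P E = c%:E ->
  exists Q : probability T R, (Q : set T -> \bar R) = prob_given P E.
Proof.
move=> mE c0 PE; have ci0 : 0 <= c^-1 by rewrite invr_ge0 ltW.
pose m : {measure set T -> \bar R} := mscale (NngNum ci0) (mrestr P mE).
have mEq : (m : set T -> \bar R) = prob_given P E.
  by apply/funext => B; rewrite /prob_given PE.
have mT : m setT = 1%E.
  by rewrite mEq /prob_given setTI PE/= -EFinM mulVf// gt_eqF.
pose Q : probability T R := HB.pack (m : set T -> \bar R) (Measure.class m)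
  (Measure_isProbability.Build _ _ _ m mT).
by exists Q; rewrite -mEq.
Qed.

Section ConditionalProbability.
Context (R : realType) d (T : measurableType d) (P : probability T R).
Variables GF GG : set (set T).
Hypotheses (mGF : GF `<=` measurable) (mGG : GG `<=` measurable).
Hypothesis indFG : independent_sigma P <<s GF >> <<s GG >>.
Local Notation TF := (g_sigma_algebraType GF).
Local Notation TG := (g_sigma_algebraType GG).

(* By independence, [w] may be frozen in the first argument while the second
   one is integrated out. *)
Lemma cond_prob_version_indep (S : set (TF * TG)) (g : T -> R) :
  measurable S ->
  cond_prob_version P <<s GF >> [set w | S (w, w)] g ->
  exists2 N, measurable N /\ P N = 0%E &
    forall w, ~ N w -> g w = fine (P [set w' | S (w, w')]).
Proof.
move=> mS [gF gi gE].
pose h w := P [set w' | S (w, w')].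
have mid := measurable_sub_sigma mGF.
pose idF : {mfun T >-> TF} := HB.pack (id : T -> TF) (isMeasurableFun.Build _ _ _ _ _ mid).
have midG := measurable_sub_sigma mGG.
pose idG : {mfun T >-> TG} := HB.pack (id : T -> TG) (isMeasurableFun.Build _ _ _ _ _ midG).
pose pF : probability TF R := distribution P idF.
pose pG : probability TG R := distribution P idG.
have mh : measurable_fun [set: TF] h.
  have := measurable_fun_xsection pG mS.
  apply: eq_measurable_fun => w _; rewrite /= /distribution /pushforward /=.
  by congr (P _); apply/seteqP; split => w' /=; rewrite /xsection /= inE.
have h0 w : (0 <= h w)%E by [].
have mg : measurable_fun [set: TF] g.
  by move=> _ B mB; rewrite setTI; exact: gF.
have giF : pF.-integrable setT (EFin \o g).
  apply/integrableP; split; first exact/measurable_EFinP.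
  rewrite ge0_integral_distribution//.
    by have /integrableP[] := gi.
  by apply/measurableT_comp => //; exact/measurable_EFinP.
have hE G : measurable (G : set TF) -> (\int[P]_(w in G) h w = P ([set w | S (w, w)] `&` G))%E.
  move=> mG; have mGT : measurable (G : set T).
    by have := mid measurableT _ mG; rewrite setTI.
  have mSw w : measurable ([set w' | S (w, w')] : set T).
    have := midG measurableT _ (measurable_preimageT (pair1_measurable (w : TF)) mS).
    by rewrite setTI.
  have mSd : measurable [set w : T | S (w, w)].
    pose diag (w : T) : TF * TG := (w, w).
    have mdiag : measurable_fun setT diag by exact: measurable_fun_pair mid midG.
    exact: measurable_preimageT mdiag mS.
  transitivity (\int[P]_w \int[P]_w' (\1_G w * \1_S (w, w'))%:E)%E.
    rewrite integral_mkcond; apply: eq_integral => w _.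
    have -> : (\int[P]_w' (\1_G w * \1_S (w, w'))%:E =
        (\1_G w)%:E * \int[P]_w' (\1_[set w' | S (w, w')] w')%:E)%E.
      rewrite -ge0_integralZl//.
      by apply/measurable_EFinP; exact: measurable_indic.
    rewrite integral_indic// setIT /patch indicE.
    by case: ifP; rewrite ?mul1e ?mul0e.
  rewrite -(integral_indep mGF mGG indFG (h := fun z => (\1_G z.1 * \1_S z)%:E)); last 2 first.
  - apply/measurable_EFinP/measurable_funM; last exact: measurable_indic.
    by apply: (measurableT_comp _ measurable_fst); exact: measurable_indic.
  - by move=> z; rewrite lee_fin mulr_ge0.
  rewrite -(setIT (_ `&` G)) -[RHS]integral_indic//; last exact: measurableI.
  by apply: eq_integral => w _; rewrite indicI /= mulrC.
(* Both functions are measurable for the sub-sigma-algebra and have the same integral over each of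
   its sets. *)
have ae : ae_eq pF setT (EFin \o g) h.
  apply: (integral_ae_eq measurableT giF mh) => G _ mG.
  have mGT : measurable (G : set T).
    by have := mid measurableT _ mG; rewrite setTI.
  transitivity (\int[P]_(w in G) (g w)%:E)%E.
    rewrite (integral_pushforward mid)//.
      by apply/measurable_EFinP.
    by apply: integrableS gi.
  transitivity (\int[P]_(w in G) h w)%E; last first.
    by rewrite ge0_integral_pushforward//; exact: measurable_funTS.
  by rewrite gE// hE.
have [N [mN N0 gN]] := ae.
exists N.
  split; last by rewrite -N0.
  by have := mid measurableT _ mN; rewrite setTI.
move=> w Nw; have : EFin (g w) = h w.
  by apply: contrapT => ne; apply: Nw; apply: gN => /(_ Logic.I).
by rewrite -/(h w) => <-.
Qed.

End ConditionalProbability.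

Lemma measurable_cond_risk (R : realType) (K p : nat) (n : 'I_K -> nat)
    d (Omega : measurableType d) (P : probability Omega R) (T : rule R p n)
    (X : Omega -> sample R p n) (y : Omega -> 'I_K) (xnew : Omega -> 'cV[R]_p)
    (r : Omega -> R) :
  is_cond_risk P T X y xnew r -> measurable_fun [set: Omega] r.
Proof.
move=> [g [hg rE]]; have -> : r = fun w => \sum_i g i w by apply/funext.
apply: measurable_sum => i; have [_ gi _] := hg i.
by apply/measurable_EFinP; exact: (measurable_int P gi).
Qed.

(** * Risk of the sample rule at a frozen sample, and its tail *)

Section LDARisk.
Context (R : realType) (K p : nat) (n : 'I_K -> nat).
Variables (mu : 'I_K -> 'cV[R]_p) (Sigma : 'M[R]_p).
Context (d : measure_display) (Omega : measurableType d) (P : probability Omega R).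
Variables (X : Omega -> sample R p n) (y : Omega -> 'I_K) (xnew : Omega -> 'cV[R]_p).
Arguments X : clear implicits.
Hypothesis model : gaussian_classes P mu Sigma X y xnew.
Hypothesis K2 : (2 <= K)%N.
Variables (TL : rule R p n) (TO : 'cV[R]_p -> 'I_K) (RL : Omega -> R).
Hypotheses (hTL : is_LDA_rule TL) (hTO : is_optimal_rule mu Sigma TO).
Hypothesis hRL : is_cond_risk P TL X y xnew RL.

Let posS : posdef Sigma. Proof. exact: gc_cov model. Qed.
Let K0 : 0 < K%:R :> R. Proof. by rewrite ltr0n (leq_trans _ K2). Qed.

Let class_prob i : exists Q : probability Omega R,
  (Q : set Omega -> \bar R) = prob_given P [set w | y w = i].
Proof.
apply: (prob_given_probability (c := K%:R^-1)).
- exact: (gc_label_meas model i).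
- by rewrite invr_gt0.
- exact: (gc_prior model i).
Qed.

Let prior_mul i (Q : probability Omega R) (B : set Omega) :
  (Q : set Omega -> \bar R) = prob_given P [set w | y w = i] -> measurable B ->
  fine (P [set w | y w = i /\ B w]) = K%:R^-1 * fine (Q B).
Proof.
move=> QE mB; rewrite QE /prob_given (gc_prior model i) /= invrK.
have mE := gc_label_meas model i.
have fB := fin_num_measure P _ (measurableI _ _ mB mE).
rewrite -(fineK fB) -EFinM /= mulKf ?lt0r_neq0//.
by congr (fine (P _)); apply/seteqP; split => w [].
Qed.

Let law_new i (Q : probability Omega R) :
  (Q : set Omega -> \bar R) = prob_given P [set w | y w = i] ->
  mvnormal Q xnew (mu i) Sigma.
Proof. by move=> ->; exact: (gc_new_law model i). Qed.

Let mxnew : random_vector xnew.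
Proof.
have i : 'I_K by exact: (Ordinal (ltnW K2)).
have [Q QE] := class_prob i; exact: random_vector_mvnormal (law_new QE).
Qed.

Let mX : forall i (j : 'I_(n i)), random_vector (fun w => X w i j).
Proof. by move=> i j; exact: random_vector_mvnormal (gc_sample_law model j). Qed.

Lemma measurable_rule_at (D : sample R p n) i :
  measurable [set w | TL D (xnew w) = i].
Proof.
have [mTL _] := hTL.
apply: (measurable_sigma_gen (phi := fun w => (D, xnew w)) _ (mTL i)).
by case=> [[a c]|c] /=; [exact: measurable_cst|exact: mxnew].
Qed.

Let gens_sample : set (set Omega) :=
  [set A | exists (k : {l : 'I_K & 'I_(n l)} * 'I_p) (B : set R), measurable B /\
    A = (fun w => X w (tag k.1) (tagged k.1) k.2 0) @^-1` B].
Let gens_new : set (set Omega) :=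
  [set A | exists (k : option 'I_p) (B : set R), measurable B /\
    A = (fun w => if k is Some c then xnew w c 0 else (y w)%:R) @^-1` B].

Let gens_sample_sub : gens_sample `<=` measurable.
Proof. by move=> _ [k [B [mB ->]]]; exact: measurable_preimageT (mX (tagged k.1) k.2) mB. Qed.

Let labelE i : [set w | y w = i] = (fun w => (y w)%:R) @^-1` [set i%:R : R].
Proof.
apply/seteqP; split => w /=; first by move=> ->.
by move=> /eqP; rewrite eqr_nat => /eqP yi; exact: val_inj.
Qed.

Let my : measurable_fun [set: Omega] (fun w => (y w)%:R : R).
Proof.
move=> _ B mB; rewrite setTI.
have -> : (fun w => (y w)%:R) @^-1` B =
    \big[setU/set0]_(i < K | `[< B i%:R >]) [set w | y w = i].
  apply/seteqP; split => w /=.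
    by move=> Bw; rewrite (bigD1 (y w)); [left|exact/asboolP].
  suff h : \big[setU/set0]_(i < K | `[< B i%:R >]) [set w | y w = i] `<=`
    [set w | B (y w)%:R] by exact: h.
  apply: (big_ind (fun V : set Omega => V `<=` _)) => //.
    by move=> U V hU hV z [/hU|/hV].
  by move=> i /asboolP Bi z /= ->.
by apply: bigsetU_measurable => i _; exact: (gc_label_meas model i).
Qed.

Let gens_new_sub : gens_new `<=` measurable.
Proof.
move=> _ [k [B [mB ->]]]; apply: measurable_preimageT mB.
by case: k => [c|]; [exact: mxnew|exact: my].
Qed.

Let measurable_err_pair i :
  measurable ([set z | y z.2 = i /\ TL (X z.1) (xnew z.2) <> i] :
    set (g_sigma_algebraType gens_sample * g_sigma_algebraType gens_new)).
Proof.
have [mTL _] := hTL.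
apply: measurableI.
  have m1 : measurable ([set w | y w = i] : set (g_sigma_algebraType gens_new)).
    by rewrite labelE; apply: sub_sigma_algebra; exists None, [set i%:R].
  exact: (measurable_preimageT measurable_snd m1).
apply: measurableC.
apply: (measurable_sigma_gen (phi := fun z : g_sigma_algebraType gens_sample *
  g_sigma_algebraType gens_new => (X z.1, xnew z.2)) _ (mTL i)).
case=> [[a c]|c] /=.
  apply: (measurableT_comp (f := (fun w => X w (tag a) (tagged a) c 0) :
    g_sigma_algebraType gens_sample -> R) _ measurable_fst).
  by move=> _ B mB; rewrite setTI; apply: sub_sigma_algebra; exists (a, c), B.
apply: (measurableT_comp (f := (fun w => xnew w c 0) :
  g_sigma_algebraType gens_new -> R) _ measurable_snd).
by move=> _ B mB; rewrite setTI; apply: sub_sigma_algebra; exists (Some c), B.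
Qed.

(** Each class contributes one null set outside which its conditional probability is computed with
    the sample frozen; their finite union is null. *)
Lemma cond_riskE_ae : exists2 N0, measurable N0 /\ P N0 = 0%E &
  forall w, ~ N0 w -> RL w =
    \sum_i fine (P [set w' | y w' = i /\ TL (X w) (xnew w') <> i]).
Proof.
have [g [hg RE]] := hRL.
have each i : exists N, [/\ measurable N, P N = 0%E & forall w, ~ N w ->
    g i w = fine (P [set w' | y w' = i /\ TL (X w) (xnew w') <> i])].
  have [N [mN N0] gN] := cond_prob_version_indep gens_sample_sub gens_new_sub
    (gc_new_indep model) (measurable_err_pair i) (hg i).
  by exists N; split.
have [N hN] := choice each.
exists (\big[setU/set0]_i N i).
  apply: (big_ind (fun V => measurable V /\ P V = 0%E)).
  - by rewrite measure0; split.
  - move=> U V [mU U0] [mV V0]; split; first exact: measurableU.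
    apply/eqP; rewrite eq_le measure_ge0 andbT.
    have PUV : (P U + P V <= 0)%E by rewrite U0 V0 adde0.
    exact: le_trans (measureU2 P mU mV) PUV.
  - by move=> i _; have [] := hN i.
move=> w Nw; rewrite RE; apply: eq_bigr => i _.
have [_ _ ->//] := hN i => Ni; apply: Nw.
by rewrite (bigD1 i)//=; left.
Qed.

Let err_le0 i : 0 <= fine (P [set w | y w = i /\ TO (xnew w) <> i]).
Proof. exact: prb_ge0. Qed.

Let measurable_errO i : measurable [set w | TO (xnew w) <> i].
Proof.
by apply: measurableC; exact: (measurable_sigma_vec mxnew (hTO.1 i)).
Qed.

Let dist_root A0 (A0S : A0 *m A0^T = Sigma) i j :
  normv (invmx A0 *m (mu j - mu i)) ^+ 2 = qform (invmx Sigma) (mu j - mu i).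
Proof. by rewrite (qform_pair_dist mu posS A0S). Qed.

Variables (A0 : 'M[R]_p) (s Mn Mx c1 : R).
Hypothesis A0S : A0 *m A0^T = Sigma.
Hypotheses (c10 : 0 < c1) (c1Mn : c1 <= Mn).
Hypothesis dist_bounds : forall i j : 'I_K, i != j ->
  Mn <= qform (invmx Sigma) (mu i - mu j) <= Mx.

Let D0 i j : j != i -> 0 < normv (invmx A0 *m (mu j - mu i)).
Proof.
move=> ji; have /andP[h _] := dist_bounds ji.
rewrite lt_neqAle normv_ge0 andbT eq_sym; apply/eqP => n0.
have := dist_root A0S i j; rewrite n0 expr0n/=.
by have := c10; have := c1Mn; lra.
Qed.

Lemma opt_risk_gt0 : 0 < risk P TO y xnew.
Proof.
pose i : 'I_K := Ordinal (ltnW K2); pose j : 'I_K := Ordinal K2.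
have ji : j != i by [].
have [Q QE] := class_prob i.
rewrite /risk (bigD1 i)//= ltr_pwDl ?sumr_ge0//.
rewrite (prior_mul QE (measurable_errO i)) mulr_gt0 ?invr_gt0//.
exact: (opt_error_gt0 posS A0S (law_new QE) (hTO.1 i) hTO.2 (D0 ji)).
Qed.

Hypotheses (s0 : 0 < s) (s24 : s <= 1 / 24) (sMx : s * Mx <= 1 / 2).

Let Mx_ge : Mn <= Mx.
Proof.
pose i : 'I_K := Ordinal (ltnW K2); pose j : 'I_K := Ordinal K2.
have ji : j != i by [].
have h := dist_bounds ji; case/andP: h => h1 h2; exact: le_trans h1 h2.
Qed.

(** The mean errors are measured against [Mn], hence against every pairwise distance. Their squares
    add at most [s ^+ 2 * Mn <= s] to the covariance error, so [class_error] is applied at level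
    [2 * s], which [s <= 1 / 24] keeps below [1 / 12]. *)
Lemma risk_at_sample_le (D : sample R p n) :
  (forall i, dotv (mean_err mu A0 D i) (mean_err mu A0 D i) <= s ^+ 2 * Mn) ->
  frob2 (cov_err mu A0 D) <= s ^+ 2 ->
  `|\sum_i fine (P [set w | y w = i /\ TL D (xnew w) <> i]) - risk P TO y xnew| <=
  K%:R * (wedge_const 24 3 (Num.sqrt c1) * (2 * s * Mx)) * risk P TO y xnew.
Proof.
move=> he hf; rewrite /risk -sumrB mulr_sumr.
apply: le_trans (ler_norm_sum _ _ _) _; apply: ler_sum => i _.
have [Q QE] := class_prob i.
have mTLi := measurable_rule_at D i.
rewrite (prior_mul QE (measurable_errO i)) (prior_mul QE (measurableC mTLi)).
rewrite -mulrBr normrM gtr0_norm ?invr_gt0// mulrCA ler_wpM2l ?invr_ge0 ?(ltW K0)//.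
have Mn0 : 0 < Mn by have := c10; have := c1Mn; lra.
have Mx0 : 0 < Mx by have := Mx_ge; lra.
have s0' := s0.
have n0 := gc_size model.
have N0 : (0 < \sum_i n i)%N by rewrite (bigD1 i)//= addn_gt0 n0.
have sMn : s * Mn <= 1.
  apply: (@le_trans _ _ (s * Mx)); first by rewrite ler_wpM2l// ltW.
  by have := sMx; lra.
have near_id v : normv (invmx A0 *m pooled_cov D *m (invmx A0)^T *m v - v) <=
    2 * s * normv v.
  apply: le_trans (pooled_cov_near_id n0 (ltW s0) he hf N0 v) _.
  rewrite ler_wpM2r ?normv_ge0// expr2 -mulrA.
  have : s * (s * Mn) <= s * 1 by rewrite ler_wpM2l// ltW.
  by lra.
have A1 := root_unitmx posS A0S.
have s2 : 0 < 2 * s <= 1 / 12 by apply/andP; have := s24; split; lra.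
have S1 : pooled_cov D \in unitmx.
  by apply: (near_id_cov_unitmx near_id); case/andP: s2.
apply: (class_error posS A0S (law_new QE) (hTO.1 i) mTLi hTO.2
  (xbar := class_mean D) (pooled_cov_sym D) near_id s2 (ltW Mx0)) => //.
- by have := sMx; lra.
- by move=> z j; exact: LDA_rule_le.
- move=> j ji; rewrite (dist_root A0S); have /andP[h1 h2] := dist_bounds ji.
  by rewrite h2 andbT (le_trans c1Mn).
- move=> j k ji; have /andP[h1 _] := dist_bounds ji.
  apply: (@le_trans _ _ (s * normv (invmx A0 *m (mu j - mu i)))); last first.
    by rewrite ler_wpM2r ?normv_ge0//; lra.
  rewrite -ler_sqr ?nnegrE ?mulr_ge0 ?normv_ge0 ?(ltW s0)//.
  rewrite exprMn (dist_root A0S) sqr_normv; apply: le_trans (he k) _.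
  by rewrite ler_wpM2l ?sqr_ge0.
Qed.

(** The exceptional event is covered by a null set and two Markov events. One of these controls the
    sum of the squared mean errors, and thereby all classes at once. *)
Lemma LDA_risk_ratio_tail :
  (P [set w | (K%:R * (wedge_const 24 3 (Num.sqrt c1) * (2 * s * Mx)) <
               `|RL w / risk P TO y xnew - 1|)%R] <=
   ((s ^+ 2 * Mn)^-1 * (\sum_i p%:R / (n i)%:R) +
    (s ^+ 2)^-1 * (p%:R ^+ 2 * (512 * expR (1 / 2)) / (\sum_i n i)%:R))%:E)%E.
Proof.
have n0 := gc_size model.
pose i0 : 'I_K := Ordinal (ltnW K2).
have N0 : (0 < \sum_i n i)%N by rewrite (bigD1 i0)//= addn_gt0 n0.
have s2 : 0 < s ^+ 2 by rewrite exprn_gt0.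
have Mn0 : 0 < Mn by have := c10; have := c1Mn; lra.
pose e2 i w := dotv (mean_err mu A0 (X w) i) (mean_err mu A0 (X w) i).
pose f2 w := frob2 (cov_err mu A0 (X w)).
have e2_ge0 i w : 0 <= e2 i w by exact: dotvv_ge0.
have f2_ge0 w : 0 <= f2 w.
  by apply: sumr_ge0 => a _; apply: sumr_ge0 => b _; exact: sqr_ge0.
have me i := expectation_mean_err posS A0S n0 (gc_sample_law model) (gc_sample_indep model) i.
have [if2 mf2] := expectation_cov_err posS A0S (gc_sample_law model) (gc_sample_indep model) N0.
have [ie2 me2] := Rintegral_sum (index_enum 'I_K) predT (fun i => (me i).1).
have tail1 := markov_Rintegral (fun w => sumr_ge0 _ (fun i _ => e2_ge0 i w)) ie2 (mulr_gt0 s2 Mn0).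
have tail2 := markov_Rintegral f2_ge0 if2 s2.
set T1 := [set w | _] in tail1; set T2 := [set w | _] in tail2.
have [N [mN PN0] RLE] := cond_riskE_ae.
have r0 := opt_risk_gt0.
have mT1 : measurable T1.
  by apply: measurable_ltrT => //; apply/measurable_EFinP; exact: (measurable_int P ie2).
have mT2 : measurable T2.
  by apply: measurable_ltrT => //; apply/measurable_EFinP; exact: (measurable_int P if2).
have mRL := measurable_cond_risk hRL.
apply: (@le_trans _ _ (P (N `|` (T1 `|` T2)))).
  apply: le_measure; rewrite ?inE.
  - apply: measurable_ltrT => //; apply: measurableT_comp => //.
    by apply: measurable_funB => //; exact: measurable_funM.
  - by apply: measurableU => //; exact: measurableU.
  move=> w /= hw; have [Nw|Nw] := pselect (N w); first by left.
  right; apply: contrapT => /not_orP[nT1 nT2].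
  have he i : e2 i w <= s ^+ 2 * Mn.
    apply: (@le_trans _ _ (\sum_i e2 i w)).
      by rewrite (bigD1 i)//= lerDl sumr_ge0.
    by rewrite leNgt; apply/negP.
  have hf : f2 w <= s ^+ 2 by rewrite leNgt; apply/negP.
  have := risk_at_sample_le he hf; rewrite -(RLE w Nw) => h.
  move: hw; apply/negP; rewrite -leNgt.
  have -> : RL w / risk P TO y xnew - 1 = (RL w - risk P TO y xnew) / risk P TO y xnew.
    by rewrite mulrBl divff// gt_eqF.
  by rewrite normrM (gtr0_norm (_ : 0 < (risk P TO y xnew)^-1)) ?invr_gt0// ler_pdivrMr.
apply: le_trans (measureU2 P mN (measurableU _ _ mT1 mT2)) _.
have -> : (P N + P (T1 `|` T2) = P (T1 `|` T2))%E by rewrite PN0 add0e.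
apply: le_trans (measureU2 P mT1 mT2) _.
rewrite EFinD; apply: leeD.
  apply: le_trans tail1 _; rewrite lee_fin me2.
  by rewrite (eq_bigr _ (fun i _ => (me i).2)).
by apply: le_trans tail2 _; rewrite lee_fin ler_wpM2l ?invr_ge0 ?(ltW s2).
Qed.

End LDARisk.

(** * Rates *)

(** [inf] and [sup] act as bounds only on sets bounded on the relevant side: 0 is a lower bound, and
    the sum over all pairs an upper one. *)
Lemma pair_dists_bounds (R : realType) (K p : nat) (mu : 'I_K -> 'cV[R]_p)
    (Sigma A0 : 'M[R]_p) (i j : 'I_K) :
  posdef Sigma -> A0 *m A0^T = Sigma -> i != j ->
  M_min mu Sigma <= qform (invmx Sigma) (mu i - mu j) <= M_max mu Sigma.
Proof.
move=> posS A0S ij; have q0 k l : 0 <= qform (invmx Sigma) (mu l - mu k).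
  by rewrite (qform_pair_dist mu posS A0S) sqr_ge0.
have memij : pair_dists mu Sigma (qform (invmx Sigma) (mu i - mu j)).
  by exists j, i; rewrite eq_sym.
apply/andP; split.
  by apply: ge_inf memij; exists 0 => _ [k [l [_ ->]]].
apply: ub_le_sup memij.
exists (\sum_k \sum_l qform (invmx Sigma) (mu l - mu k)) => _ [k [l [_ ->]]].
rewrite (bigD1 k)//= (bigD1 l)//= -addrA lerDl addr_ge0 ?sumr_ge0// => h _.
exact: sumr_ge0.
Qed.

Lemma bigmin_nat_gt0 (K m : nat) (n : 'I_K -> nat) :
  (0 < m)%N -> (forall i, 0 < n i)%N -> (0 < \big[minn/m]_(i < K) n i)%N.
Proof.
move=> m0 n0; apply: (big_ind (fun k => 0 < k)%N) => // a b a0 b0.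
by rewrite leq_min a0.
Qed.

Lemma bigmin_nat_le (K m : nat) (n : 'I_K -> nat) i :
  (\big[minn/m]_(i < K) n i <= n i)%N.
Proof.
have : i \in index_enum 'I_K by exact: mem_index_enum.
elim: (index_enum 'I_K) => // a s IH; rewrite inE big_cons => /orP[/eqP <-|/IH].
  exact: geq_minl.
exact: leq_trans (geq_minr _ _).
Qed.

Section Rates.
Variable R : realType.

Lemma le_sqrt_mul_ln (u : R) : 0 < u -> u <= (expR 1)^-1 ->
  u <= Num.sqrt (u * ln u^-1).
Proof.
move=> u0 ue; have lnu : 1 <= ln u^-1.
  rewrite -[leLHS](expRK (1 : R)) ler_ln ?posrE ?expR_gt0 ?invr_gt0//.
  by rewrite -[leLHS]invrK lef_pV2 ?posrE ?invr_gt0 ?expR_gt0.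
have u1 : u <= 1.
  by apply: le_trans ue _; rewrite invf_le1 ?expR_gt0// -expR0 ler_expR.
rewrite -[leLHS](ger0_norm (ltW u0)) -sqrtr_sqr ler_wsqrtr// expr2.
by rewrite ler_wpM2l ?(ltW u0)// (le_trans u1).
Qed.

Variables (K p : nat) (n : 'I_K -> nat) (mu : 'I_K -> 'cV[R]_p) (Sigma : 'M[R]_p).
Let N : R := (\sum_i n i)%:R.
Hypotheses (K0 : (0 < K)%N) (N0 : 0 < N) (Mn0 : 0 < M_min mu Sigma).
Hypothesis lnp : 1 <= ln (p%:R : R).

Let p0 : 0 < p%:R :> R.
Proof.
rewrite lt_neqAle ler0n andbT; apply/eqP => p0.
by have := lnp; rewrite -p0 ln0//; lra.
Qed.

Let term1 : 0 < p%:R * Num.sqrt (ln p%:R / N).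
Proof. by rewrite mulr_gt0// sqrtr_gt0 divr_gt0// (lt_le_trans ltr01). Qed.

Let term2 : 0 < K%:R / Num.sqrt (M_min mu Sigma) * Num.sqrt (p%:R / N).
Proof. by rewrite mulr_gt0 ?sqrtr_gt0 ?divr_gt0 ?sqrtr_gt0 ?(ltr0n _ K). Qed.

Lemma s_rate_gt0 : 0 < s_rate n mu Sigma.
Proof. exact: addr_gt0. Qed.

(** The first term of the rate dominates the covariance variance, as [ln p >= 1]; the next lemma
    does the same for the class means with the second term. *)
Lemma s_rate_sqr_ge_dim : p%:R ^+ 2 / N <= s_rate n mu Sigma ^+ 2.
Proof.
apply: (@le_trans _ _ ((p%:R * Num.sqrt (ln p%:R / N)) ^+ 2)); last first.
  by rewrite ler_sqr ?nnegrE ?(ltW s_rate_gt0) ?(ltW term1)// lerDl ltW.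
rewrite exprMn sqr_sqrtr ?divr_ge0 ?(ltW N0) ?(le_trans ler01)//.
by rewrite ler_wpM2l ?sqr_ge0// ler_pdivlMr// mulVf// gt_eqF.
Qed.

Lemma s_rate_sqr_ge_classes :
  K%:R ^+ 2 / M_min mu Sigma * (p%:R / N) <= s_rate n mu Sigma ^+ 2.
Proof.
apply: (@le_trans _ _ ((K%:R / Num.sqrt (M_min mu Sigma) * Num.sqrt (p%:R / N)) ^+ 2)).
  rewrite !exprMn exprVn !sqr_sqrtr ?divr_ge0 ?(ltW N0) ?(ltW Mn0)//.
by rewrite ler_sqr ?nnegrE ?(ltW s_rate_gt0) ?(ltW term2)// lerDr ltW.
Qed.

End Rates.

(** * Tail bound at the stated rate *)

Section Tail.
Context (R : realType) (K p : nat) (n : 'I_K -> nat).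
Variables (mu : 'I_K -> 'cV[R]_p) (Sigma : 'M[R]_p).
Context (d : measure_display) (Omega : measurableType d) (P : probability Omega R).
Variables (X : Omega -> sample R p n) (y : Omega -> 'I_K) (xnew : Omega -> 'cV[R]_p).
Variables (TL : rule R p n) (TO : 'cV[R]_p -> 'I_K) (RL : Omega -> R).
Variables (c1 c2 Ce : R).
Let N : R := (\sum_i n i)%:R.
Let sn := s_rate n mu Sigma.
Let u := M_max mu Sigma * sn.

(** The error level is [s = Ce * sn]. Both Markov bounds then scale as [Ce ^- 2], while the
    threshold grows only linearly in [Ce]. *)
Lemma LDA_risk_ratio_rate :
  gaussian_classes P mu Sigma X y xnew -> (2 <= K)%N ->
  is_LDA_rule TL -> is_optimal_rule mu Sigma TO ->
  is_cond_risk P TL X y xnew RL ->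
  0 < c1 -> c1 <= M_min mu Sigma -> 0 < Ce ->
  ((\big[minn/(\sum_i n i)%N]_i n i)%:R : R)^-1 <= c2 * (K%:R / N) ->
  1 <= ln (p%:R : R) -> sn <= Ce^-1 / 24 -> u <= Ce^-1 / 2 -> u <= (expR 1)^-1 ->
  (P [set w | (2 * wedge_const 24 3 (Num.sqrt c1) * Ce * lda_rate n mu Sigma <
               `|RL w / risk P TO y xnew - 1|)%R] <=
   ((c2 + 512 * expR (1 / 2)) / Ce ^+ 2)%:E)%E.
Proof.
move=> model K2 hTL hTO hRL c10 c1M Ce0 hn lnp hs hu1 hu2.
set C := wedge_const _ _ _; set C4 := 512 * _.
pose i0 : 'I_K := Ordinal (ltnW K2); pose j0 : 'I_K := Ordinal K2.
have n0 := gc_size model.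
have Nn0 : (0 < \sum_i n i)%N by rewrite (bigD1 i0)//= addn_gt0 n0.
have N0 : 0 < N by rewrite ltr0n.
have Mn0 : 0 < M_min mu Sigma by lra.
have K0 : 0 < K%:R :> R by rewrite ltr0n ltnW.
have [A0 [_ [A0S _ _]]] := gc_new_law model i0.
have posS := gc_cov model.
have hd i j : i != j -> M_min mu Sigma <= qform (invmx Sigma) (mu i - mu j) <= M_max mu Sigma.
  exact: pair_dists_bounds posS A0S.
have Mx0 : 0 < M_max mu Sigma.
  by have /hd/andP[h1 h2] : i0 != j0 by []; lra.
have sn0 : 0 < sn by exact: s_rate_gt0 (ltnW K2) N0 Mn0 lnp.
have u0 : 0 < u by exact: mulr_gt0.
have s0 : 0 < Ce * sn by exact: mulr_gt0.
have s24 : Ce * sn <= 1 / 24.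
  by rewrite mulrC -ler_pdivlMr// (le_trans hs)// mulrC mul1r.
have sM : Ce * sn * M_max mu Sigma <= 1 / 2.
  rewrite -mulrA (mulrC sn) (mulrC Ce) -ler_pdivlMr//; apply: le_trans hu1 _.
  by rewrite mulrC mul1r.
have C0 : 0 <= C.
  by apply/ltW/wedge_const_gt0; rewrite sqrtr_gt0.
have tail := LDA_risk_ratio_tail model K2 hTL hTO hRL A0S c10 c1M hd s0 s24 sM.
have le_thr : K%:R * (C * (2 * (Ce * sn) * M_max mu Sigma)) <=
    2 * C * Ce * lda_rate n mu Sigma.
  rewrite (_ : _ * _ = 2 * C * Ce * (K%:R * u)); last by rewrite /u; ring.
  rewrite ler_wpM2l ?mulr_ge0 ?(ltW Ce0)// /lda_rate expr2 -mulrA.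
  rewrite ler_wpM2l ?(ltW K0)// -[leLHS]mul1r ler_pM ?(ltW u0)//.
    by rewrite ler1n ltnW.
  exact: le_sqrt_mul_ln.
have mR : measurable_fun [set: Omega] (fun w => `|RL w / risk P TO y xnew - 1|).
  apply: measurableT_comp => //; apply: measurable_funB => //.
  by apply: measurable_funM => //; exact: measurable_cond_risk hRL.
apply: le_trans (_ : _ <= P [set w | (K%:R * (C * (2 * (Ce * sn) * M_max mu Sigma)) <
    `|RL w / risk P TO y xnew - 1|)%R])%E _.
  apply: le_measure; rewrite ?inE; try exact: measurable_ltrT.
  by move=> w /=; exact: le_lt_trans.
apply: le_trans tail _; rewrite lee_fin [leRHS]mulrDl exprMn; apply: lerD.
  (* The balance condition bounds each [1 / n i] by [c2 * K / N]; summing over the classes supplies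
     the second factor [K]. *)
  have le_sum : \sum_i p%:R / (n i)%:R <= K%:R * (p%:R * (c2 * (K%:R / N))) :> R.
    rewrite -[X in X%:R * _](card_ord K) -sum1_card natr_sum mulr_suml.
    apply: ler_sum => i _; rewrite mul1r ler_wpM2l//.
    apply: le_trans hn; rewrite lef_pV2 ?posrE ?ltr0n// ?bigmin_nat_gt0//.
    by rewrite ler_nat bigmin_nat_le.
  apply: (@le_trans _ _ ((Ce ^+ 2 * sn ^+ 2 * M_min mu Sigma)^-1 *
      (K%:R * (p%:R * (c2 * (K%:R / N)))))).
    rewrite ler_wpM2l// invr_ge0 mulr_ge0 ?(ltW Mn0)// mulr_ge0 ?sqr_ge0//.
  rewrite [leLHS](_ : _ = c2 / Ce ^+ 2 *
    ((K%:R ^+ 2 / M_min mu Sigma * (p%:R / N)) / sn ^+ 2)); last first.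
    by field; rewrite !gt_eqF.
  have c20 : 0 <= c2.
    have : 0 <= c2 * (K%:R / N) by apply: le_trans hn; rewrite invr_ge0.
    by rewrite pmulr_lge0// divr_gt0.
  rewrite -[leRHS]mulr1 ler_wpM2l ?divr_ge0 ?sqr_ge0//.
  by rewrite ler_pdivrMr ?exprn_gt0// mul1r s_rate_sqr_ge_classes// ltnW.
rewrite -/C4 [leLHS](_ : _ = C4 / Ce ^+ 2 * ((p%:R ^+ 2 / N) / sn ^+ 2)); last first.
  by field; rewrite !gt_eqF.
rewrite -[leRHS]mulr1 ler_wpM2l ?divr_ge0 ?sqr_ge0 ?mulr_ge0 ?expR_ge0//.
by rewrite ler_pdivrMr ?exprn_gt0// mul1r s_rate_sqr_ge_dim// ltnW.
Qed.

End Tail.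

(** Eventually [C * a t] is below any fixed [e], so the tail at [e] is contained in the tail at
    [C * a t]; measurability makes [P] monotone on these events. *)
Lemma op1_Op (R : realType) (d : nat -> measure_display)
    (Omega : forall t, measurableType (d t))
    (P : forall t, probability (Omega t) R)
    (Z : forall t, Omega t -> R) (a : nat -> R) :
  (forall t, measurable_fun [set: Omega t] (Z t)) ->
  a t @[t --> \oo] --> (0 : R) -> Op P Z a -> op1 P Z.
Proof.
move=> mZ a0 OpZ e e0.
have mS t r : measurable [set w | r < `|Z t w|].
  by apply: measurable_ltrT => //; exact: measurableT_comp.
apply/fine_cvgP; split; first by near=> t; exact: fin_num_measure.
apply/cvgr0Pnorm_lt => e' e'0.
have [|C [C0 hC]] := OpZ (e' / 2); first by rewrite divr_gt0.
have small : \forall t \near \oo, a t < e / C.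
  by apply: cvgr_lt a0 _ _; rewrite divr_gt0.
near=> t; rewrite /= ger0_norm ?fine_ge0//.
apply: (@le_lt_trans _ _ (e' / 2)); last by lra.
rewrite -lee_fin fineK ?fin_num_measure//.
apply: (@le_trans _ _ (P t [set w | (C * a t < `|Z t w|)%R])); last by near: t.
apply: le_measure; rewrite ?inE// => w /=; apply: le_lt_trans.
by rewrite mulrC -ler_pdivlMr// ltW//; near: t.
Unshelve. all: by end_near. Qed.

(* Everything is indexed by t; the total sample size at stage t is
   \sum_(i < K t) n t i. *)
Theorem theorem4p2 (R : realType) (K p : nat -> nat)
    (n : forall t, 'I_(K t) -> nat)
    (mu : forall t, 'I_(K t) -> 'cV[R]_(p t))
    (Sigma : forall t, 'M[R]_(p t))
    (d : nat -> measure_display) (Omega : forall t, measurableType (d t))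
    (P : forall t, probability (Omega t) R)
    (X : forall t, Omega t -> sample R (p t) (n t))
    (y : forall t, Omega t -> 'I_(K t))
    (xnew : forall t, Omega t -> 'cV[R]_(p t))
    (T_LDA : forall t, rule R (p t) (n t))
    (T_OPT : forall t, 'cV[R]_(p t) -> 'I_(K t))
    (R_LDA : forall t, Omega t -> R)
    (c0 c1 c2 : R)
    (hK : forall t, (2 <= K t)%N)
    (hmodel : forall t, gaussian_classes (P t) (mu t) (Sigma t)
                          (X t) (y t) (xnew t))
    (hn_infty : (\sum_(i < K t) n t i)%N @[t --> \oo] --> \oo)
    (hp_infty : p t @[t --> \oo] --> \oo)
    (hLDA : forall t, is_LDA_rule (T_LDA t))
    (hOPT : forall t, is_optimal_rule (mu t) (Sigma t) (T_OPT t))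
    (hrisk : forall t, is_cond_risk (P t) (T_LDA t) (X t) (y t) (xnew t)
                         (R_LDA t))
    (hi : forall t, c0^-1 <= lambda_min (Sigma t) /\
                    lambda_min (Sigma t) <= lambda_max (Sigma t) /\
                    lambda_max (Sigma t) <= c0)
    (hc1 : 0 < c1)
    (hii : forall t, c1 <= M_min (mu t) (Sigma t))
    (hiii : forall t,
       ((\big[minn/(\sum_(i < K t) n t i)%N]_(i < K t) n t i)%:R : R)^-1 <=
       c2 * ((K t)%:R / (\sum_(i < K t) n t i)%:R))
    (hiv : forall t, (K t <= p t + 1)%N)
    (hs : s_rate (n t) (mu t) (Sigma t) @[t --> \oo] --> (0 : R))
    (* the rate is sqrt(u log(1/u)) with u -> 0; without this, Num.sqrt and
       ln would make the rate vanish also when u >= 1 or u -> 1 *)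
    (hu : M_max (mu t) (Sigma t) * s_rate (n t) (mu t) (Sigma t)
            @[t --> \oo] --> (0 : R))
    (hrate : lda_rate (n t) (mu t) (Sigma t) @[t --> \oo] --> (0 : R)) :
  let Z := fun t w =>
    R_LDA t w / risk (P t) (T_OPT t) (y t) (xnew t) - 1 in
  op1 P Z /\ Op P Z (fun t => lda_rate (n t) (mu t) (Sigma t)).
Proof.
move=> Z; suff OpZ : Op P Z (fun t => lda_rate (n t) (mu t) (Sigma t)).
  split=> //; apply: op1_Op hrate OpZ => t.
  apply: measurable_funB => //; apply: measurable_funM => //.
  exact: measurable_cond_risk (hrisk t).
move=> e e0; pose C4 : R := 512 * expR (1 / 2).
have C40 : 0 < C4 by rewrite mulr_gt0// expR_gt0.
have c2C4 : 0 < `|c2| + C4 by rewrite ltr_wpDl.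
(* Chosen so that the tail bound is at most [e]; the absolute value makes the radicand positive
   without a prior sign for [c2]. *)
pose Ce := Num.sqrt ((`|c2| + C4) / e).
have Ce0 : 0 < Ce by rewrite sqrtr_gt0 divr_gt0.
have CeE : (c2 + C4) / Ce ^+ 2 <= e.
  rewrite sqr_sqrtr ?divr_ge0 ?(ltW e0) ?(ltW c2C4)// ler_pdivrMr ?divr_gt0//.
  by rewrite mulrC divfK ?gt_eqF// lerD2r ler_norm.
exists (2 * wedge_const 24 3 (Num.sqrt c1) * Ce); split.
  by rewrite !mulr_gt0// wedge_const_gt0// sqrtr_gt0.
(* Eventually [p t >= expR 1], which gives [1 <= ln p]. *)
have he : \forall t \near \oo, (Num.bound (expR 1 : R) <= p t)%N.
  by move/cvgnyPge: hp_infty; exact.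
have hs' : \forall t \near \oo, s_rate (n t) (mu t) (Sigma t) < Ce^-1 / 24.
  by apply: cvgr_lt hs _ _; rewrite divr_gt0 ?invr_gt0.
have hu1 : \forall t \near \oo,
    M_max (mu t) (Sigma t) * s_rate (n t) (mu t) (Sigma t) < Ce^-1 / 2.
  by apply: cvgr_lt hu _ _; rewrite divr_gt0 ?invr_gt0.
have hu2 : \forall t \near \oo,
    M_max (mu t) (Sigma t) * s_rate (n t) (mu t) (Sigma t) < (expR 1)^-1.
  by apply: cvgr_lt hu _ _; rewrite invr_gt0 expR_gt0.
near=> t.
apply: le_trans (_ : _ <= ((c2 + C4) / Ce ^+ 2)%:E)%E _; last by rewrite lee_fin.
apply: (LDA_risk_ratio_rate (hmodel t) (hK t) (hLDA t) (hOPT t) (hrisk t) hc1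
  (hii t) Ce0 (hiii t)).
- have h : expR 1 <= (p t)%:R :> R.
    apply: (@le_trans _ _ (Num.bound (expR 1 : R))%:R); first by rewrite ltW// archi_boundP ?expR_ge0.
    by rewrite ler_nat; near: t.
  by rewrite -[leLHS](expRK (1 : R)) ler_ln ?posrE ?expR_gt0// (lt_le_trans _ h) ?expR_gt0.
- by apply: ltW; near: t.
- by apply: ltW; near: t.
- by apply: ltW; near: t.
Unshelve. all: by end_near. Qed.
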